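(* Let $\mathcal{D}$ be a unitary multifusion category. For a left $\mathcal{D}$-module category $\mathcal{M}$, the left boundary tube algebra $$\tilde{\mathbf{L}}({}_{\mathcal{D}}\mathcal{M})=\bigoplus_{a\in\mathrm{Irr}(\mathcal{D});\,d,e,f,g\in\mathrm{Irr}(\mathcal{M})}\mathrm{Hom}_{\mathcal{M}}(d,a\otimes e)\otimes\mathrm{Hom}_{\mathcal{M}}(a\otimes f,g)$$ is a $C^*$ weak Hopf algebra with the following structure ($\nu\in\mathrm{Hom}(d,a\otimes e)$, $\zeta\in\mathrm{Hom}(a\otimes f,g)$): unit $1=\sum_{x,y}\mathrm{id}_y\otimes\mathrm{id}_x$, over pairs $x,y\in\mathrm{Irr}(\mathcal{M})$ with $\mathbf{1}_i\otimes x\neq0\neq\mathbf{1}_i\otimes y$ for a common $i$ (the summand has $a=\mathbf{1}_i$, $d=e=y$, $f=g=x$); multiplication $(\nu\otimes\zeta)(\nu'\otimes\zeta')=\delta_{f,g'}\delta_{e,d'}\langle\!\langle(\mathrm{id}_a\otimes\nu')\nu,\;\zeta(\mathrm{id}_a\otimes\zeta')\rangle\!\rangle$; counit $\varepsilon(\nu\otimes\zeta)\,\mathrm{id}_g=\delta_{e,f}\delta_{d,g}\,\zeta\circ\nu$; comultiplication $\Delta(\nu\otimes\zeta)=\sum_{i,j\in\mathrm{Irr}(\mathcal{M})}\sum_\sigma(\sigma\otimes\zeta)\otimes(\nu\otimes\sigma^* )$, where $\sigma$ runs over a basis of $\mathrm{Hom}(j,a\otimes i)$ with dual basis $\sigma^*$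 of $\mathrm{Hom}(a\otimes i,j)$, $\sigma^*\circ\tau=\delta_{\sigma,\tau}\mathrm{id}_j$; antipode $S(\nu\otimes\zeta)=\frac{d_f}{d_g}\,\zeta^\flat\otimes\nu^\sharp$; $*$-operation (antilinear) $(\nu\otimes\zeta)^*=\frac{d_e}{d_d}\,(\nu^\dagger)^\flat\otimes(\zeta^\dagger)^\sharp$. Similarly, for a right $\mathcal{D}$-module category $\mathcal{M}$, the right boundary tube algebra $\tilde{\mathbf{R}}(\mathcal{M}_{\mathcal{D}})=\bigoplus_{b\in\mathrm{Irr}(\mathcal{D});\,d,e,f,g\in\mathrm{Irr}(\mathcal{M})}\mathrm{Hom}_{\mathcal{M}}(d,e\otimes b)\otimes\mathrm{Hom}_{\mathcal{M}}(f\otimes b,g)$, with the mirror-image structure, is a $C^*$ weak Hopf algebra.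
   Context: A unitary multifusion category (UMFC) $\mathcal{D}$ is a finite semisimple $\mathbb{C}$-linear rigid monoidal category with compatible unitary dagger structure; $\mathbf{1}=\bigoplus_i\mathbf{1}_i$ with $\mathbf{1}_i$ simple. It carries a spherical structure: for simple $x$ with dual $\bar x$ there are $\mathrm{coev}_x:\mathbf{1}\to x\otimes\bar x$, $\mathrm{ev}_x:\bar x\otimes x\to\mathbf{1}$ satisfying the zig-zag equations, the other pair of duality maps is $\mathrm{ev}_x^\dagger,\mathrm{coev}_x^\dagger$, and both $\mathrm{coev}_x^\dagger\mathrm{coev}_x$ and $\mathrm{ev}_x\mathrm{ev}_x^\dagger$ equal $d_x>0$ times the identity of the corresponding simple summand of $\mathbf{1}$. Module categories $\mathcal{M}$ are finite semisimple and unitary (dagger compatible with the action) and carry a compatible module trace: traces $\mathrm{tr}_m$ on $\mathrm{End}(m)$ with $\mathrm{tr}(fg)=\mathrm{tr}(gf)$ and $\mathrm{tr}_{a\otimes m}(f)=\mathrm{tr}_m(\text{partial trace of }f\text{ over }a)$, and $d_m=\mathrm{tr}_m(\mathrm{id}_m)>0$ for $m$ simple (similarly on the right). Associators are suppressed; $\mathrm{Irr}$ denotes representatives of simples (containing all $\mathbf{1}_i$). Elements are diagrams: a vertical boundary line cut by a hole, lower part labelled $d$ outside and $e$ inside, upper part $f$ inside and $g$ outside, and a left arc $a$ joining the two parts. For an arbitrary object $A\in\mathcal{D}$ and $\nu\in\mathrm{Hom}(d,A\otimes e)$, $\zeta\in\mathrm{Hom}(A\otimes f,g)$, $\langle\!\langle\nu,\zeta\rangle\!\rangle=\sum_{k\in\mathrm{Irr}(\mathcal{D})}\sum_p((p^*\otimes\mathrm{id}_e)\nu)\otimes(\zeta(p\otimes\mathrm{id}_f))$,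 with $p$ a basis of $\mathrm{Hom}(k,A)$ and $p^*$ the dual basis of $\mathrm{Hom}(A,k)$, $p^*p'=\delta_{p,p'}\mathrm{id}_k$; in the product $A=a\otimes a'$. Bending: for $u\in\mathrm{Hom}(a\otimes x,y)$, $u^\flat=(\mathrm{id}_{\bar a}\otimes u)(\mathrm{ev}_a^\dagger\otimes\mathrm{id}_x)\in\mathrm{Hom}(x,\bar a\otimes y)$; for $u\in\mathrm{Hom}(y,a\otimes x)$, $u^\sharp=(\mathrm{ev}_a\otimes\mathrm{id}_x)(\mathrm{id}_{\bar a}\otimes u)\in\mathrm{Hom}(\bar a\otimes y,x)$. Mirror-image structure on $\tilde{\mathbf{R}}$: the same formulas with $a$ on the left replaced by $b$ on the right, e.g. product $\delta_{f,g'}\delta_{e,d'}\langle\!\langle(\nu'\otimes\mathrm{id}_b)\nu,\zeta(\zeta'\otimes\mathrm{id}_b)\rangle\!\rangle$ with $B=b'\otimes b$, and bending with $\mathrm{coev}_b$ and $\mathrm{coev}_b^\dagger$: $u^\flat=(u\otimes\mathrm{id}_{\bar b})(\mathrm{id}_x\otimes\mathrm{coev}_b)$, $u^\sharp=(\mathrm{id}_x\otimes\mathrm{coev}_b^\dagger)(u\otimes\mathrm{id}_{\bar b})$. A weak Hopf algebra is an algebra and coalgebra with $\Delta$ multiplicative, $(\Delta\otimes\mathrm{id})\Delta(1)=(\Delta(1)\otimes1)(1\otimes\Delta(1))=(1\otimes\Delta(1))(\Delta(1)\otimes1)$, $\varepsilon(xyz)=\sum\varepsilon(xy^{(1)})\varepsilon(y^{(2)}z)=\sum\varepsilon(xy^{(2)})\varepsilon(y^{(1)}z)$,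 and antipode $S$ with $\sum x^{(1)}S(x^{(2)})=\sum\varepsilon(1^{(1)}x)1^{(2)}$, $\sum S(x^{(1)})x^{(2)}=\sum1^{(1)}\varepsilon(x1^{(2)})$, $\sum S(x^{(1)})x^{(2)}S(x^{(3)})=S(x)$. It is a $C^*$ weak Hopf algebra if it also has an antilinear involution $*$ with $(xy)^*=y^*x^*$, $\Delta(x^* )=\Delta(x)^*$, and a faithful $*$-representation on a Hilbert space. *)

(* Defs.v *)
From HB Require Import structures.
From mathcomp Require Import all_boot all_order all_algebra.
From mathcomp Require Export complex.
From mathcomp Require Export reals.

Set Implicit Arguments.
Unset Strict Implicit.
Unset Printing Implicit Defensive.

Import GRing.Theory Num.Theory.
Local Open Scope ring_scope.

(* Everything is developed over a [numClosedFieldType] C and used at C = R[i]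
   with R : realType.  In C, [0 < c] means "c is real and positive", and [c^*]
   is complex conjugation. *)

Definition antilinear (C : numClosedFieldType) (U V : lmodType C)
  (f : U -> V) : Prop :=
  forall c u v, f (c *: u + v) = c^* *: f u + f v.

Definition bilinear2 (C : numClosedFieldType) (U V W : lmodType C)
  (B : U -> V -> W) : Prop :=
  (forall u, linear (B u)) /\ (forall v, linear (B^~ v)).

(* V (x) W is modelled by coordinate matrices with respect to the library's
   chosen bases of V and W; [tlift] is the linear extension of a bilinear map
   (see [tlift_pure]), so that a Sweedler sum "sum B(x1, x2)" is
   [tlift B (Delta x)]. *)
Definition tensor (C : numClosedFieldType) (V W : vectType C) : vectType C :=
  'M[C]_(\dim {:V}, \dim {:W}).

Definition stdv (C : numClosedFieldType) (V : vectType C)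
  (i : 'I_(\dim {:V})) : V := (vbasis {:V})`_i.

Definition stdc (C : numClosedFieldType) (V : vectType C)
  (i : 'I_(\dim {:V})) (v : V) : C := coord (vbasis {:V}) i v.

Definition pure (C : numClosedFieldType) (V W : vectType C) (v : V) (w : W) :
  tensor V W := \matrix_(i, j) (stdc i v * stdc j w).

Notation "v ⊠ w" := (pure v w) (at level 40, left associativity).

Definition tlift (C : numClosedFieldType) (V W : vectType C) (U : lmodType C)
    (B : V -> W -> U) (t : tensor V W) : U :=
  \sum_i \sum_j (t : 'M[C]_(_, _)) i j *: B (stdv i) (stdv j).

Definition tlift_anti (C : numClosedFieldType) (V W : vectType C)
    (U : lmodType C) (B : V -> W -> U) (t : tensor V W) : U :=
  \sum_i \sum_j ((t : 'M[C]_(_, _)) i j)^* *: B (stdv i) (stdv j).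

Lemma stdc_sum (C : numClosedFieldType) (V : vectType C) (v : V) :
  v = \sum_i stdc i v *: stdv i.
Proof. exact: coord_vbasis (memvf v). Qed.

Lemma bilinear2_sum (C : numClosedFieldType) (V W : vectType C)
    (U : lmodType C) (B : V -> W -> U) (v : V) (w : W) : bilinear2 B ->
  B v w = \sum_i \sum_j (stdc i v * stdc j w) *: B (stdv i) (stdv j).
Proof.
move=> [linr linl].
pose Bl w0 : {linear V -> U} :=
  HB.pack (B^~ w0) (GRing.isLinear.Build C V U _ (B^~ w0) (linl w0)).
pose Br v0 : {linear W -> U} :=
  HB.pack (B v0) (GRing.isLinear.Build C W U _ (B v0) (linr v0)).
transitivity (Bl w v) => //; rewrite {1}(stdc_sum v) linear_sum.
apply: eq_bigr => i _; rewrite linearZ /=.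
transitivity (stdc i v *: Br (stdv i) w) => //.
rewrite {1}(stdc_sum w) linear_sum scaler_sumr.
by apply: eq_bigr => j _; rewrite linearZ /= scalerA.
Qed.

Lemma tlift_pure (C : numClosedFieldType) (V W : vectType C) (U : lmodType C)
    (B : V -> W -> U) (v : V) (w : W) :
  bilinear2 B -> tlift B (v ⊠ w) = B v w.
Proof.
move=> bilB; rewrite (bilinear2_sum v w bilB) /tlift.
by apply: eq_bigr => i _; apply: eq_bigr => j _; rewrite mxE.
Qed.

Lemma stdc_stdv (C : numClosedFieldType) (V : vectType C)
    (i j : 'I_(\dim {:V})) : stdc i (stdv j) = (i == j)%:R.
Proof. by rewrite /stdc /stdv coord_free ?(basis_free (vbasisP _)) // eq_sym. Qed.

Lemma stdv_sum2 (C : numClosedFieldType) (V W : vectType C) (U : lmodType C)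
    (F : 'I_(\dim {:V}) -> 'I_(\dim {:W}) -> U) i j :
  \sum_i' \sum_j' (stdc i' (stdv i) * stdc j' (stdv j)) *: F i' j' = F i j.
Proof.
rewrite (bigD1 i) //= (bigD1 j) //= !stdc_stdv !eqxx mulr1 scale1r.
rewrite !big1 ?addr0 // => [i' /negPf ni|j' /negPf nj].
  by apply: big1 => j' _; rewrite stdc_stdv ni mul0r scale0r.
by rewrite !stdc_stdv nj mulr0 scale0r.
Qed.

(* A Hilbert space; [ip] is linear in the first and antilinear in the second
   variable, and Cauchy sequences for the norm [sqrt (ip v v)] converge. *)
Record hilbert (C : numClosedFieldType) := Hilbert {
  hsp :> lmodType C;
  ip : hsp -> hsp -> C;
  ip_linear : forall w, scalar (ip^~ w);
  ip_conj : forall v w, ip w v = (ip v w)^*;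
  ip_ge0 : forall v, 0 <= ip v v;
  ip_eq0 : forall v, ip v v = 0 -> v = 0;
  ip_complete : forall u : nat -> hsp,
    (forall eps : C, 0 < eps -> exists N, forall m n, (N <= m)%N -> (N <= n)%N ->
       ip (u m - u n) (u m - u n) < eps) ->
    exists l, forall eps : C, 0 < eps -> exists N, forall n, (N <= n)%N ->
       ip (u n - l) (u n - l) < eps
}.

Record wha_data (C : numClosedFieldType) (V : vectType C) := WhaData {
  wmul : V -> V -> V;
  wone : V;
  weps : V -> C;
  wdelta : V -> tensor V V;
  wS : V -> V;
  wstar : V -> V
}.

Record is_weak_hopf (C : numClosedFieldType) (V : vectType C)
    (H : wha_data V) : Prop := IsWeakHopf {
  wmul_bilinear : bilinear2 (wmul H);
  wmulA : forall x y z, wmul H x (wmul H y z) = wmul H (wmul H x y) z;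
  wmul1l : forall x, wmul H (wone H) x = x;
  wmul1r : forall x, wmul H x (wone H) = x;
  wdelta_linear : linear (wdelta H);
  weps_linear : scalar (weps H);
  wcoassoc : forall x,
    tlift (fun u c => tlift (fun a b => a ⊠ (b ⊠ c)) (wdelta H u)) (wdelta H x) =
    tlift (fun a u => a ⊠ wdelta H u) (wdelta H x);
  wcounitl : forall x, tlift (fun a b => weps H a *: b) (wdelta H x) = x;
  wcounitr : forall x, tlift (fun a b => weps H b *: a) (wdelta H x) = x;
  wdeltaM : forall x y,
    wdelta H (wmul H x y) =
    tlift (fun a b => tlift (fun c d => wmul H a c ⊠ wmul H b d) (wdelta H y))
      (wdelta H x);
  wdelta1l :
    tlift (fun u c => tlift (fun a b => a ⊠ (b ⊠ c)) (wdelta H u))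
      (wdelta H (wone H)) =
    tlift (fun a b => tlift (fun c d => a ⊠ (wmul H b c ⊠ d))
      (wdelta H (wone H))) (wdelta H (wone H));
  wdelta1r :
    tlift (fun u c => tlift (fun a b => a ⊠ (b ⊠ c)) (wdelta H u))
      (wdelta H (wone H)) =
    tlift (fun a b => tlift (fun c d => a ⊠ (wmul H c b ⊠ d))
      (wdelta H (wone H))) (wdelta H (wone H));
  wepsMl : forall x y z,
    (weps H (wmul H (wmul H x y) z) : C^o) =
    tlift (fun a b => weps H (wmul H x a) * weps H (wmul H b z) : C^o)
      (wdelta H y);
  wepsMr : forall x y z,
    (weps H (wmul H (wmul H x y) z) : C^o) =
    tlift (fun a b => weps H (wmul H x b) * weps H (wmul H a z) : C^o)
      (wdelta H y);
  wS_linear : linear (wS H);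
  wS_target : forall x,
    tlift (fun a b => wmul H a (wS H b)) (wdelta H x) =
    tlift (fun a b => weps H (wmul H a x) *: b) (wdelta H (wone H));
  wS_source : forall x,
    tlift (fun a b => wmul H (wS H a) b) (wdelta H x) =
    tlift (fun a b => weps H (wmul H x b) *: a) (wdelta H (wone H));
  wS_conv : forall x,
    tlift (fun u c =>
      tlift (fun a b => wmul H (wmul H (wS H a) b) (wS H c)) (wdelta H u))
      (wdelta H x) = wS H x
}.

Definition faithful_star_rep (C : numClosedFieldType) (V : vectType C)
    (H : wha_data V) (K : hilbert C) (rho : V -> K -> K) : Prop :=
  [/\ bilinear2 rho,
      forall x, exists c : C, forall v, ip (rho x v) (rho x v) <= c * ip v v,
      (forall v, rho (wone H) v = v) /\
      (forall x y v, rho (wmul H x y) v = rho x (rho y v)),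
      forall x v w, ip (rho (wstar H x) v) w = ip v (rho x w) &
      forall x, (forall v, rho x v = 0) -> x = 0].

Record is_cstar_weak_hopf (C : numClosedFieldType) (V : vectType C)
    (H : wha_data V) : Prop := IsCstarWeakHopf {
  cstar_weak_hopf :> is_weak_hopf H;
  wstar_antilinear : antilinear (wstar H);
  wstarK : forall x, wstar H (wstar H x) = x;
  wstarM : forall x y, wstar H (wmul H x y) = wmul H (wstar H y) (wstar H x);
  wdelta_star : forall x,
    wdelta H (wstar H x) =
    tlift_anti (fun a b => wstar H a ⊠ wstar H b) (wdelta H x);
  wstar_rep : exists (K : hilbert C) (rho : V -> K -> K), faithful_star_rep H rho
}.

(* Besides the dagger category structure, the data contain representatives
   [simp k] (k : Irr) of the simple objects and, for each object x, a direct sum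
   decomposition of x with inclusions [inc] and projections [prj].  By Schur's
   lemma the [inc k x _] form a basis of Hom(simp k, x) (see [inc_basis]), with
   dual basis the [prj k x _], and every family of such pairs of dual bases
   arises in this way. *)
Record ucat_data (C : numClosedFieldType) := UcatData {
  ob :> Type;
  hom : ob -> ob -> vectType C;
  idm : forall x, hom x x;
  comp : forall x y z, hom y z -> hom x y -> hom x z;
  dag : forall x y, hom x y -> hom y x;
  Irr : finType;
  simp : Irr -> ob;
  mult : Irr -> ob -> nat;
  inc : forall k x, 'I_(mult k x) -> hom (simp k) x;
  prj : forall k x, 'I_(mult k x) -> hom x (simp k)
}.

Arguments idm {C u} x.
Arguments simp {C u} k.
Arguments inc {C u} k x t.
Arguments prj {C u} k x t.

Notation "g ∘ f" := (comp g f) (at level 40, left associativity).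
Notation "f '†'" := (dag f) (at level 8, format "f †").

Definition simple (C : numClosedFieldType) (X : ucat_data C) (x : X) : Prop :=
  idm x <> 0 /\ forall f : hom x x, exists c : C, f = c *: idm x.

Record is_ucat (C : numClosedFieldType) (X : ucat_data C) : Prop := IsUcat {
  comp_bilinear : forall x y z : X, bilinear2 (@comp C X x y z);
  comp_idl : forall (x y : X) (f : hom x y), idm y ∘ f = f;
  comp_idr : forall (x y : X) (f : hom x y), f ∘ idm x = f;
  comp_assoc : forall (x y z w : X) (h : hom z w) (g : hom y z) (f : hom x y),
    h ∘ (g ∘ f) = h ∘ g ∘ f;
  zero_object : exists z : X, idm z = 0;
  biproducts : forall x y : X,
    exists (z : X) (ix : hom x z) (iy : hom y z) (px : hom z x) (py : hom z y),
      [/\ px ∘ ix = idm x, py ∘ iy = idm y, px ∘ iy = 0, py ∘ ix = 0 &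
          ix ∘ px + iy ∘ py = idm z];
  (* [dag_eq0] and [dag_positive] say that X is a C*-category. *)
  dag_antilinear : forall x y : X, antilinear (@dag C X x y);
  dagK : forall (x y : X) (f : hom x y), (f†)† = f;
  dag_comp : forall (x y z : X) (g : hom y z) (f : hom x y),
    (g ∘ f)† = f† ∘ g†;
  dag_eq0 : forall (x y : X) (f : hom x y), f† ∘ f = 0 -> f = 0;
  dag_positive : forall (x y : X) (f : hom x y),
    exists g : hom x x, f† ∘ f = g† ∘ g;
  irr_simple : forall k : Irr X, simple (simp k);
  irr_hom0 : forall (k l : Irr X) (f : hom (simp k) (simp l)), k != l -> f = 0;
  prj_inc : forall k (x : X) (s t : 'I_(mult k x)),
    prj k x s ∘ inc k x t = (s == t)%:R *: idm (simp k);
  inc_prj : forall x : X,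
    \sum_k \sum_(t < mult k x) inc k x t ∘ prj k x t = idm x
}.

Record ucat (C : numClosedFieldType) := Ucat {
  udata :> ucat_data C;
  ucatP : is_ucat udata
}.

Lemma comp_sumr (C : numClosedFieldType) (X : ucat C) (x y z : X)
    (g : hom y z) (I : finType) (c : I -> C) (F : I -> hom x y) :
  g ∘ (\sum_i c i *: F i) = \sum_i c i *: (g ∘ F i).
Proof.
pose L : {linear hom x y -> hom x z} := HB.pack (comp g)
  (GRing.isLinear.Build C (hom x y) (hom x z) _ (comp g)
     ((comp_bilinear (ucatP X) x y z).1 g)).
by rewrite -[LHS]/(L _) linear_sum; apply: eq_bigr => i _; exact: linearZ.
Qed.

Lemma comp_suml (C : numClosedFieldType) (X : ucat C) (x y z : X)
    (f : hom x y) (I : finType) (F : I -> hom y z) :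
  (\sum_i F i) ∘ f = \sum_i F i ∘ f.
Proof.
pose L : {linear hom y z -> hom x z} := HB.pack (fun g => g ∘ f)
  (GRing.isLinear.Build C (hom y z) (hom x z) _ (fun g => g ∘ f)
     ((comp_bilinear (ucatP X) x y z).2 f)).
by rewrite -[LHS]/(L _) linear_sum.
Qed.

Lemma inc_basis (C : numClosedFieldType) (X : ucat C) (k : Irr X) (x : X) :
  basis_of {:hom (simp k) x} [tuple inc k x t | t < mult k x].
Proof.
have P := ucatP X; have [id0 idC] := irr_simple P k.
have scaler (y z : X) (g : hom y z) (h : hom (simp k) y) (c : C) :
    g ∘ (c *: h) = c *: (g ∘ h).
  by have := comp_sumr g (fun=> c) (fun _ : 'I_1 => h); rewrite !big_ord1.
rewrite /basis_of eqEsubv subvf; apply/andP; split.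
  apply/subvP => f _.
  rewrite -(comp_idl P f) -(inc_prj P) comp_suml; apply: memv_suml => l _.
  rewrite comp_suml; apply: memv_suml => t _; rewrite -(comp_assoc P).
  have [kl|kl] := eqVneq k l; last first.
    by rewrite (irr_hom0 P (prj l x t ∘ f) kl) -(scale0r 0) scaler scale0r mem0v.
  case: l / kl t => t; have [c ->] := idC (prj k x t ∘ f).
  rewrite scaler (comp_idr P) memvZ // memv_span //.
  by apply/mapP; exists t; rewrite ?mem_enum.
apply/freeP => c; under eq_bigr do rewrite -tnth_nth tnth_mktuple.
move=> c0 t; have := comp_sumr (prj k x t) c (inc k x).
rewrite c0 (bigD1 t) //= (prj_inc P) eqxx scale1r.
rewrite big1 ?addr0 => [|s st]; last first.
  by rewrite (prj_inc P) eq_sym (negPf st) scale0r scaler0.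
rewrite -(scale0r 0) scaler scale0r => /esym/eqP.
by rewrite scaler_eq0 => /orP[/eqP //|/eqP].
Qed.

Definition isometric_iso (C : numClosedFieldType) (X : ucat_data C) (x y : X)
  (f : hom x y) : Prop := f† ∘ f = idm x /\ f ∘ f† = idm y.

(* [assoc], [lunit] and [runit] are unitary, so their inverses are their
   daggers.  The simple summands of the unit object are the [simp i] with
   i \in [unit_irr], included in it by the isometries [unit_inc i]. *)
Record umfc_data (C : numClosedFieldType) := UmfcData {
  ucat_of_umfc :> ucat C;
  ten : ucat_of_umfc -> ucat_of_umfc -> ucat_of_umfc;
  tenm : forall x x' y y' : ucat_of_umfc,
    hom x x' -> hom y y' -> hom (ten x y) (ten x' y');
  unito : ucat_of_umfc;
  assoc : forall x y z, hom (ten (ten x y) z) (ten x (ten y z));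
  lunit : forall x, hom (ten unito x) x;
  runit : forall x, hom (ten x unito) x;
  unit_irr : {set Irr ucat_of_umfc};
  unit_inc : forall i : Irr ucat_of_umfc, hom (simp i) unito;
  dual : ucat_of_umfc -> ucat_of_umfc;
  ev : forall x, hom (ten (dual x) x) unito;
  coev : forall x, hom unito (ten x (dual x))
}.

Arguments unito {C u}.
Arguments assoc {C u} x y z.
Arguments lunit {C u} x.
Arguments runit {C u} x.
Arguments unit_irr {C u}.
Arguments unit_inc {C u} i.
Arguments ev {C u} x.
Arguments coev {C u} x.

Notation "x ⊗ y" := (ten x y) (at level 39, left associativity).
Notation "f ⊗m g" := (tenm f g) (at level 39, left associativity).

Definition unit_proj (C : numClosedFieldType) (D : umfc_data C) (i : Irr D) :
  hom (unito : D) unito := unit_inc i ∘ (unit_inc i)†.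

Record is_umfc (C : numClosedFieldType) (D : umfc_data C) : Prop := IsUmfc {
  tenm_bilinear : forall x x' y y' : D, bilinear2 (@tenm C D x x' y y');
  tenm_id : forall x y : D, idm x ⊗m idm y = idm (x ⊗ y);
  tenm_comp : forall (x x' x'' y y' y'' : D) (f' : hom x' x'') (f : hom x x')
      (g' : hom y' y'') (g : hom y y'),
    (f' ∘ f) ⊗m (g' ∘ g) = (f' ⊗m g') ∘ (f ⊗m g);
  tenm_dag : forall (x x' y y' : D) (f : hom x x') (g : hom y y'),
    (f ⊗m g)† = f† ⊗m g†;
  assoc_nat : forall (x x' y y' z z' : D) (f : hom x x') (g : hom y y')
      (h : hom z z'),
    assoc x' y' z' ∘ ((f ⊗m g) ⊗m h) = (f ⊗m (g ⊗m h)) ∘ assoc x y z;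
  lunit_nat : forall (x x' : D) (f : hom x x'),
    lunit x' ∘ (idm unito ⊗m f) = f ∘ lunit x;
  runit_nat : forall (x x' : D) (f : hom x x'),
    runit x' ∘ (f ⊗m idm unito) = f ∘ runit x;
  assoc_unitary : forall x y z : D, isometric_iso (assoc x y z);
  lunit_unitary : forall x : D, isometric_iso (lunit x);
  runit_unitary : forall x : D, isometric_iso (runit x);
  pentagon : forall x y z w : D,
    assoc x y (z ⊗ w) ∘ assoc (x ⊗ y) z w =
    (idm x ⊗m assoc y z w) ∘ assoc x (y ⊗ z) w ∘ (assoc x y z ⊗m idm w);
  triangle : forall x y : D,
    (idm x ⊗m lunit y) ∘ assoc x unito y = runit x ⊗m idm y;
  unit_inc_isom : forall i : Irr D, i \in unit_irr ->
    (unit_inc i)† ∘ unit_inc i = idm (simp i);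
  unit_decomp : \sum_(i in unit_irr) unit_proj i = idm (unito : D);
  zigzag_r : forall x : D,
    runit x ∘ (idm x ⊗m ev x) ∘ assoc x (dual x) x ∘ (coev x ⊗m idm x)
      ∘ (lunit x)† = idm x;
  zigzag_l : forall x : D,
    lunit (dual x) ∘ (ev x ⊗m idm (dual x)) ∘ (assoc (dual x) x (dual x))†
      ∘ (idm (dual x) ⊗m coev x) ∘ (runit (dual x))† = idm (dual x);
  spherical : forall x : D, simple x -> exists d : C,
    [/\ 0 < d,
        forall i, i \in unit_irr -> idm (simp i ⊗ x) <> 0 ->
          (coev x)† ∘ coev x = d *: unit_proj i &
        forall j, j \in unit_irr -> idm (x ⊗ simp j) <> 0 ->
          ev x ∘ (ev x)† = d *: unit_proj j]
}.

Record umfc (C : numClosedFieldType) := Umfc {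
  umfcd :> umfc_data C;
  umfcP : is_umfc umfcd
}.

Record lmod_data (C : numClosedFieldType) (D : umfc C) := LmodData {
  ucat_of_lmod :> ucat C;
  lact : D -> ucat_of_lmod -> ucat_of_lmod;
  lactm : forall (a a' : D) (m m' : ucat_of_lmod),
    hom a a' -> hom m m' -> hom (lact a m) (lact a' m');
  lassoc : forall (a b : D) m, hom (lact (a ⊗ b) m) (lact a (lact b m));
  lmunit : forall m, hom (lact unito m) m;
  ltr : forall m : ucat_of_lmod, hom m m -> C
}.

Arguments lassoc {C D l} a b m.
Arguments lmunit {C D l} m.

Notation "a ⊳ m" := (lact a m) (at level 38, right associativity).
Notation "f ⊳m g" := (lactm f g) (at level 38, right associativity).

(* (ev_a ⊳ id_m) and its dagger, with the coherence isomorphisms inserted *)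
Definition lcap (C : numClosedFieldType) (D : umfc C) (M : lmod_data D)
    (a : D) (m : M) : hom (dual a ⊳ a ⊳ m) m :=
  lmunit m ∘ (ev a ⊳m idm m) ∘ (lassoc (dual a) a m)†.

Definition lcup (C : numClosedFieldType) (D : umfc C) (M : lmod_data D)
    (a : D) (m : M) : hom m (dual a ⊳ a ⊳ m) :=
  lassoc (dual a) a m ∘ ((ev a)† ⊳m idm m) ∘ (lmunit m)†.

Definition lptr (C : numClosedFieldType) (D : umfc C) (M : lmod_data D)
    (a : D) (m : M) (f : hom (a ⊳ m) (a ⊳ m)) : hom m m :=
  lcap a m ∘ (idm (dual a) ⊳m f) ∘ lcup a m.

Record is_lmod (C : numClosedFieldType) (D : umfc C) (M : lmod_data D) : Prop :=
  IsLmod {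
  lactm_bilinear : forall (a a' : D) (m m' : M),
    bilinear2 (@lactm C D M a a' m m');
  lactm_id : forall (a : D) (m : M), idm a ⊳m idm m = idm (a ⊳ m);
  lactm_comp : forall (a a' a'' : D) (m m' m'' : M) (f' : hom a' a'')
      (f : hom a a') (g' : hom m' m'') (g : hom m m'),
    (f' ∘ f) ⊳m (g' ∘ g) = (f' ⊳m g') ∘ (f ⊳m g);
  lactm_dag : forall (a a' : D) (m m' : M) (f : hom a a') (g : hom m m'),
    (f ⊳m g)† = f† ⊳m g†;
  lassoc_nat : forall (a a' b b' : D) (m m' : M) (f : hom a a') (g : hom b b')
      (h : hom m m'),
    lassoc a' b' m' ∘ ((f ⊗m g) ⊳m h) = (f ⊳m (g ⊳m h)) ∘ lassoc a b m;
  lmunit_nat : forall (m m' : M) (f : hom m m'),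
    lmunit m' ∘ (idm unito ⊳m f) = f ∘ lmunit m;
  lassoc_unitary : forall (a b : D) (m : M), isometric_iso (lassoc a b m);
  lmunit_unitary : forall m : M, isometric_iso (lmunit m);
  lpentagon : forall (a b c : D) (m : M),
    lassoc a b (c ⊳ m) ∘ lassoc (a ⊗ b) c m =
    (idm a ⊳m lassoc b c m) ∘ lassoc a (b ⊗ c) m ∘ (assoc a b c ⊳m idm m);
  ltriangle : forall (a : D) (m : M),
    (idm a ⊳m lmunit m) ∘ lassoc a unito m = runit a ⊳m idm m;
  ltr_linear : forall m : M, scalar (@ltr C D M m);
  ltr_cyclic : forall (m n : M) (f : hom n m) (g : hom m n),
    ltr (f ∘ g) = ltr (g ∘ f);
  ltr_ptr : forall (a : D) (m : M) (f : hom (a ⊳ m) (a ⊳ m)),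
    simple a -> ltr f = ltr (lptr f);
  ltr_pos : forall m : M, simple m -> 0 < ltr (idm m)
}.

Record left_module (C : numClosedFieldType) (D : umfc C) := LeftModule {
  lmodd :> lmod_data D;
  lmodP : is_lmod lmodd
}.

Record rmod_data (C : numClosedFieldType) (D : umfc C) := RmodData {
  ucat_of_rmod :> ucat C;
  ract : ucat_of_rmod -> D -> ucat_of_rmod;
  ractm : forall (m m' : ucat_of_rmod) (b b' : D),
    hom m m' -> hom b b' -> hom (ract m b) (ract m' b');
  rassoc : forall m (a b : D), hom (ract (ract m a) b) (ract m (a ⊗ b));
  rmunit : forall m, hom (ract m unito) m;
  rtr : forall m : ucat_of_rmod, hom m m -> C
}.

Arguments rassoc {C D r} m a b.
Arguments rmunit {C D r} m.

Notation "m ⊲ b" := (ract m b) (at level 39, left associativity).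
Notation "g ⊲m f" := (ractm g f) (at level 39, left associativity).

(* (id_m ⊲ coev_b) and its dagger, with the coherence isomorphisms inserted *)
Definition rcup (C : numClosedFieldType) (D : umfc C) (M : rmod_data D)
    (m : M) (b : D) : hom m (m ⊲ b ⊲ dual b) :=
  (rassoc m b (dual b))† ∘ (idm m ⊲m coev b) ∘ (rmunit m)†.

Definition rcap (C : numClosedFieldType) (D : umfc C) (M : rmod_data D)
    (m : M) (b : D) : hom (m ⊲ b ⊲ dual b) m :=
  rmunit m ∘ (idm m ⊲m (coev b)†) ∘ rassoc m b (dual b).

Definition rptr (C : numClosedFieldType) (D : umfc C) (M : rmod_data D)
    (m : M) (b : D) (f : hom (m ⊲ b) (m ⊲ b)) : hom m m :=
  rcap m b ∘ (f ⊲m idm (dual b)) ∘ rcup m b.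

Record is_rmod (C : numClosedFieldType) (D : umfc C) (M : rmod_data D) : Prop :=
  IsRmod {
  ractm_bilinear : forall (m m' : M) (b b' : D),
    bilinear2 (@ractm C D M m m' b b');
  ractm_id : forall (m : M) (b : D), idm m ⊲m idm b = idm (m ⊲ b);
  ractm_comp : forall (m m' m'' : M) (b b' b'' : D) (g' : hom m' m'')
      (g : hom m m') (f' : hom b' b'') (f : hom b b'),
    (g' ∘ g) ⊲m (f' ∘ f) = (g' ⊲m f') ∘ (g ⊲m f);
  ractm_dag : forall (m m' : M) (b b' : D) (g : hom m m') (f : hom b b'),
    (g ⊲m f)† = g† ⊲m f†;
  rassoc_nat : forall (m m' : M) (a a' b b' : D) (h : hom m m') (f : hom a a')
      (g : hom b b'),
    rassoc m' a' b' ∘ ((h ⊲m f) ⊲m g) = (h ⊲m (f ⊗m g)) ∘ rassoc m a b;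
  rmunit_nat : forall (m m' : M) (f : hom m m'),
    rmunit m' ∘ (f ⊲m idm unito) = f ∘ rmunit m;
  rassoc_unitary : forall (m : M) (a b : D), isometric_iso (rassoc m a b);
  rmunit_unitary : forall m : M, isometric_iso (rmunit m);
  rpentagon : forall (m : M) (a b c : D),
    rassoc m a (b ⊗ c) ∘ rassoc (m ⊲ a) b c =
    (idm m ⊲m assoc a b c) ∘ rassoc m (a ⊗ b) c ∘ (rassoc m a b ⊲m idm c);
  rtriangle : forall (m : M) (b : D),
    (idm m ⊲m lunit b) ∘ rassoc m unito b = rmunit m ⊲m idm b;
  rtr_linear : forall m : M, scalar (@rtr C D M m);
  rtr_cyclic : forall (m n : M) (f : hom n m) (g : hom m n),
    rtr (f ∘ g) = rtr (g ∘ f);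
  rtr_ptr : forall (m : M) (b : D) (f : hom (m ⊲ b) (m ⊲ b)),
    simple b -> rtr f = rtr (rptr f);
  rtr_pos : forall m : M, simple m -> 0 < rtr (idm m)
}.

Record right_module (C : numClosedFieldType) (D : umfc C) := RightModule {
  rmodd :> rmod_data D;
  rmodP : is_rmod rmodd
}.

(* The direct sum over (a, d, e, f, g) of V a d e (x) W a f g, in coordinates
   with respect to the bases [stdv]: functions on the disjoint union of the
   index sets of the bases [stdv i (x) stdv j] of the summands. *)
Definition tube_fiber (C : numClosedFieldType) (I J : finType)
    (V W : I -> J -> J -> vectType C) (s : I * J * J * J * J) : finType :=
  let: (a, d, e, f, g) := s in ('I_(\dim {:V a d e}) * 'I_(\dim {:W a f g}))%type.

Definition tube (C : numClosedFieldType) (I J : finType)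
    (V W : I -> J -> J -> vectType C) : vectType C :=
  {ffun {s : I * J * J * J * J & tube_fiber V W s} -> C^o}.

Definition tube_base (C : numClosedFieldType) (I J : finType)
    (V W : I -> J -> J -> vectType C) (a : I) (d e f g : J)
    (i : 'I_(\dim {:V a d e})) (j : 'I_(\dim {:W a f g})) : tube V W :=
  [ffun t => (t == Tagged (tube_fiber V W)
                     (i := (a, d, e, f, g)) (i, j))%:R].

Definition tube_elt (C : numClosedFieldType) (I J : finType)
    (V W : I -> J -> J -> vectType C) (a : I) (d e f g : J)
    (v : V a d e) (w : W a f g) : tube V W :=
  \sum_i \sum_j (stdc i v * stdc j w) *: tube_base (V := V) (W := W) i j.

Lemma tube_universal (C : numClosedFieldType) (I J : finType)
    (V W : I -> J -> J -> vectType C) (U : lmodType C)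
    (phi : forall a d e f g, V a d e -> W a f g -> U) :
  (forall a d e f g, bilinear2 (@phi a d e f g)) ->
  exists F : {linear tube V W -> U},
    (forall a d e f g (v : V a d e) (w : W a f g),
       F (tube_elt v w) = phi a d e f g v w) /\
    (forall G : {linear tube V W -> U},
       (forall a d e f g (v : V a d e) (w : W a f g),
          G (tube_elt v w) = phi a d e f g v w) -> G =1 F).
Proof.
move=> phiB.
pose val (t : {s & tube_fiber V W s}) : U := let: existT s p := t in
  (match s return tube_fiber V W s -> U with
     (a, d, e, f, g) => fun p => phi a d e f g (stdv p.1) (stdv p.2) end) p.
pose F0 (x : tube V W) : U := \sum_t (x : {ffun _ -> C^o}) t *: val t.
have F0lin : linear F0.
  move=> c x y; rewrite /F0 scaler_sumr -big_split /=; apply: eq_bigr => t _.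
  by rewrite !ffunE scalerDl scalerA.
pose F : {linear tube V W -> U} :=
  HB.pack F0 (GRing.isLinear.Build C (tube V W) U _ F0 F0lin).
have Fbase a d e f g i j :
    F0 (tube_base (V := V) (W := W) (a := a) (d := d) (e := e) (f := f) (g := g)
          i j) = phi a d e f g (stdv i) (stdv j).
  rewrite /F0 (bigD1 (Tagged (tube_fiber V W) (i := (a, d, e, f, g)) (i, j))) //=.
  rewrite ffunE eqxx scale1r big1 ?addr0 // => t /negPf tn.
  by rewrite ffunE tn scale0r.
exists F; split=> [a d e f g v w|G GP x].
  rewrite (bilinear2_sum v w (phiB a d e f g)) /tube_elt linear_sum.
  apply: eq_bigr => i _; rewrite linear_sum; apply: eq_bigr => j _.
  by rewrite linearZ /= Fbase.
have Gbase a d e f g i j :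
    G (tube_base (V := V) (W := W) (a := a) (d := d) (e := e) (f := f) (g := g)
         i j) = phi a d e f g (stdv i) (stdv j).
  by rewrite -GP /tube_elt stdv_sum2.
have -> : x = \sum_t (x : {ffun _ -> C^o}) t *: [ffun t' => (t' == t)%:R].
  apply/ffunP => t; rewrite sum_ffunE (bigD1 t) //= !ffunE eqxx [_ *: _]mulr1.
  rewrite big1 ?addr0 // => t' tt'.
  by rewrite !ffunE eq_sym (negPf tt') scaler0.
rewrite !linear_sum; apply: eq_bigr => -[[[[[a d] e] f] g] [i j]] _.
by rewrite !linearZ; congr (_ *: _); rewrite [LHS]Gbase [RHS]Fbase.
Qed.

Definition left_tube (C : numClosedFieldType) (D : umfc C) (M : left_module D) :
  vectType C :=
  tube (fun (a : Irr D) (d e : Irr M) => hom (simp d) (simp a ⊳ simp e))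
       (fun (a : Irr D) (f g : Irr M) => hom (simp a ⊳ simp f) (simp g)).

Definition ltube_elt (C : numClosedFieldType) (D : umfc C) (M : left_module D)
    (a : Irr D) (d e f g : Irr M) (nu : hom (simp d) (simp a ⊳ simp e))
    (zeta : hom (simp a ⊳ simp f) (simp g)) : left_tube M :=
  tube_elt (V := fun a d e => hom (simp d) (simp a ⊳ simp e))
           (W := fun a f g => hom (simp a ⊳ simp f) (simp g)) nu zeta.

Definition lbracket (C : numClosedFieldType) (D : umfc C) (M : left_module D)
    (A : D) (d e f g : Irr M) (nu : hom (simp d) (A ⊳ simp e))
    (zeta : hom (A ⊳ simp f) (simp g)) : left_tube M :=
  \sum_k \sum_(p < mult k A)
     ltube_elt ((prj k A p ⊳m idm (simp e)) ∘ nu)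
               (zeta ∘ (inc k A p ⊳m idm (simp f))).

Definition lflat (C : numClosedFieldType) (D : umfc C) (M : left_module D)
    (a : D) (x y : M) (u : hom (a ⊳ x) y) : hom x (dual a ⊳ y) :=
  (idm (dual a) ⊳m u) ∘ lcup a x.

Definition lsharp (C : numClosedFieldType) (D : umfc C) (M : left_module D)
    (a : D) (x y : M) (u : hom y (a ⊳ x)) : hom (dual a ⊳ y) x :=
  lcap a x ∘ (idm (dual a) ⊳m u).

Definition ldim (C : numClosedFieldType) (D : umfc C) (M : left_module D)
  (m : Irr M) : C := ltr (idm (simp m : M)).

(* The operations are prescribed on the spanning elements [ltube_elt nu zeta].
   The dual of a representative simple object need not itself be one of the
   chosen representatives; hence the brackets in the antipode and in the
   star. *)
Record is_left_tube_algebra (C : numClosedFieldType) (D : umfc C)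
    (M : left_module D) (H : wha_data (left_tube M)) : Prop :=
  IsLeftTubeAlgebra {
  ltube_one :
    wone H =
    \sum_(i in (unit_irr : {set Irr D}))
      \sum_(y : Irr M | idm (simp i ⊳ simp y) != 0)
      \sum_(x : Irr M | idm (simp i ⊳ simp x) != 0)
        ltube_elt (((unit_inc i)† ⊳m idm (simp y)) ∘ (lmunit (simp y))†)
                  (lmunit (simp x) ∘ (unit_inc i ⊳m idm (simp x)));
  ltube_mul : forall (a a' : Irr D) (d e f g e' f' : Irr M)
      (nu : hom (simp d) (simp a ⊳ simp e))
      (zeta : hom (simp a ⊳ simp f) (simp g))
      (nu' : hom (simp e) (simp a' ⊳ simp e'))
      (zeta' : hom (simp a' ⊳ simp f') (simp f)),
    wmul H (ltube_elt nu zeta) (ltube_elt nu' zeta') =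
    lbracket
      ((lassoc (simp a) (simp a') (simp e'))† ∘ (idm (simp a) ⊳m nu') ∘ nu)
      (zeta ∘ (idm (simp a) ⊳m zeta') ∘ lassoc (simp a) (simp a') (simp f'));
  ltube_mul0 : forall (a a' : Irr D) (d e f g d' e' f' g' : Irr M)
      (nu : hom (simp d) (simp a ⊳ simp e))
      (zeta : hom (simp a ⊳ simp f) (simp g))
      (nu' : hom (simp d') (simp a' ⊳ simp e'))
      (zeta' : hom (simp a' ⊳ simp f') (simp g')),
    ~~ ((f == g') && (e == d')) ->
    wmul H (ltube_elt nu zeta) (ltube_elt nu' zeta') = 0;
  ltube_eps : forall (a : Irr D) (d e : Irr M)
      (nu : hom (simp d) (simp a ⊳ simp e))
      (zeta : hom (simp a ⊳ simp e) (simp d)),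
    weps H (ltube_elt nu zeta) *: idm (simp d) = zeta ∘ nu;
  ltube_eps0 : forall (a : Irr D) (d e f g : Irr M)
      (nu : hom (simp d) (simp a ⊳ simp e))
      (zeta : hom (simp a ⊳ simp f) (simp g)),
    ~~ ((e == f) && (d == g)) -> weps H (ltube_elt nu zeta) = 0;
  ltube_delta : forall (a : Irr D) (d e f g : Irr M)
      (nu : hom (simp d) (simp a ⊳ simp e))
      (zeta : hom (simp a ⊳ simp f) (simp g)),
    wdelta H (ltube_elt nu zeta) =
    \sum_(i : Irr M) \sum_(j : Irr M) \sum_(s < mult j (simp a ⊳ simp i))
      ltube_elt (inc j (simp a ⊳ simp i) s) zeta
        ⊠ ltube_elt nu (prj j (simp a ⊳ simp i) s);
  ltube_S : forall (a : Irr D) (d e f g : Irr M)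
      (nu : hom (simp d) (simp a ⊳ simp e))
      (zeta : hom (simp a ⊳ simp f) (simp g)),
    wS H (ltube_elt nu zeta) =
    (ldim f / ldim g) *: lbracket (lflat zeta) (lsharp nu);
  ltube_star : forall (a : Irr D) (d e f g : Irr M)
      (nu : hom (simp d) (simp a ⊳ simp e))
      (zeta : hom (simp a ⊳ simp f) (simp g)),
    wstar H (ltube_elt nu zeta) =
    (ldim e / ldim d) *: lbracket (lflat nu†) (lsharp zeta†)
}.

Definition right_tube (C : numClosedFieldType) (D : umfc C)
    (M : right_module D) : vectType C :=
  tube (fun (b : Irr D) (d e : Irr M) => hom (simp d) (simp e ⊲ simp b))
       (fun (b : Irr D) (f g : Irr M) => hom (simp f ⊲ simp b) (simp g)).

Definition rtube_elt (C : numClosedFieldType) (D : umfc C) (M : right_module D)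
    (b : Irr D) (d e f g : Irr M) (nu : hom (simp d) (simp e ⊲ simp b))
    (zeta : hom (simp f ⊲ simp b) (simp g)) : right_tube M :=
  tube_elt (V := fun b d e => hom (simp d) (simp e ⊲ simp b))
           (W := fun b f g => hom (simp f ⊲ simp b) (simp g)) nu zeta.

Definition rbracket (C : numClosedFieldType) (D : umfc C) (M : right_module D)
    (B : D) (d e f g : Irr M) (nu : hom (simp d) (simp e ⊲ B))
    (zeta : hom (simp f ⊲ B) (simp g)) : right_tube M :=
  \sum_k \sum_(p < mult k B)
     rtube_elt ((idm (simp e) ⊲m prj k B p) ∘ nu)
               (zeta ∘ (idm (simp f) ⊲m inc k B p)).

Definition rflat (C : numClosedFieldType) (D : umfc C) (M : right_module D)
    (b : D) (x y : M) (u : hom (x ⊲ b) y) : hom x (y ⊲ dual b) :=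
  (u ⊲m idm (dual b)) ∘ rcup x b.

Definition rsharp (C : numClosedFieldType) (D : umfc C) (M : right_module D)
    (b : D) (x y : M) (u : hom y (x ⊲ b)) : hom (y ⊲ dual b) x :=
  rcap x b ∘ (u ⊲m idm (dual b)).

Definition rdim (C : numClosedFieldType) (D : umfc C) (M : right_module D)
  (m : Irr M) : C := rtr (idm (simp m : M)).

Record is_right_tube_algebra (C : numClosedFieldType) (D : umfc C)
    (M : right_module D) (H : wha_data (right_tube M)) : Prop :=
  IsRightTubeAlgebra {
  rtube_one :
    wone H =
    \sum_(i in (unit_irr : {set Irr D}))
      \sum_(y : Irr M | idm (simp y ⊲ simp i) != 0)
      \sum_(x : Irr M | idm (simp x ⊲ simp i) != 0)
        rtube_elt ((idm (simp y) ⊲m (unit_inc i)†) ∘ (rmunit (simp y))†)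
                  (rmunit (simp x) ∘ (idm (simp x) ⊲m unit_inc i));
  rtube_mul : forall (b b' : Irr D) (d e f g e' f' : Irr M)
      (nu : hom (simp d) (simp e ⊲ simp b))
      (zeta : hom (simp f ⊲ simp b) (simp g))
      (nu' : hom (simp e) (simp e' ⊲ simp b'))
      (zeta' : hom (simp f' ⊲ simp b') (simp f)),
    wmul H (rtube_elt nu zeta) (rtube_elt nu' zeta') =
    rbracket
      (rassoc (simp e') (simp b') (simp b) ∘ (nu' ⊲m idm (simp b)) ∘ nu)
      (zeta ∘ (zeta' ⊲m idm (simp b)) ∘ (rassoc (simp f') (simp b') (simp b))†);
  rtube_mul0 : forall (b b' : Irr D) (d e f g d' e' f' g' : Irr M)
      (nu : hom (simp d) (simp e ⊲ simp b))
      (zeta : hom (simp f ⊲ simp b) (simp g))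
      (nu' : hom (simp d') (simp e' ⊲ simp b'))
      (zeta' : hom (simp f' ⊲ simp b') (simp g')),
    ~~ ((f == g') && (e == d')) ->
    wmul H (rtube_elt nu zeta) (rtube_elt nu' zeta') = 0;
  rtube_eps : forall (b : Irr D) (d e : Irr M)
      (nu : hom (simp d) (simp e ⊲ simp b))
      (zeta : hom (simp e ⊲ simp b) (simp d)),
    weps H (rtube_elt nu zeta) *: idm (simp d) = zeta ∘ nu;
  rtube_eps0 : forall (b : Irr D) (d e f g : Irr M)
      (nu : hom (simp d) (simp e ⊲ simp b))
      (zeta : hom (simp f ⊲ simp b) (simp g)),
    ~~ ((e == f) && (d == g)) -> weps H (rtube_elt nu zeta) = 0;
  rtube_delta : forall (b : Irr D) (d e f g : Irr M)
      (nu : hom (simp d) (simp e ⊲ simp b))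
      (zeta : hom (simp f ⊲ simp b) (simp g)),
    wdelta H (rtube_elt nu zeta) =
    \sum_(i : Irr M) \sum_(j : Irr M) \sum_(s < mult j (simp i ⊲ simp b))
      rtube_elt (inc j (simp i ⊲ simp b) s) zeta
        ⊠ rtube_elt nu (prj j (simp i ⊲ simp b) s);
  rtube_S : forall (b : Irr D) (d e f g : Irr M)
      (nu : hom (simp d) (simp e ⊲ simp b))
      (zeta : hom (simp f ⊲ simp b) (simp g)),
    wS H (rtube_elt nu zeta) =
    (rdim f / rdim g) *: rbracket (rflat zeta) (rsharp nu);
  rtube_star : forall (b : Irr D) (d e f g : Irr M)
      (nu : hom (simp d) (simp e ⊲ simp b))
      (zeta : hom (simp f ⊲ simp b) (simp g)),
    wstar H (rtube_elt nu zeta) =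
    (rdim e / rdim d) *: rbracket (rflat nu†) (rsharp zeta†)
}.

(* Main.v *)
(* L is the coend of the functor a |-> (+)_(d,e) Hom(d, a e) on D against its dual:
   the bracket <<nu, zeta>>_A makes sense for every object A of D, is bilinear, and is
   balanced, <<t nu, zeta>>_B = <<nu, zeta t>>_A for t : A -> B.  Sums over dual bases
   in M obey the same rule, and all the bialgebra axioms follow by sliding morphisms
   through these two kinds of sums.  The antipode axioms rest on one more fact: by the
   zigzag identities and the module trace, bending rescaled by d_i / d_j carries dual
   bases of Hom(j, a i) to dual bases of Hom(i, a^* j).  For the C*-structure, the
   inner product of L for which the brackets of orthonormal bases are orthogonal with
   squared norm d_g / tr(id_(a e)) makes left multiplication by x^* the adjoint of left
   multiplication by x; bending is needed here in D itself, where tr(id_(a e)), for e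
   fixed, plays the role of the dimension of a.  As the regular representation is
   faithful, the involution is determined by this adjunction, so that it is involutive
   and antimultiplicative.  A right module over D is a left module over D with the
   reversed tensor product, and the two tube algebras coincide. *)

(* Three obstacles shape the proof. Products a a' and duals of simple objects are not among the
   representatives, so computing with structure constants would mean decomposing them at every step;
   product, counit and coproduct are therefore computed on brackets over arbitrary objects, where
   associators and unit isomorphisms are absorbed by balance. Second, checking directly that the
   star is involutive and reverses products would require identifying the dual of the dual of a with
   a, and the dual of a a' with a product of duals; the adjunction avoids both, since only one star
   occurs in it. Third, the weights: the star contributes d_e / d_d, bending the two tensor factors
   in M contributes d_d / d_e and d_g / d_f, and bending in D contributes a ratio of dimensions of
   simple objects of D; the weight d_g / dim(a) is what balances these factors. The dimension of a
   is read off from its action on e, because h |-> tr(h e) is a trace on endomorphisms in D that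
   inherits its partial trace property from M. *)
From HB Require Import structures.
From mathcomp Require Import all_boot all_order all_algebra complex classical_sets.
From mathcomp Require Import reals ring lra.
Require Import Defs.

Set Implicit Arguments.
Unset Strict Implicit.
Unset Printing Implicit Defensive.

Import Order.TTheory GRing.Theory Num.Theory.
Local Open Scope ring_scope.

(** * Linear maps and semisimple categories *)

Section Linear.
Variable C : numClosedFieldType.
Implicit Types U V W : lmodType C.

Lemma lin0 U V (f : U -> V) : linear f -> f 0 = 0.
Proof.
by move=> fL; have := fL (-1) 0 0; rewrite scaler0 addr0 scaleN1r addNr.
Qed.

Lemma linD U V (f : U -> V) : linear f -> {morph f : x y / x + y}.
Proof. by move=> fL x y; have := fL 1 x y; rewrite !scale1r. Qed.

Lemma linZ U V (f : U -> V) : linear f -> forall c, {morph f : x / c *: x}.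
Proof. by move=> fL c x; have := fL c x 0; rewrite !addr0 lin0 // addr0. Qed.

Lemma lin_sum U V (f : U -> V) (fL : linear f) I (r : seq I) (P : pred I)
    (F : I -> U) :
  f (\sum_(i <- r | P i) F i) = \sum_(i <- r | P i) f (F i).
Proof. by apply: big_morph; [exact: linD | exact: lin0]. Qed.

Lemma lin_id V : linear (fun v : V => v).
Proof. by []. Qed.

Lemma lin_fun U V W (f : V -> W) (F : U -> V) :
  linear f -> linear F -> linear (fun v => f (F v)).
Proof. by move=> fL FL c u v; rewrite FL fL. Qed.

Lemma lin_bilinl U V W W' (B : V -> W -> W') (F : U -> V) w :
  bilinear2 B -> linear F -> linear (fun v => B (F v) w).
Proof. by move=> [_ BL]; apply: lin_fun (B^~ w) F (BL w). Qed.

Lemma lin_bilinr U V W W' (B : V -> W -> W') (F : U -> W) v :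
  bilinear2 B -> linear F -> linear (fun u => B v (F u)).
Proof. by move=> [BL _]; apply: lin_fun (B v) F (BL v). Qed.

Lemma lin_scale V W (F : V -> W) c : linear F -> linear (fun v => c *: F v).
Proof. by move=> FL a u v; rewrite FL scalerDr !scalerA mulrC. Qed.

Lemma lin_scalel V W (F : V -> C^o) (w : W) :
  linear F -> linear (fun v => (F v : C) *: w).
Proof. by move=> FL a u v; rewrite FL scalerDl scalerA. Qed.

Lemma lin_mulr V (F : V -> C^o) (c : C) :
  linear F -> linear (fun v => (F v : C) * c : C^o).
Proof. by move=> FL a u v; rewrite FL mulrDl -[LHS]/(a * F u * c + _) -mulrA. Qed.

Lemma lin_mull V (F : V -> C^o) (c : C) :
  linear F -> linear (fun v => c * (F v : C) : C^o).
Proof.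
by move=> FL a u v; rewrite FL mulrDr -[LHS]/(c * (a * F u) + _) mulrCA.
Qed.

Lemma lin_bigsum V W I (r : seq I) (P : pred I) (F : I -> V -> W) :
  (forall i, linear (F i)) -> linear (fun v => \sum_(i <- r | P i) F i v).
Proof.
move=> FL c u v; rewrite scaler_sumr -big_split /=.
by apply: eq_bigr => i _; rewrite FL.
Qed.

Lemma lin_tlift V (T S : vectType C) W (B : T -> S -> W) (F : V -> tensor T S) :
  linear F -> linear (fun v => tlift B (F v)).
Proof.
move=> FL c u v; rewrite FL /tlift scaler_sumr -big_split /=.
apply: eq_bigr => i _; rewrite scaler_sumr -big_split /=.
by apply: eq_bigr => j _; rewrite !mxE scalerDl scalerA.
Qed.

Lemma lin_tliftB V (T S : vectType C) W (B : V -> T -> S -> W)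
    (t : tensor T S) :
  (forall a b, linear (fun v => B v a b)) -> linear (fun v => tlift (B v) t).
Proof.
move=> BL; apply: lin_bigsum => i; apply: lin_bigsum => j.
exact: lin_scale.
Qed.

Lemma stdc_linear (V : vectType C) i : linear (stdc i : V -> C^o).
Proof. by move=> c u v; rewrite /stdc linearP. Qed.

Lemma pure_bilinear (V W : vectType C) : bilinear2 (@pure C V W).
Proof.
split=> [v c x y|w c x y]; apply/matrixP => i j; rewrite !mxE stdc_linear.
  by rewrite mulrDr -[_ *: _]/(_ * _) mulrCA.
by rewrite mulrDl -[_ *: _]/(_ * _) -mulrA.
Qed.

Lemma bilinear_comp2 U V U' V' W (B : U' -> V' -> W) (f : U -> U') (g : V -> V') :
  bilinear2 B -> linear f -> linear g -> bilinear2 (fun u v => B (f u) (g v)).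
Proof.
by move=> bB fL gL; split=> u; [apply: lin_bilinr | apply: lin_bilinl].
Qed.

End Linear.

Section UCat.
Variables (C : numClosedFieldType) (X : ucat C).
Implicit Types (x y z : X) (k l : Irr X).

Let P := ucatP X.

Lemma comp_lin2 x y z : bilinear2 (@comp C X x y z).
Proof. exact: comp_bilinear. Qed.

Lemma compA x y z w (h : hom z w) (g : hom y z) (f : hom x y) :
  h ∘ (g ∘ f) = h ∘ g ∘ f.
Proof. exact: comp_assoc. Qed.

Lemma comp1l x y (f : hom x y) : idm y ∘ f = f.
Proof. exact: comp_idl. Qed.

Lemma comp1r x y (f : hom x y) : f ∘ idm x = f.
Proof. exact: comp_idr. Qed.

Lemma lin_compl (V : lmodType C) x y z (g : hom x y) (F : V -> hom y z) :
  linear F -> linear (fun v => F v ∘ g).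
Proof. exact: lin_bilinl (comp_lin2 x y z). Qed.

Lemma lin_compr (V : lmodType C) x y z (g : hom y z) (F : V -> hom x y) :
  linear F -> linear (fun v => g ∘ F v).
Proof. exact: lin_bilinr (comp_lin2 x y z). Qed.

Lemma comp0l x y z (f : hom x y) : (0 : hom y z) ∘ f = 0.
Proof. exact: lin0 (lin_compl f (@lin_id C _)). Qed.

Lemma comp0r x y z (f : hom y z) : f ∘ (0 : hom x y) = 0.
Proof. exact: lin0 (lin_compr f (@lin_id C _)). Qed.

Lemma compZl x y z c (g : hom y z) (f : hom x y) :
  (c *: g) ∘ f = c *: (g ∘ f).
Proof. exact: (linZ (lin_compl f (@lin_id C _))). Qed.

Lemma compZr x y z c (g : hom y z) (f : hom x y) :
  g ∘ (c *: f) = c *: (g ∘ f).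
Proof. exact: (linZ (lin_compr g (@lin_id C _))). Qed.

Lemma compSl x y z I (r : seq I) (Q : pred I) (F : I -> hom y z) (f : hom x y) :
  (\sum_(i <- r | Q i) F i) ∘ f = \sum_(i <- r | Q i) F i ∘ f.
Proof. exact: (lin_sum (lin_compl f (@lin_id C _))). Qed.

Lemma compSr x y z I (r : seq I) (Q : pred I) (F : I -> hom x y) (g : hom y z) :
  g ∘ (\sum_(i <- r | Q i) F i) = \sum_(i <- r | Q i) g ∘ F i.
Proof. exact: (lin_sum (lin_compr g (@lin_id C _))). Qed.

Lemma dagD x y (f g : hom x y) : (f + g)† = f† + g†.
Proof.
by have := dag_antilinear P 1 f g; rewrite conjC1 !scale1r.
Qed.

Lemma dag0 x y : (0 : hom x y)† = 0.
Proof. by have := dagD (0 : hom x y) 0; rewrite addr0 -{1}[_†]addr0 => /addrI. Qed.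

Lemma dagZ x y c (f : hom x y) : (c *: f)† = c^* *: f†.
Proof. by have := dag_antilinear P c f 0; rewrite dag0 !addr0. Qed.

Lemma dagS x y I (r : seq I) (Q : pred I) (F : I -> hom x y) :
  (\sum_(i <- r | Q i) F i)† = \sum_(i <- r | Q i) (F i)†.
Proof. by apply: (big_morph _ (@dagD x y) (@dag0 x y)). Qed.

Lemma dagKK x y (f : hom x y) : (f†)† = f.
Proof. exact: dagK. Qed.

Lemma dagM x y z (g : hom y z) (f : hom x y) : (g ∘ f)† = f† ∘ g†.
Proof. exact: dag_comp. Qed.

Lemma dag1 x : (idm x)† = idm x.
Proof. by rewrite -[LHS]comp1l -{1}(dagKK (idm x)) -dagM comp1l dagKK. Qed.

(* The identity when [k = l] and zero otherwise: it absorbs the Kronecker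
   deltas of the structure constants without any cast along [k = l]. *)
Definition dlt k l : hom (simp k : X) (simp l) :=
  if k =P l is ReflectT e
  then eq_rect k (fun m => hom (simp k : X) (simp m)) (idm _) l e else 0.

Lemma dltE k : dlt k k = idm _.
Proof. by rewrite /dlt; case: eqP => // e; rewrite (eq_axiomK e). Qed.

Lemma dlt_neq k l : k != l -> dlt k l = 0.
Proof. by rewrite /dlt; case: eqP. Qed.

Lemma dlt_dag k l : (dlt k l)† = dlt l k.
Proof.
have [<-|n] := eqVneq k l; first by rewrite dltE dag1.
by rewrite !dlt_neq ?dag0 // eq_sym.
Qed.

Lemma id_simp0 k : idm (simp k : X) <> 0.
Proof. by case: (irr_simple P k). Qed.

(** Defined for all k and l, so that scalars of composites can be written before their labels are
    known to agree; for k different from l the Hom space is zero and so is the value. *)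
Definition co k l (f : hom (simp k : X) (simp l)) : C :=
  coord [tuple dlt k l] ord0 f.

Lemma co_linear k l : linear (@co k l : _ -> C^o).
Proof. by move=> c u v; rewrite /co linearP. Qed.

Lemma co_id k : co (idm (simp k : X)) = 1.
Proof.
rewrite /co -(dltE k).
have fr : free [tuple dlt k k].
  by rewrite -[tval _]/[:: dlt k k] seq1_free dltE; apply/eqP/id_simp0.
by have := coord_free ord0 ord0 fr; rewrite eqxx.
Qed.

Lemma coZ k l c (f : hom (simp k : X) (simp l)) : co (c *: f) = c * co f.
Proof. exact: (linZ (@co_linear k l)). Qed.

Lemma co0 k l : co (0 : hom (simp k : X) (simp l)) = 0.
Proof. exact: (lin0 (@co_linear k l)). Qed.

Lemma co_neq k l (f : hom (simp k : X) (simp l)) : k != l -> co f = 0.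
Proof. by move=> n; rewrite (irr_hom0 P f n) co0. Qed.

Lemma coE k l (f : hom (simp k : X) (simp l)) : f = co f *: dlt k l.
Proof.
have [kl|n] := eqVneq k l; last by rewrite co_neq // scale0r (irr_hom0 P f n).
case: l / kl f => f; have [_ /(_ f) [c ->]] := irr_simple P k.
by rewrite dltE coZ co_id mulr1.
Qed.

Lemma coE1 k (f : hom (simp k : X) (simp k)) : f = co f *: idm _.
Proof. by rewrite -dltE -coE. Qed.

Lemma co_dag k l (f : hom (simp k : X) (simp l)) : co f† = (co f)^*.
Proof.
have [kl|n] := eqVneq k l; last first.
  by rewrite !co_neq ?conjC0 // eq_sym.
case: l / kl f => f.
by rewrite (coE1 f) dagZ !coZ dag1 co_id !mulr1.
Qed.

Lemma co_comp k l m (g : hom (simp l : X) (simp m)) (f : hom (simp k : X) (simp l)) :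
  k = l -> l = m -> co (g ∘ f) = co g * co f.
Proof.
move=> kl lm; subst l m.
by rewrite [X in X ∘ f](coE1 g) compZl comp1l coZ.
Qed.

(** Positivity replaces f by an endomorphism g of the simple object, and then the scalar is the
    squared modulus of [co g]. *)
Lemma co_ge0 k x (f : hom (simp k) x) : 0 <= co (f† ∘ f).
Proof.
have [g ->] := dag_positive P f.
by rewrite co_comp // co_dag mulrC -normCK exprn_ge0.
Qed.

Lemma co_eq0 k x (f : hom (simp k) x) : co (f† ∘ f) = 0 -> f = 0.
Proof. by move=> f0; apply: (dag_eq0 P); rewrite [LHS]coE f0 scale0r. Qed.

Lemma sum_dltl (U : nmodType) l (F : forall k, hom (simp k : X) (simp l) -> U) :
  (forall k, F k 0 = 0) -> \sum_k F k (dlt k l) = F l (idm _).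
Proof.
move=> F0; rewrite (bigD1 l) //= dltE big1 ?addr0 // => k /dlt_neq ->.
exact: F0.
Qed.

Lemma sum_dltr (U : nmodType) l (F : forall k, hom (simp l : X) (simp k) -> U) :
  (forall k, F k 0 = 0) -> \sum_k F k (dlt l k) = F l (idm _).
Proof.
move=> F0; rewrite (bigD1 l) //= dltE big1 ?addr0 // => k.
by rewrite eq_sym => /dlt_neq ->.
Qed.

(** For bilinear B this is the image of the canonical element of (+)_k Hom(k, x) (x) Hom(x, k).
    Brackets (in D) and coproducts (in M) are both of this form. *)
Definition bsum (U : nmodType) x
    (B : forall k, hom (simp k) x -> hom x (simp k) -> U) : U :=
  \sum_k \sum_(t < mult k x) B k (inc k x t) (prj k x t).

Lemma eq_bsum (U : nmodType) x
    (B B' : forall k, hom (simp k) x -> hom x (simp k) -> U) :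
  (forall k u v, B k u v = B' k u v) -> bsum B = bsum B'.
Proof.
by move=> BB; apply: eq_bigr => k _; apply: eq_bigr => t _; rewrite BB.
Qed.

Lemma bsum_lin (U V : lmodType C) x (F : U -> V)
    (B : forall k, hom (simp k) x -> hom x (simp k) -> U) :
  linear F -> F (bsum B) = bsum (fun k u v => F (B k u v)).
Proof.
move=> FL; rewrite /bsum (lin_sum FL); apply: eq_bigr => k _.
by rewrite (lin_sum FL).
Qed.

Lemma bsum_sum (U : nmodType) I (r : seq I) (Q : pred I) x
    (B : I -> forall k, hom (simp k) x -> hom x (simp k) -> U) :
  \sum_(i <- r | Q i) bsum (B i) = bsum (fun k u v => \sum_(i <- r | Q i) B i k u v).
Proof.
rewrite exchange_big; apply: eq_bigr => k _.
by rewrite exchange_big.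
Qed.

Lemma expand_inc k x (f : hom (simp k) x) :
  f = \sum_(t < mult k x) co (prj k x t ∘ f) *: inc k x t.
Proof.
rewrite -{1}(comp1l f) -(inc_prj P) compSl (bigD1 k) //= [X in _ + X]big1.
  rewrite addr0 compSl; apply: eq_bigr => t _; rewrite -compA.
  by rewrite {1}(coE1 (prj k x t ∘ f)) compZr comp1r.
move=> l n; rewrite compSl big1 // => t _; rewrite -compA.
by rewrite (irr_hom0 P (prj l x t ∘ f)) ?comp0r // eq_sym.
Qed.

Lemma expand_prj k x (f : hom x (simp k)) :
  f = \sum_(t < mult k x) co (f ∘ inc k x t) *: prj k x t.
Proof.
rewrite -{1}(comp1r f) -(inc_prj P) compSr (bigD1 k) //= [X in _ + X]big1.
  rewrite addr0 compSr; apply: eq_bigr => t _; rewrite compA.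
  by rewrite {1}(coE1 (f ∘ inc k x t)) compZl comp1l.
move=> l n; rewrite compSr big1 // => t _; rewrite compA.
by rewrite (irr_hom0 P (f ∘ inc l x t)) ?comp0l.
Qed.

(** Expanding in the bases of either object gives the same double sum, whose coefficients are the
    matrix of f on the multiplicity spaces. *)
Lemma bsum_balance (U : lmodType C) x y (f : hom x y)
    (B : forall k, hom (simp k) y -> hom x (simp k) -> U) :
  (forall k, bilinear2 (B k)) ->
  bsum (fun k (u : hom _ x) v => B k (f ∘ u) v) =
  bsum (fun k u (v : hom y _) => B k u (v ∘ f)).
Proof.
move=> bB; apply: eq_bigr => k _.
transitivity (\sum_(t < mult k x) \sum_(s < mult k y)
   co (prj k y s ∘ f ∘ inc k x t) *: B k (inc k y s) (prj k x t)).
  apply: eq_bigr => t _; rewrite {1}(expand_inc (f ∘ inc k x t)).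
  rewrite (lin_sum ((bB k).2 _)); apply: eq_bigr => s _.
  by rewrite (linZ ((bB k).2 _)) compA.
rewrite exchange_big; apply: eq_bigr => s _.
rewrite [X in _ = B k _ X](expand_prj (prj k y s ∘ f)).
rewrite (lin_sum ((bB k).1 _)); apply: eq_bigr => t _.
by rewrite (linZ ((bB k).1 _)).
Qed.

Lemma bsum_res (U : lmodType C) x (F : hom x x -> U) :
  linear F -> bsum (fun k u v => F (u ∘ v)) = F (idm x).
Proof.
move=> FL; rewrite -(inc_prj P) (lin_sum FL); apply: eq_bigr => k _.
by rewrite (lin_sum FL).
Qed.

(* [u] and [v] need not be indexed by a basis: it is enough that they resolve the
   [k]-isotypic component of [x]. *)
Lemma bsum_component (U : lmodType C) k x (I : finType) (u : I -> hom (simp k) x)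
    (v : I -> hom x (simp k)) (B : hom (simp k) x -> hom x (simp k) -> U) :
  bilinear2 B -> (forall f : hom (simp k) x, \sum_i u i ∘ (v i ∘ f) = f) ->
  \sum_i B (u i) (v i) = \sum_(t < mult k x) B (inc k x t) (prj k x t).
Proof.
move=> bB uv.
transitivity (\sum_i \sum_(t < mult k x)
   co (v i ∘ inc k x t) *: B (u i) (prj k x t)).
  apply: eq_bigr => i _; rewrite {1}(expand_prj (v i)).
  rewrite (lin_sum (bB.1 _)); apply: eq_bigr => t _.
  by rewrite (linZ (bB.1 _)).
rewrite exchange_big; apply: eq_bigr => t _.
rewrite -[in RHS](uv (inc k x t)) (lin_sum (bB.2 _)); apply: eq_bigr => i _.
by rewrite {2}(coE1 (v i ∘ inc k x t)) compZr comp1r (linZ (bB.2 _)).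
Qed.

Lemma bsum_simple (U : lmodType C) k
    (B : forall l, hom (simp l : X) (simp k) -> hom (simp k) (simp l) -> U) :
  (forall l, bilinear2 (B l)) -> bsum B = B k (idm _) (idm _).
Proof.
move=> bB; rewrite /bsum (bigD1 k) //= [X in _ + X]big1 ?addr0 => [|l n].
  rewrite -(@bsum_component _ k (simp k) 'I_1 (fun _ => idm _) (fun _ => idm _) (B k)) //.
    by rewrite big_ord1.
  by move=> f; rewrite big_ord1 !comp1l.
apply: big1 => t _.
by rewrite (irr_hom0 P (inc l (simp k) t) n) (lin0 ((bB l).2 _)).
Qed.

(** Sliding h to the other side leaves a sum over dual bases of a simple object, which has a single
    term. This is how counits and Kronecker deltas remove a sum. *)
Lemma bsum_postl (U : lmodType C) k x (h : hom x (simp k))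
    (B : forall l, hom (simp l : X) (simp k) -> hom x (simp l) -> U) :
  (forall l, bilinear2 (B l)) ->
  bsum (fun l u v => B l (h ∘ u) v) = B k (idm _) h.
Proof.
move=> bB; rewrite (bsum_balance h bB).
rewrite (@bsum_simple _ k (fun l u v => B l u (v ∘ h))) ?comp1l // => l.
by apply: bilinear_comp2 => //; apply: lin_compl.
Qed.

Lemma bsum_postr (U : lmodType C) k x (h : hom (simp k) x)
    (B : forall l, hom (simp l) x -> hom (simp k : X) (simp l) -> U) :
  (forall l, bilinear2 (B l)) ->
  bsum (fun l u v => B l u (v ∘ h)) = B k h (idm _).
Proof.
move=> bB; rewrite -(bsum_balance h bB).
rewrite (@bsum_simple _ k (fun l u v => B l (h ∘ u) v)) ?comp1r // => l.
by apply: bilinear_comp2 => //; apply: lin_compr.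
Qed.

(** The inclusions need not be isometries, so the daggers form another pair of dual bases; the
    dagger of the resolution of the identity is again one, which is what [bsum_component] asks
    for. *)
Lemma sum_dag (U : lmodType C) k x
    (B : hom (simp k) x -> hom x (simp k) -> U) : bilinear2 B ->
  \sum_(t < mult k x) B (prj k x t)† (inc k x t)† =
  \sum_(t < mult k x) B (inc k x t) (prj k x t).
Proof.
move=> bB.
apply: (bsum_component (u := fun t => (prj k x t)†) (v := fun t => (inc k x t)†)).
  exact: bB.
move=> f; rewrite -[RHS]dagKK -(comp1r f†) -(inc_prj P) compSr dagS.
rewrite [RHS](bigD1 k) //= [X in _ + X]big1 ?addr0 => [|l n].
  rewrite compSr dagS; apply: eq_bigr => t _.
  by rewrite !dagM dagKK compA.
rewrite compSr dagS; apply: big1 => t _.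
by rewrite compA (irr_hom0 P (f† ∘ inc l x t) n) comp0l dag0.
Qed.

Lemma bsum_dag (U : lmodType C) x
    (B : forall k, hom (simp k) x -> hom x (simp k) -> U) :
  (forall k, bilinear2 (B k)) -> bsum (fun k u v => B k v† u†) = bsum B.
Proof. by move=> bB; apply: eq_bigr => k _; apply: sum_dag. Qed.

End UCat.

(** * Module categories without trace *)

(** This equation and the next two carry a tail k, so that they rewrite inside right-nested
    composites and replace rewriting modulo associativity. *)
Lemma precomp (C : numClosedFieldType) (X : ucat C) (x y z w v : X)
    (g : hom y z) (f : hom x y) (g' : hom w z) (f' : hom x w) :
  g ∘ f = g' ∘ f' -> forall k : hom v x, g ∘ (f ∘ k) = g' ∘ (f' ∘ k).
Proof. by move=> e k; rewrite compA e compA. Qed.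

Lemma precomp1 (C : numClosedFieldType) (X : ucat C) (x y z v : X)
    (g : hom y z) (f : hom x y) (h : hom x z) :
  g ∘ f = h -> forall k : hom v x, g ∘ (f ∘ k) = h ∘ k.
Proof. by move=> e k; rewrite compA e. Qed.

Lemma precompK (C : numClosedFieldType) (X : ucat C) (x y v : X)
    (g : hom y x) (f : hom x y) :
  g ∘ f = idm x -> forall k : hom v x, g ∘ (f ∘ k) = k.
Proof. by move=> e k; rewrite compA e comp1l. Qed.

(** The part of [is_lmod] that does not mention the trace. It is split off so that the calculus of
    bending applies to D acting on itself as well as to M. *)
Record is_action (C : numClosedFieldType) (D : umfc C) (M : lmod_data D) : Prop :=
  IsAction {
  act_lin2 : forall (a a' : D) (m m' : M), bilinear2 (@lactm C D M a a' m m');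
  act1 : forall (a : D) (m : M), idm a ⊳m idm m = idm (a ⊳ m);
  actM : forall (a a' a'' : D) (m m' m'' : M) (f' : hom a' a'')
      (f : hom a a') (g' : hom m' m'') (g : hom m m'),
    (f' ∘ f) ⊳m (g' ∘ g) = (f' ⊳m g') ∘ (f ⊳m g);
  act_dag : forall (a a' : D) (m m' : M) (f : hom a a') (g : hom m m'),
    (f ⊳m g)† = f† ⊳m g†;
  act_assoc : forall (a a' b b' : D) (m m' : M) (f : hom a a') (g : hom b b')
      (h : hom m m'),
    lassoc a' b' m' ∘ ((f ⊗m g) ⊳m h) = (f ⊳m (g ⊳m h)) ∘ lassoc a b m;
  act_unit : forall (m m' : M) (f : hom m m'),
    lmunit m' ∘ (idm unito ⊳m f) = f ∘ lmunit m;
  act_assocU : forall (a b : D) (m : M), isometric_iso (lassoc a b m);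
  act_unitU : forall m : M, isometric_iso (lmunit m);
  act_pentagon : forall (a b c : D) (m : M),
    lassoc a b (c ⊳ m) ∘ lassoc (a ⊗ b) c m =
    (idm a ⊳m lassoc b c m) ∘ lassoc a (b ⊗ c) m ∘ (assoc a b c ⊳m idm m);
  act_triangle : forall (a : D) (m : M),
    (idm a ⊳m lmunit m) ∘ lassoc a unito m = runit a ⊳m idm m
}.

Lemma left_module_action (C : numClosedFieldType) (D : umfc C)
  (M : left_module D) : is_action M.
Proof. by case: (lmodP M). Qed.

(** The trace 0 is a placeholder: only [is_action] is claimed of this module. *)
Definition regular_module (C : numClosedFieldType) (D : umfc C) : lmod_data D :=
  LmodData (@tenm C D) (@assoc C D) (@lunit C D) (fun _ _ => 0).

Lemma regular_action (C : numClosedFieldType) (D : umfc C) :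
  is_action (regular_module D).
Proof. by case: (umfcP D). Qed.

Section Action.
Variables (C : numClosedFieldType) (D : umfc C) (M : lmod_data D).
Hypothesis MP : is_action M.
Implicit Types (a b : D) (m n : M).

Let actM := actM MP.
Let act1 := act1 MP.

Lemma lin_actl (V : lmodType C) a a' m m' (F : V -> hom a a') (g : hom m m') :
  linear F -> linear (fun v => F v ⊳m g).
Proof. exact: lin_bilinl (act_lin2 MP a a' m m'). Qed.

Lemma lin_actr (V : lmodType C) a a' m m' (F : V -> hom m m') (g : hom a a') :
  linear F -> linear (fun v => g ⊳m F v).
Proof. exact: lin_bilinr (act_lin2 MP a a' m m'). Qed.

Lemma actMl a m m' m'' (g : hom m' m'') (f : hom m m') :
  idm a ⊳m (g ∘ f) = (idm a ⊳m g) ∘ (idm a ⊳m f).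
Proof. by rewrite -actM comp1l. Qed.

Lemma actMr a a' a'' m (g : hom a' a'') (f : hom a a') :
  (g ∘ f) ⊳m idm m = (g ⊳m idm m) ∘ (f ⊳m idm m).
Proof. by rewrite -actM comp1l. Qed.

Lemma act_swap a a' m m' (f : hom a a') (g : hom m m') :
  (f ⊳m idm m') ∘ (idm a ⊳m g) = (idm a' ⊳m g) ∘ (f ⊳m idm m).
Proof. by rewrite -!actM !comp1l !comp1r. Qed.

Lemma assocK a b m : (lassoc a b m)† ∘ lassoc a b m = idm _.
Proof. exact: (act_assocU MP a b m).1. Qed.

Lemma assocVK a b m : lassoc a b m ∘ (lassoc a b m)† = idm _.
Proof. exact: (act_assocU MP a b m).2. Qed.

Lemma munitK m : (lmunit m)† ∘ lmunit m = idm _.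
Proof. exact: (act_unitU MP m).1. Qed.

Lemma munitVK m : lmunit m ∘ (lmunit m)† = idm _.
Proof. exact: (act_unitU MP m).2. Qed.

Lemma assocV_nat a a' b b' m m' (f : hom a a') (g : hom b b') (h : hom m m') :
  ((f ⊗m g) ⊳m h) ∘ (lassoc a b m)† = (lassoc a' b' m')† ∘ (f ⊳m (g ⊳m h)).
Proof.
rewrite -[LHS]comp1l -(assocK a' b' m') -!compA; congr (_ ∘ _).
by rewrite !compA (act_assoc MP) -compA assocVK comp1r.
Qed.

Lemma unitV_nat m m' (f : hom m m') :
  (idm unito ⊳m f) ∘ (lmunit m)† = (lmunit m')† ∘ f.
Proof.
rewrite -[LHS]comp1l -(munitK m') -!compA; congr (_ ∘ _).
by rewrite !compA (act_unit MP) -compA munitVK comp1r.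
Qed.

Lemma pentagonV a b c m :
  (lassoc a b (c ⊳ m))† ∘ (idm a ⊳m lassoc b c m) ∘ lassoc a (b ⊗ c) m =
  lassoc (a ⊗ b) c m ∘ ((assoc a b c)† ⊳m idm m).
Proof.
have [_ aV] := assoc_unitary (umfcP D) a b c.
have e := act_pentagon MP a b c m.
rewrite -compA.
have -> : idm a ⊳m lassoc b c m ∘ lassoc a (b ⊗ c) m =
   (lassoc a b (c ⊳ m) ∘ lassoc (a ⊗ b) c m) ∘ ((assoc a b c)† ⊳m idm m).
  by rewrite e -compA -actMr aV act1 comp1r.
rewrite -!compA; exact: precompK (assocK _ _ _) _.
Qed.

Lemma unit_act_faithful m m' (f g : hom m m') :
  idm unito ⊳m f = idm unito ⊳m g -> f = g.
Proof.
move=> fg; rewrite -[f]comp1r -[g]comp1r -(munitVK m) !compA.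
by rewrite -!(act_unit MP) fg.
Qed.

(* Kelly's argument: coherence for the unit on the left follows from the triangle
   axiom, which has it in the middle. *)
Lemma unit_triangle a m : lmunit (a ⊳ m) ∘ lassoc unito a m = lunit a ⊳m idm m.
Proof.
apply: unit_act_faithful.
have [_ aV] := assoc_unitary (umfcP D) unito unito a.
rewrite -[LHS]comp1r -[RHS]comp1r -(assocVK unito (unito ⊗ a) m) !compA.
congr (_ ∘ _).
rewrite -[LHS]comp1r -[RHS]comp1r -act1 -aV actMr !compA.
congr (_ ∘ _).
rewrite actMl -!compA [X in _ ∘ X]compA -(act_pentagon MP).
rewrite compA (act_triangle MP) -act1 -(act_assoc MP).
rewrite -(triangle (umfcP D)) actMr !compA (act_assoc MP).
by rewrite -!compA.
Qed.

Definition lcoev a m : hom m (a ⊳ dual a ⊳ m) :=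
  lassoc a (dual a) m ∘ (coev a ⊳m idm m) ∘ (lmunit m)†.

Lemma lcap_dag a m : (lcap a m)† = lcup a m.
Proof. by rewrite /lcap /lcup !dagM dagKK (act_dag MP) dag1 !compA. Qed.

Lemma lcap_nat a m n (f : hom m n) :
  lcap a n ∘ (idm (dual a) ⊳m (idm a ⊳m f)) = f ∘ lcap a m.
Proof.
rewrite /lcap -!compA -assocV_nat (tenm_id (umfcP D)).
rewrite (precomp (act_swap (ev a) f)) (precomp (act_unit MP f)).
by rewrite !compA.
Qed.

Lemma lcup_nat a m n (f : hom m n) :
  (idm (dual a) ⊳m (idm a ⊳m f)) ∘ lcup a m = lcup a n ∘ f.
Proof.
rewrite /lcup -!compA compA -(act_assoc MP) (tenm_id (umfcP D)).
rewrite -!compA; congr (_ ∘ _).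
by rewrite -(precomp (act_swap _ _)) unitV_nat.
Qed.

Lemma lcoev_nat a m n (f : hom m n) :
  (idm a ⊳m (idm (dual a) ⊳m f)) ∘ lcoev a m = lcoev a n ∘ f.
Proof.
rewrite /lcoev -!compA compA -(act_assoc MP) (tenm_id (umfcP D)).
rewrite -!compA; congr (_ ∘ _).
by rewrite -(precomp (act_swap _ _)) unitV_nat.
Qed.

(** The pentagon, with one associator moved across by unitarity, and the two triangles collect all
    coherence isomorphisms of M into those of D; what remains is [zigzag_r] acting on m. *)
Lemma zigzag_cap_coev a m : (idm a ⊳m lcap a m) ∘ lcoev a (a ⊳ m) = idm (a ⊳ m).
Proof.
have e : (idm a ⊳m lassoc (dual a) a m)† ∘ lassoc a (dual a) (a ⊳ m) =
   lassoc a (dual a ⊗ a) m ∘ (assoc a (dual a) a ⊳m idm m) ∘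
     (lassoc (a ⊗ dual a) a m)†.
  rewrite -[LHS]comp1r -(assocVK (a ⊗ dual a) a m) !compA; congr (_ ∘ _).
  rewrite -compA (act_pentagon MP) !compA (act_dag MP) dag1 -actMl assocK act1.
  by rewrite comp1l.
rewrite /lcap /lcoev !actMl; move: e; rewrite (act_dag MP) dag1 => e.
rewrite -!compA (precomp1 e) -!compA -act1.
rewrite -(precomp (assocV_nat _ _ _)) -dagM unit_triangle (act_dag MP) dag1.
rewrite -(precomp (act_assoc MP _ _ _)) (precomp1 (act_triangle MP _ _)).
rewrite -!actMr -?compA.
have := zigzag_r (umfcP D) a; rewrite -!compA => ->.
by rewrite !act1.
Qed.

Lemma zigzag_coev_cap a m :
  lcap a (dual a ⊳ m) ∘ (idm (dual a) ⊳m lcoev a m) = idm (dual a ⊳ m).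
Proof.
have e : (lassoc (dual a) a (dual a ⊳ m))† ∘ (idm (dual a) ⊳m lassoc a (dual a) m)
   = lassoc (dual a ⊗ a) (dual a) m ∘ ((assoc (dual a) a (dual a))† ⊳m idm m) ∘
     (lassoc (dual a) (a ⊗ dual a) m)†.
  by rewrite -pentagonV -compA assocVK comp1r.
rewrite /lcap /lcoev !actMl -!compA (precomp1 e) -!compA.
rewrite -(precomp (assocV_nat _ _ _)).
have -> : (lassoc (dual a) unito m)† ∘ (idm (dual a) ⊳m (lmunit m)†) =
    (runit (dual a))† ⊳m idm m.
  rewrite -[LHS]dagKK dagM dagKK (act_dag MP) dagKK dag1 (act_triangle MP).
  by rewrite (act_dag MP) dag1.
rewrite -act1 -(precomp (act_assoc MP _ _ _)) (precomp1 (unit_triangle _ _)).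
rewrite -!actMr -?compA.
have := zigzag_l (umfcP D) a; rewrite -!compA => ->.
by rewrite !act1.
Qed.

(** Bending in D and then acting on m is bending in M around x m. Through this link the trace of M
    controls duals in D. *)
Lemma lcap_regular a (x : D) m :
  (lcap (M := regular_module D) a x : hom (dual a ⊗ (a ⊗ x)) x) ⊳m idm m =
  lcap a (x ⊳ m) ∘ (idm (dual a) ⊳m lassoc a x m) ∘ lassoc (dual a) (a ⊗ x) m.
Proof.
rewrite /lcap -!compA (compA (_†)) pentagonV -act1.
rewrite -(precomp (act_assoc MP _ _ _)) (precomp1 (unit_triangle _ _)).
by rewrite -!actMr -?compA.
Qed.

End Action.

(** * Bending and traces *)

Section Bending.
Variables (C : numClosedFieldType) (D : umfc C) (M : lmod_data D).
Hypothesis MP : is_action M.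
Implicit Types (a b : D) (m n x y : M).

Definition flat a x y (u : hom (a ⊳ x) y) : hom x (dual a ⊳ y) :=
  (idm (dual a) ⊳m u) ∘ lcup a x.

Definition sharp a x y (u : hom y (a ⊳ x)) : hom (dual a ⊳ y) x :=
  lcap a x ∘ (idm (dual a) ⊳m u).

Lemma flat_lin a x y : linear (@flat a x y).
Proof. by apply: lin_compl; apply: lin_actr => //; exact: lin_id. Qed.

Lemma sharp_lin a x y : linear (@sharp a x y).
Proof. by apply: lin_compr; apply: lin_actr => //; exact: lin_id. Qed.

Lemma sharp_dag a x y (u : hom y (a ⊳ x)) : (sharp u)† = flat u†.
Proof. by rewrite /sharp dagM (lcap_dag MP) (act_dag MP) dag1. Qed.

Lemma sharp_flat a x y z (u : hom y (a ⊳ x)) (v : hom (a ⊳ z) y) :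
  sharp u ∘ flat v = lcap a x ∘ (idm (dual a) ⊳m (u ∘ v)) ∘ lcup a z.
Proof. by rewrite /sharp /flat (actMl MP) !compA. Qed.

Lemma flat_comp a x x' y (u : hom (a ⊳ x) y) (v : hom x' x) :
  flat u ∘ v = flat (u ∘ (idm a ⊳m v)).
Proof. by rewrite /flat -compA -(lcup_nat MP) compA (actMl MP). Qed.

Lemma comp_flat a x y y' (u : hom (a ⊳ x) y) (v : hom y y') :
  (idm (dual a) ⊳m v) ∘ flat u = flat (v ∘ u).
Proof. by rewrite /flat compA -(actMl MP). Qed.

Lemma comp_sharp a x x' y (u : hom y (a ⊳ x)) (v : hom x x') :
  v ∘ sharp u = sharp ((idm a ⊳m v) ∘ u).
Proof. by rewrite /sharp compA -(lcap_nat MP) -compA (actMl MP). Qed.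

Lemma sharp_comp a x y y' (u : hom y (a ⊳ x)) (v : hom y' y) :
  sharp u ∘ (idm (dual a) ⊳m v) = sharp (u ∘ v).
Proof. by rewrite /sharp -compA -(actMl MP). Qed.

Lemma sharpK a x y (u : hom y (a ⊳ x)) : (idm a ⊳m sharp u) ∘ lcoev a y = u.
Proof.
rewrite /sharp (actMl MP) -compA (lcoev_nat MP) compA (zigzag_cap_coev MP).
by rewrite comp1l.
Qed.

Lemma flat_surj a x y (f : hom x (dual a ⊳ y)) :
  flat ((lcoev a y)† ∘ (idm a ⊳m f)) = f.
Proof.
rewrite /flat (actMl MP) -compA (lcup_nat MP) compA -(lcap_dag MP).
rewrite -[X in (X ⊳m _) ∘ _]dag1 -(act_dag MP) -dagM (zigzag_coev_cap MP) dag1.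
by rewrite comp1l.
Qed.

(* Rescaled bending turns dual bases of Hom(j, a i) into dual bases of
   Hom(i, ābar j), provided the partial trace of End(a i) matches the scalar
   traces up to the weights [ki], [kj]. *)
Lemma bsum_bend (U : lmodType C) a (i j : Irr M) (ki kj : C)
    (B : hom (simp i) (dual a ⊳ simp j) -> hom (dual a ⊳ simp j) (simp i) -> U) :
  bilinear2 B -> ki != 0 -> kj != 0 ->
  (forall (s : hom (simp j) (a ⊳ simp i)) (g : hom (a ⊳ simp i) (simp j)),
     ki *: lptr (s ∘ g) = (kj * co (g ∘ s)) *: idm (simp i : M)) ->
  \sum_(t < mult j (a ⊳ simp i))
     (ki / kj) *: B (flat (prj j (a ⊳ simp i) t)) (sharp (inc j (a ⊳ simp i) t)) =
  \sum_(t < mult i (dual a ⊳ simp j))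
     B (inc i (dual a ⊳ simp j) t) (prj i (dual a ⊳ simp j) t).
Proof.
move=> bB ki0 kj0 tr.
rewrite -(bsum_component
  (u := fun t => (ki / kj) *: flat (prj j (a ⊳ simp i) t))
  (v := fun t => sharp (inc j (a ⊳ simp i) t)) bB).
  by apply: eq_bigr => t _; rewrite (linZ (bB.2 _)).
(* Every f is a bent morphism [flat g]. The composite of a [sharp] with it is then a partial trace,
   which the hypothesis turns into a scalar. *)
move=> f; rewrite -[RHS]flat_surj; set g := _ ∘ _.
rewrite [in RHS](expand_prj g) (lin_sum (@flat_lin _ _ _)); apply: eq_bigr => t _.
rewrite -{1}[f]flat_surj -/g sharp_flat -[_ ∘ _ ∘ _]/(lptr _).
have -> : lptr (inc j (a ⊳ simp i) t ∘ g) =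
    (kj / ki * co (g ∘ inc j (a ⊳ simp i) t)) *: idm _.
  by apply: (scalerI ki0); rewrite [LHS]tr scalerA mulrA mulrCA mulfV ?mulr1.
rewrite compZl compZr comp1r scalerA (linZ (@flat_lin _ _ _)).
by congr (_ *: _); field; rewrite ki0.
Qed.

Lemma lcup_regular a (x : D) m :
  (lcup (M := regular_module D) a x : hom x (dual a ⊗ (a ⊗ x))) ⊳m idm m =
  (lassoc (dual a) (a ⊗ x) m)† ∘ (idm (dual a) ⊳m (lassoc a x m)†) ∘
    lcup a (x ⊳ m).
Proof.
rewrite -(lcap_dag (regular_action D)) -(dag1 m) -(act_dag MP).
by rewrite (lcap_regular MP) dagM dagM (lcap_dag MP) (act_dag MP) dag1 compA.
Qed.

End Bending.

Section Trace.
Variables (C : numClosedFieldType) (D : umfc C) (M : left_module D).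
Implicit Types (m n : M) (i j k : Irr M).

Let MP := left_module_action M.

Lemma ldim_gt0 k : 0 < ldim k.
Proof. exact: ltr_pos (lmodP M) _ (irr_simple (ucatP M) k). Qed.

Lemma ldim_neq0 k : ldim k != 0.
Proof. by rewrite gt_eqF ?ldim_gt0. Qed.

Lemma ltr_lin m : linear (@ltr C D M m : _ -> C^o).
Proof. exact: (ltr_linear (lmodP M)). Qed.

Lemma ltr_co k (f : hom (simp k) (simp k)) : ltr f = co f * ldim k.
Proof. by rewrite {1}(coE1 f) (linZ (@ltr_lin _)). Qed.

Lemma ltr_id m : ltr (idm m) = \sum_k ldim k *+ mult k m.
Proof.
rewrite -(inc_prj (ucatP M)) (lin_sum (@ltr_lin _)); apply: eq_bigr => k _.
rewrite (lin_sum (@ltr_lin _)) -[X in _ *+ X]card_ord -sumr_const.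
apply: eq_bigr => t _.
by rewrite (ltr_cyclic (lmodP M)) (prj_inc (ucatP M)) eqxx scale1r.
Qed.

(** The trace is the sum of the positive d_k with multiplicities, so it can vanish only if m has no
    simple summand. *)
Lemma ltr_id_gt0 m : idm m != 0 -> 0 < ltr (idm m).
Proof.
rewrite ltr_id => m0; rewrite lt_neqAle sumr_ge0 ?andbT; last first.
  by move=> k _; rewrite mulrn_wge0 ?ltW ?ldim_gt0.
rewrite eq_sym; apply: contra m0 => /eqP/psumr_eq0P e.
rewrite -(inc_prj (ucatP M)); apply/eqP; apply: big1 => k _.
have /eqP : ldim k *+ mult k m = 0.
  by apply: e => // l _; rewrite mulrn_wge0 ?ltW ?ldim_gt0.
rewrite mulrn_eq0 (negPf (ldim_neq0 k)) orbF => /eqP m0.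
by apply: big1 => t _; move: (ltn_ord t); rewrite [X in (_ < X)%N]m0.
Qed.

(** Both sides compute the trace of s g on a i: through the partial trace over a, and by cyclicity
    as the trace of g s on j. *)
Lemma module_bend_trace (a : Irr D) i j (s : hom (simp j) (simp a ⊳ simp i))
    (g : hom (simp a ⊳ simp i) (simp j)) :
  ldim i *: lptr (s ∘ g) = (ldim j * co (g ∘ s)) *: idm (simp i : M).
Proof.
rewrite [X in _ *: X](coE1 _) scalerA; congr (_ *: _).
rewrite mulrC -ltr_co -(ltr_ptr (lmodP M)); last exact: irr_simple (ucatP D) a.
by rewrite (ltr_cyclic (lmodP M)) ltr_co mulrC.
Qed.

Lemma lptr_regular (a x : D) m (h : hom (a ⊗ x) (a ⊗ x)) :
  (lptr (M := regular_module D) (h : hom (a ⊳ (x : regular_module D)) _)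
      : hom x x) ⊳m idm m =
  lptr (lassoc a x m ∘ (h ⊳m idm m) ∘ (lassoc a x m)†).
Proof.
rewrite /lptr (actMr MP) (actMr MP) (lcup_regular MP) (lcap_regular MP) -!compA.
rewrite (precomp (act_assoc MP _ _ _)) (precompK (assocVK MP _ _ _)).
by rewrite !(actMl MP) -!compA.
Qed.

(** The double count of [module_bend_trace], carried out in D with the trace h |-> tr(h m).
    [lptr_regular] transports the partial trace from D to M, where the module trace can evaluate
    it. *)
Lemma regular_bend_trace (a i j : Irr D) m (s : hom (simp j) (simp a ⊗ simp i))
    (g : hom (simp a ⊗ simp i) (simp j)) :
  ltr (idm (simp i ⊳ m)) *:
    lptr (M := regular_module D)
       (s ∘ g : hom (simp a ⊳ (simp i : regular_module D)) _) =
  (ltr (idm (simp j ⊳ m)) * co (g ∘ s)) *: idm (simp i : D).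
Proof.
set p := lptr _; rewrite [X in _ *: X](coE1 (p : hom (simp i : D) _)) scalerA.
congr (_ *: _); rewrite mulrC.
have -> : co (p : hom (simp i : D) _) * ltr (idm (simp i ⊳ m)) =
    ltr ((p : hom (simp i : D) _) ⊳m idm m).
  rewrite [X in X ⊳m _](coE1 (p : hom (simp i : D) _)).
  rewrite (linZ (lin_actl MP (idm m) (@lin_id _ _))) (act1 MP).
  by rewrite (linZ (@ltr_lin _)).
rewrite lptr_regular -(ltr_ptr (lmodP M)); last exact: irr_simple (ucatP D) a.
rewrite (ltr_cyclic (lmodP M)) compA (assocK MP) comp1l.
rewrite (actMr MP) (ltr_cyclic (lmodP M)) -(actMr MP).
rewrite [X in X ⊳m _](coE1 _) (linZ (lin_actl MP (idm m) (@lin_id _ _))).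
by rewrite (linZ (@ltr_lin _)) (act1 MP) mulrC.
Qed.

End Trace.

(** * Tube spaces and brackets *)

Section Tensor.
Variable C : numClosedFieldType.

Definition antilinear2 (U V W : lmodType C) (B : U -> V -> W) : Prop :=
  (forall u, antilinear (B u)) /\ (forall v, antilinear (B^~ v)).

Lemma alin0 (U V : lmodType C) (f : U -> V) : antilinear f -> f 0 = 0.
Proof.
by move=> fL; have := fL (-1) 0 0; rewrite scaler0 addr0 rmorphN1 scaleN1r addNr.
Qed.

Lemma alinD (U V : lmodType C) (f : U -> V) :
  antilinear f -> {morph f : x y / x + y}.
Proof. by move=> fL x y; have := fL 1 x y; rewrite conjC1 !scale1r. Qed.

Lemma alinZ (U V : lmodType C) (f : U -> V) :
  antilinear f -> forall c x, f (c *: x) = c^* *: f x.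
Proof. by move=> fL c x; have := fL c x 0; rewrite !addr0 alin0 // addr0. Qed.

Lemma alin_sum (U V : lmodType C) (f : U -> V) (fL : antilinear f) I (r : seq I)
    (P : pred I) (F : I -> U) :
  f (\sum_(i <- r | P i) F i) = \sum_(i <- r | P i) f (F i).
Proof. by apply: big_morph; [exact: alinD | exact: alin0]. Qed.

Lemma alin_scale (V W : lmodType C) (F : V -> W) c :
  antilinear F -> antilinear (fun v => c *: F v).
Proof. by move=> FL a u v; rewrite FL scalerDr !scalerA mulrC. Qed.

Lemma alin_fun (U V W : lmodType C) (f : V -> W) (F : U -> V) :
  linear f -> antilinear F -> antilinear (fun v => f (F v)).
Proof. by move=> FL GL a u v; rewrite GL FL. Qed.

Lemma alin_lin (U V W : lmodType C) (f : V -> W) (F : U -> V) :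
  antilinear f -> linear F -> antilinear (fun v => f (F v)).
Proof. by move=> FL GL a u v; rewrite GL FL. Qed.

Lemma alin_alin (U V W : lmodType C) (f : V -> W) (F : U -> V) :
  antilinear f -> antilinear F -> linear (fun v => f (F v)).
Proof. by move=> FL GL a u v; rewrite GL FL conjCK. Qed.

Lemma antilinear2_sum (V W : vectType C) (U : lmodType C) (B : V -> W -> U) v w :
  antilinear2 B ->
  B v w = \sum_i \sum_j (stdc i v * stdc j w)^* *: B (stdv i) (stdv j).
Proof.
move=> [linr linl].
rewrite {1}(stdc_sum v) (alin_sum (linl _)); apply: eq_bigr => i _.
rewrite (alinZ (linl _)) {1}(stdc_sum w) (alin_sum (linr _)) scaler_sumr.
by apply: eq_bigr => j _; rewrite (alinZ (linr _)) scalerA rmorphM.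
Qed.

Lemma tlift_anti_pure (V W : vectType C) (U : lmodType C) (B : V -> W -> U) v w :
  antilinear2 B -> tlift_anti B (v ⊠ w) = B v w.
Proof.
move=> bilB; rewrite (antilinear2_sum v w bilB) /tlift_anti.
by apply: eq_bigr => i _; apply: eq_bigr => j _; rewrite mxE.
Qed.

Lemma tlift_anti_antilinear (V W : vectType C) (U : lmodType C)
    (B : V -> W -> U) : antilinear (tlift_anti B).
Proof.
move=> c u v; rewrite /tlift_anti scaler_sumr -big_split /=.
apply: eq_bigr => i _; rewrite scaler_sumr -big_split /=.
by apply: eq_bigr => j _; rewrite !mxE rmorphD rmorphM scalerDl scalerA.
Qed.

Variables (I J : finType) (V W : I -> J -> J -> vectType C).
Local Notation T := (tube V W).

Definition tube_val (U : Type)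
    (phi : forall a d e f g, V a d e -> W a f g -> U)
    (t : {s : I * J * J * J * J & tube_fiber V W s}) : U :=
  let: existT s p := t in
  (match s return tube_fiber V W s -> U with
     (a, d, e, f, g) => fun p => phi a d e f g (stdv p.1) (stdv p.2) end) p.

(** An explicit form of the linear extension of [tube_universal], defined for any phi; bilinearity
    is then needed only to evaluate it on the spanning elements. *)
Definition tube_lift (U : lmodType C)
    (phi : forall a d e f g, V a d e -> W a f g -> U) (x : T) : U :=
  \sum_t (x : {ffun _ -> C^o}) t *: tube_val phi t.

Definition tube_alift (U : lmodType C)
    (phi : forall a d e f g, V a d e -> W a f g -> U) (x : T) : U :=
  \sum_t ((x : {ffun _ -> C^o}) t : C)^* *: tube_val phi t.

Lemma tube_lift_lin (U : lmodType C) phi : linear (@tube_lift U phi).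
Proof.
move=> c x y; rewrite /tube_lift scaler_sumr -big_split /=; apply: eq_bigr => t _.
by rewrite !ffunE scalerDl scalerA.
Qed.

Lemma tube_alift_alin (U : lmodType C) phi : antilinear (@tube_alift U phi).
Proof.
move=> c x y; rewrite /tube_alift scaler_sumr -big_split /=; apply: eq_bigr => t _.
by rewrite !ffunE rmorphD rmorphM scalerDl scalerA.
Qed.

Lemma tube_lift_base (U : lmodType C) phi a d e f g i j :
  @tube_lift U phi (tube_base (V := V) (W := W) (a := a) (d := d) (e := e)
                      (f := f) (g := g) i j) = phi a d e f g (stdv i) (stdv j).
Proof.
rewrite /tube_lift.
rewrite (bigD1 (Tagged (tube_fiber V W) (i := (a, d, e, f, g)) (i, j))) //=.
rewrite ffunE eqxx scale1r big1 ?addr0 // => t /negPf tn.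
by rewrite ffunE tn scale0r.
Qed.

Lemma tube_alift_base (U : lmodType C) phi a d e f g i j :
  @tube_alift U phi (tube_base (V := V) (W := W) (a := a) (d := d) (e := e)
                      (f := f) (g := g) i j) = phi a d e f g (stdv i) (stdv j).
Proof.
rewrite /tube_alift.
rewrite (bigD1 (Tagged (tube_fiber V W) (i := (a, d, e, f, g)) (i, j))) //=.
rewrite ffunE eqxx conjC1 scale1r big1 ?addr0 // => t /negPf tn.
by rewrite ffunE tn conjC0 scale0r.
Qed.

Lemma tube_liftE (U : lmodType C) phi a d e f g (v : V a d e) (w : W a f g) :
  bilinear2 (@phi a d e f g) ->
  @tube_lift U phi (tube_elt v w) = phi a d e f g v w.
Proof.
move=> bP; rewrite (bilinear2_sum v w bP) (lin_sum (@tube_lift_lin _ _)).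
apply: eq_bigr => i _; rewrite (lin_sum (@tube_lift_lin _ _)).
by apply: eq_bigr => j _; rewrite (linZ (@tube_lift_lin _ _)) tube_lift_base.
Qed.

Lemma tube_aliftE (U : lmodType C) phi a d e f g (v : V a d e) (w : W a f g) :
  antilinear2 (@phi a d e f g) ->
  @tube_alift U phi (tube_elt v w) = phi a d e f g v w.
Proof.
move=> bP; rewrite (antilinear2_sum v w bP) (alin_sum (@tube_alift_alin _ _)).
apply: eq_bigr => i _; rewrite (alin_sum (@tube_alift_alin _ _)).
by apply: eq_bigr => j _; rewrite (alinZ (@tube_alift_alin _ _)) tube_alift_base.
Qed.

Lemma tube_elt_lin2 a d e f g : bilinear2 (@tube_elt C I J V W a d e f g).
Proof.
split=> [v|w]; apply: lin_bigsum => i; apply: lin_bigsum => j;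
  apply: lin_scalel => //.
  by apply: lin_mull => //; exact: stdc_linear.
by apply: lin_mulr => //; exact: stdc_linear.
Qed.

Lemma tube_span (x : T) :
  x = \sum_t (x : {ffun _ -> C^o}) t *:
        tube_val (fun a d e f g (v : V a d e) (w : W a f g) => tube_elt v w) t.
Proof.
apply/ffunP => t; rewrite sum_ffunE (bigD1 t) //= big1 ?addr0 => [|t' /negPf tt'].
  case: t => -[[[[a d] e] f] g] [i j] /=.
  by rewrite /tube_elt stdv_sum2 !ffunE eqxx [_ *: _]mulr1.
case: t' tt' => -[[[[a d] e] f] g] [i j] /= tt'.
by rewrite /tube_elt stdv_sum2 !ffunE eq_sym tt' scaler0.
Qed.

Lemma tube_ext (U : lmodType C) (F G : T -> U) : linear F -> linear G ->
  (forall a d e f g (v : V a d e) (w : W a f g),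
     F (tube_elt v w) = G (tube_elt v w)) -> F =1 G.
Proof.
move=> FL GL FG x; rewrite (tube_span x) !lin_sum //.
apply: eq_bigr => -[[[[[a d] e] f] g] [i j]] _.
by rewrite !linZ // FG.
Qed.

Lemma tube_aext (U : lmodType C) (F G : T -> U) : antilinear F -> antilinear G ->
  (forall a d e f g (v : V a d e) (w : W a f g),
     F (tube_elt v w) = G (tube_elt v w)) -> F =1 G.
Proof.
move=> FL GL FG x; rewrite (tube_span x) !alin_sum //.
apply: eq_bigr => -[[[[[a d] e] f] g] [i j]] _.
by rewrite !alinZ // FG.
Qed.

Lemma lin_tube_liftB (V' U : lmodType C)
    (phi : V' -> forall a d e f g, V a d e -> W a f g -> U) (x : T) :
  (forall a d e f g v w, linear (fun y => phi y a d e f g v w)) ->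
  linear (fun y => tube_lift (phi y) x).
Proof.
move=> pL; apply: lin_bigsum => -[[[[[a d] e] f] g] [i j]].
by apply: lin_scale; apply: pL.
Qed.

End Tensor.

Section Bracket.
Variables (C : numClosedFieldType) (D : umfc C) (M : left_module D).
Implicit Types (A B : D) (d e f g i j : Irr M).

Let MP := left_module_action M.
Local Notation T := (left_tube M).

Lemma lin_lactl (V : lmodType C) A B (m n : M) (F : V -> hom A B) (g : hom m n) :
  linear F -> linear (fun v => F v ⊳m g).
Proof. exact: lin_actl. Qed.

Lemma lin_lactr (V : lmodType C) A B (m n : M) (F : V -> hom m n) (g : hom A B) :
  linear F -> linear (fun v => g ⊳m F v).
Proof. exact: lin_actr. Qed.

Lemma ltube_elt_lin2 (a : Irr D) d e f g : bilinear2 (@ltube_elt C D M a d e f g).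
Proof. exact: tube_elt_lin2. Qed.

Lemma lin_ltube_eltl (V : lmodType C) (a : Irr D) d e f g
    (F : V -> hom (simp d) (simp a ⊳ simp e)) (z : hom (simp a ⊳ simp f) (simp g)) :
  linear F -> linear (fun v => ltube_elt (F v) z).
Proof. exact: lin_bilinl (ltube_elt_lin2 _ _ _ _ _). Qed.

Lemma lin_ltube_eltr (V : lmodType C) (a : Irr D) d e f g
    (F : V -> hom (simp a ⊳ simp f) (simp g)) (n : hom (simp d) (simp a ⊳ simp e)) :
  linear F -> linear (fun v => ltube_elt n (F v)).
Proof. exact: lin_bilinr (ltube_elt_lin2 _ _ _ _ _). Qed.

Lemma lbracketE A d e f g (n : hom (simp d) (A ⊳ simp e))
    (z : hom (A ⊳ simp f) (simp g)) :
  lbracket n z = bsum (fun k (u : hom (simp k) A) v =>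
    ltube_elt ((v ⊳m idm (simp e)) ∘ n) (z ∘ (u ⊳m idm (simp f))) : T).
Proof. by []. Qed.

Lemma lin_lbracketl (V : lmodType C) A d e f g (F : V -> hom (simp d) (A ⊳ simp e))
    (z : hom (A ⊳ simp f) (simp g)) :
  linear F -> linear (fun v => lbracket (F v) z).
Proof.
move=> FL; apply: lin_bigsum => k; apply: lin_bigsum => p.
by apply: lin_ltube_eltl; apply: lin_compr.
Qed.

Lemma lin_lbracketr (V : lmodType C) A d e f g (F : V -> hom (A ⊳ simp f) (simp g))
    (n : hom (simp d) (A ⊳ simp e)) :
  linear F -> linear (fun v => lbracket n (F v)).
Proof.
move=> FL; apply: lin_bigsum => k; apply: lin_bigsum => p.
by apply: lin_ltube_eltr; apply: lin_compl.
Qed.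

Lemma lbracket_balance A B d e f g (t : hom A B) (n : hom (simp d) (A ⊳ simp e))
    (z : hom (B ⊳ simp f) (simp g)) :
  lbracket ((t ⊳m idm _) ∘ n) z = lbracket n (z ∘ (t ⊳m idm _)).
Proof.
rewrite !lbracketE; pose B0 k (u : hom (simp k) B) (v : hom A (simp k)) : T :=
  ltube_elt ((v ⊳m idm (simp e)) ∘ n) (z ∘ (u ⊳m idm (simp f))).
transitivity (bsum (fun k u v => B0 k u (v ∘ t))).
  by apply: eq_bsum => k u v; rewrite /B0 (actMr MP) compA.
rewrite -bsum_balance.
  by apply: eq_bsum => k u v; rewrite /B0 (actMr MP) compA.
move=> k; split=> ?.
  apply: lin_ltube_eltl; apply: lin_compl; apply: lin_lactl; exact: lin_id.
apply: lin_ltube_eltr; apply: lin_compr; apply: lin_lactl; exact: lin_id.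
Qed.

Lemma lbracket_simple (a : Irr D) d e f g (n : hom (simp d) (simp a ⊳ simp e))
    (z : hom (simp a ⊳ simp f) (simp g)) :
  lbracket n z = ltube_elt n z.
Proof.
rewrite lbracketE bsum_simple; first by rewrite !(act1 MP) comp1l comp1r.
move=> k; split=> ?.
  apply: lin_ltube_eltl; apply: lin_compl; apply: lin_lactl; exact: lin_id.
apply: lin_ltube_eltr; apply: lin_compr; apply: lin_lactl; exact: lin_id.
Qed.

(** The universal property of the coend: a balanced candidate known on simple objects is correct on
    all. Balance moves the projection v over to the side of z, where it meets the inclusion u, and
    the composites u v add up to the identity of A. *)
Lemma lbracket_univ (U : lmodType C) d e f g (F : T -> U)
    (Psi : forall A, hom (simp d) (A ⊳ simp e) -> hom (A ⊳ simp f) (simp g) -> U) :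
  linear F -> (forall A n, linear (Psi A n)) ->
  (forall A B (t : hom A B) n z,
     Psi B ((t ⊳m idm _) ∘ n) z = Psi A n (z ∘ (t ⊳m idm _))) ->
  (forall (a : Irr D) n z, F (ltube_elt n z) = Psi (simp a) n z) ->
  forall A n z, F (@lbracket C D M A d e f g n z) = Psi A n z.
Proof.
move=> FL PL bal FP A n z; rewrite lbracketE (bsum_lin _ FL).
transitivity (bsum (fun k (u : hom (simp k) A) v =>
  Psi A n (z ∘ ((u ∘ v) ⊳m idm (simp f))))).
  by apply: eq_bsum => k u v; rewrite FP bal (actMr MP) compA.
rewrite (bsum_res (F := fun h => Psi A n (z ∘ (h ⊳m idm (simp f))))).
  by rewrite (act1 MP) comp1r.
apply: lin_fun; first exact: PL.
by apply: lin_compr; apply: lin_lactl; apply: lin_id.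
Qed.

End Bracket.

(* A variable [?f] of a pattern [fun v => comp g ?f] also matches terms containing
   [v]; elaborating it with [constr:(f)] fails in that case, which selects the
   argument that depends on [v]. *)
Ltac lin_step :=
  match goal with
  | |- GRing.linear_for _ (fun v => v) => exact: lin_id
  | |- GRing.linear_for _ (fun v => @comp _ _ _ _ _ _ ?f) =>
      let _ := constr:(f) in apply: lin_compl
  | |- GRing.linear_for _ (fun v => @comp _ _ _ _ _ ?g _) =>
      let _ := constr:(g) in apply: lin_compr
  | |- GRing.linear_for _ (fun v => @lactm _ _ _ _ _ _ _ _ ?g) =>
      let _ := constr:(g) in apply: lin_lactl
  | |- GRing.linear_for _ (fun v => @lactm _ _ _ _ _ _ _ ?f _) =>
      let _ := constr:(f) in apply: lin_lactr
  | |- GRing.linear_for _ (fun v => @lbracket _ _ _ _ _ _ _ _ _ ?z) =>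
      let _ := constr:(z) in apply: lin_lbracketl
  | |- GRing.linear_for _ (fun v => @lbracket _ _ _ _ _ _ _ _ ?n _) =>
      let _ := constr:(n) in apply: lin_lbracketr
  | |- GRing.linear_for _ (fun v => @ltube_elt _ _ _ _ _ _ _ _ _ ?z) =>
      let _ := constr:(z) in apply: lin_ltube_eltl
  | |- GRing.linear_for _ (fun v => @ltube_elt _ _ _ _ _ _ _ _ ?n _) =>
      let _ := constr:(n) in apply: lin_ltube_eltr
  | |- GRing.linear_for _ (fun v => @pure _ _ _ _ ?w) =>
      let _ := constr:(w) in apply: lin_bilinl; first exact: pure_bilinear
  | |- GRing.linear_for _ (fun v => @pure _ _ _ ?w _) =>
      let _ := constr:(w) in apply: lin_bilinr; first exact: pure_bilinear
  | |- GRing.linear_for _ (fun v => @tlift _ _ _ _ _ ?t) =>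
      let _ := constr:(t) in apply: lin_tliftB => ? ?
  | |- GRing.linear_for _ (fun v => @tlift _ _ _ _ ?B _) =>
      let _ := constr:(B) in apply: lin_tlift
  | |- GRing.linear_for _ (fun v => @tube_lift _ _ _ _ _ _ _ ?t) =>
      let _ := constr:(t) in apply: lin_tube_liftB => ? ? ? ? ? ? ?
  | |- GRing.linear_for _ (fun v => @tube_lift _ _ _ _ _ _ ?phi _) =>
      let _ := constr:(phi) in apply: lin_fun; first exact: tube_lift_lin
  | |- GRing.linear_for _ (fun v => @bsum _ _ _ _ _) =>
      rewrite /bsum; apply: lin_bigsum => ?; apply: lin_bigsum => ?
  | |- GRing.linear_for _ (fun v => bigop _ _ _) => apply: lin_bigsum => ?
  | |- GRing.linear_for _ (fun v => @co _ _ _ _ _) =>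
      apply: lin_fun; first exact: co_linear
  | |- GRing.linear_for _ (fun v => @GRing.scale _ _ ?c _) =>
      let _ := constr:(c) in apply: lin_scale
  | |- GRing.linear_for _ (fun v => @GRing.scale _ _ _ ?w) =>
      let _ := constr:(w) in apply: lin_scalel
  | |- GRing.linear_for _ (fun v => @GRing.mul _ _ ?c) =>
      let _ := constr:(c) in apply: lin_mulr
  | |- GRing.linear_for _ (fun v => @GRing.mul _ ?c _) =>
      let _ := constr:(c) in apply: lin_mull
  | |- GRing.linear_for _ (fun v => _) => fail 1
  | |- GRing.linear_for ?s ?F => change (GRing.linear_for s (fun v => F v))
  end.
Ltac lin := repeat first [assumption | lin_step | exact: lin_id].
Ltac lin2 := split=> ?; lin.

(** * The product *)

Section TubeOperations.
Variables (C : numClosedFieldType) (D : umfc C) (M : left_module D).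
Implicit Types (A B : D) (d e f g i j x y : Irr M).

Let MP := left_module_action M.
Local Notation T := (left_tube M).

(** Taken over arbitrary A and A', so that no product has to be decomposed into simples; the [dlt]
    factors make it meaningful, and zero, when the inner labels differ. *)
Definition lprod A A' d e f g d' e' f' g'
    (n : hom (simp d) (A ⊳ simp e)) (z : hom (A ⊳ simp f) (simp g))
    (n' : hom (simp d') (A' ⊳ simp e')) (z' : hom (A' ⊳ simp f') (simp g')) : T :=
  lbracket ((lassoc A A' (simp e'))† ∘ (idm A ⊳m (n' ∘ dlt e d')) ∘ n)
           (z ∘ (idm A ⊳m (dlt g' f ∘ z')) ∘ lassoc A A' (simp f')).

Definition ltmul (s t : T) : T :=
  tube_lift (fun a d e f g n z => tube_lift (fun a' d' e' f' g' n' z' =>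
    lprod n z n' z') t) s.

(** Bracketing over the whole unit object hides its decomposition, which is recovered only in
    [ltone_simple]. *)
Definition ltone : T :=
  \sum_y \sum_x lbracket (lmunit (simp y))† (lmunit (simp x)).

Definition lteps (t : T) : C :=
  tube_lift (U := C^o) (fun a d e f g n z =>
    co (z ∘ (idm (simp a) ⊳m dlt e f) ∘ n)) t.

Definition ltdelta (t : T) : tensor T T :=
  tube_lift (fun a d e f g n z => \sum_i bsum (fun j
    (u : hom (simp j) (simp a ⊳ simp i)) v => ltube_elt u z ⊠ ltube_elt n v)) t.

Definition ltS (t : T) : T :=
  tube_lift (fun a d e f g n z =>
    (ldim f / ldim g) *: lbracket (flat z) (sharp n)) t.

Definition ltstar (t : T) : T :=
  tube_alift (fun a d e f g n z =>
    (ldim e / ldim d) *: lbracket (flat n†) (sharp z†)) t.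

Definition lwha : wha_data T := WhaData ltmul ltone lteps ltdelta ltS ltstar.

Lemma lin_flat (V : lmodType C) (a : D) (m n : M) (F : V -> hom (a ⊳ m) n) :
  linear F -> linear (fun v => flat (F v)).
Proof. exact: (lin_fun (flat_lin MP (a := a) (x := m) (y := n))). Qed.

Lemma lin_sharp (V : lmodType C) (a : D) (m n : M) (F : V -> hom n (a ⊳ m)) :
  linear F -> linear (fun v => sharp (F v)).
Proof. exact: (lin_fun (sharp_lin MP (a := a) (x := m) (y := n))). Qed.

Lemma alin_dag (m n : M) : antilinear (@dag C M m n).
Proof. exact: (dag_antilinear (ucatP M)). Qed.

Lemma ltmulE (a a' : Irr D) d e f g d' e' f' g'
    (n : hom (simp d) (simp a ⊳ simp e)) (z : hom (simp a ⊳ simp f) (simp g))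
    (n' : hom (simp d') (simp a' ⊳ simp e'))
    (z' : hom (simp a' ⊳ simp f') (simp g')) :
  ltmul (ltube_elt n z) (ltube_elt n' z') = lprod n z n' z'.
Proof.
rewrite /ltmul tube_liftE; last by (rewrite /lprod; lin2).
by rewrite tube_liftE //; rewrite /lprod; lin2.
Qed.

Lemma lin_ltmull (V : lmodType C) (F : V -> T) t :
  linear F -> linear (fun v => ltmul (F v) t).
Proof. exact: lin_fun (@tube_lift_lin _ _ _ _ _ _ _). Qed.

Lemma lin_ltmulr (V : lmodType C) (F : V -> T) t :
  linear F -> linear (fun v => ltmul t (F v)).
Proof.
apply: lin_fun; apply: lin_tube_liftB => a d e f g n z.
exact: tube_lift_lin.
Qed.

Lemma ltmul_lin2 : bilinear2 ltmul.
Proof. by split=> t; [apply: lin_ltmulr | apply: lin_ltmull]; apply: lin_id. Qed.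

Lemma lin_lteps (V : lmodType C) (F : V -> T) :
  linear F -> linear (fun v => lteps (F v) : C^o).
Proof. exact: lin_fun (@tube_lift_lin _ _ _ _ _ _ _). Qed.

Lemma lin_ltdelta (V : lmodType C) (F : V -> T) :
  linear F -> linear (fun v => ltdelta (F v)).
Proof. exact: lin_fun (@tube_lift_lin _ _ _ _ _ _ _). Qed.

Lemma lin_ltS (V : lmodType C) (F : V -> T) :
  linear F -> linear (fun v => ltS (F v)).
Proof. exact: lin_fun (@tube_lift_lin _ _ _ _ _ _ _). Qed.

Lemma ltstar_alin : antilinear ltstar.
Proof. exact: tube_alift_alin. Qed.

End TubeOperations.

Ltac tlin_step :=
  match goal with
  | |- GRing.linear_for _ (fun v => @ltmul _ _ _ _ ?t) =>
      let _ := constr:(t) in apply: lin_ltmull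
  | |- GRing.linear_for _ (fun v => @ltmul _ _ _ ?s _) =>
      let _ := constr:(s) in apply: lin_ltmulr
  | |- GRing.linear_for _ (fun v => @lteps _ _ _ _) => apply: lin_lteps
  | |- GRing.linear_for _ (fun v => @ltdelta _ _ _ _) => apply: lin_ltdelta
  | |- GRing.linear_for _ (fun v => @ltS _ _ _ _) => apply: lin_ltS
  | |- GRing.linear_for _ (fun v => @flat _ _ _ _ _ _ _) => apply: lin_flat
  | |- GRing.linear_for _ (fun v => @sharp _ _ _ _ _ _ _) => apply: lin_sharp
  | |- _ => lin_step
  end.
Ltac tlin := repeat first [assumption | tlin_step | exact: lin_id].
Ltac tlin2 := split=> ?; tlin.

Section TubeProduct.
Variables (C : numClosedFieldType) (D : umfc C) (M : left_module D).
Implicit Types (A B : D) (d e f g i j x y : Irr M).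

Let MP := left_module_action M.
Local Notation T := (left_tube M).

Lemma ltube_ext (U : lmodType C) (F G : T -> U) : linear F -> linear G ->
  (forall (a : Irr D) d e f g (n : hom (simp d) (simp a ⊳ simp e))
     (z : hom (simp a ⊳ simp f) (simp g)), F (lbracket n z) = G (lbracket n z)) ->
  forall t, F t = G t.
Proof.
move=> FL GL FG; apply: tube_ext => // a d e f g n z.
by have := FG a d e f g n z; rewrite !lbracket_simple.
Qed.

Lemma ltube_aext (U : lmodType C) (F G : T -> U) : antilinear F -> antilinear G ->
  (forall (a : Irr D) d e f g (n : hom (simp d) (simp a ⊳ simp e))
     (z : hom (simp a ⊳ simp f) (simp g)), F (lbracket n z) = G (lbracket n z)) ->
  forall t, F t = G t.
Proof.
move=> FL GL FG; apply: tube_aext => // a d e f g n z.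
by have := FG a d e f g n z; rewrite !lbracket_simple.
Qed.

Lemma lprod_neq A A' d e f g d' e' f' g'
    (n : hom (simp d) (A ⊳ simp e)) (z : hom (A ⊳ simp f) (simp g))
    (n' : hom (simp d') (A' ⊳ simp e')) (z' : hom (A' ⊳ simp f') (simp g')) :
  ~~ ((f == g') && (e == d')) -> lprod n z n' z' = 0.
Proof.
rewrite /lprod negb_and => /orP[fg|ed].
  rewrite (dlt_neq (k := g')) 1?eq_sym // comp0l.
  rewrite (lin0 (lin_lactr _ (@lin_id _ _))) comp0r comp0l.
  exact: (lin0 (lin_lbracketr _ (@lin_id _ _))).
rewrite (dlt_neq ed) comp0r (lin0 (lin_lactr _ (@lin_id _ _))) comp0r comp0l.
exact: (lin0 (lin_lbracketl _ (@lin_id _ _))).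
Qed.

Lemma act_assoc_conj A A' (m m' : M) (h : hom m m') :
  lassoc A A' m' ∘ (idm (A ⊗ A') ⊳m h) =
  (idm A ⊳m (idm A' ⊳m h)) ∘ lassoc A A' m.
Proof. by rewrite -(tenm_id (umfcP D)) (act_assoc MP). Qed.

Lemma act_assocV_conj A A' (m m' : M) (h : hom m m') :
  (idm (A ⊗ A') ⊳m h) ∘ (lassoc A A' m)† =
  (lassoc A A' m')† ∘ (idm A ⊳m (idm A' ⊳m h)).
Proof. by rewrite -(tenm_id (umfcP D)) (assocV_nat MP). Qed.

(** [lprod] is balanced in either factor: t passes the associator by naturality and slides through
    the other factor by interchange. So [lbracket_univ] applies once per factor. *)
Lemma ltmul_bracket A A' d e f g d' e' f' g'
    (n : hom (simp d) (A ⊳ simp e)) (z : hom (A ⊳ simp f) (simp g))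
    (n' : hom (simp d') (A' ⊳ simp e')) (z' : hom (A' ⊳ simp f') (simp g')) :
  ltmul (lbracket n z) (lbracket n' z') = lprod n z n' z'.
Proof.
apply: (lbracket_univ (F := fun t => ltmul t (lbracket n' z'))
  (Psi := fun A n z => lprod n z n' z')) => {A n z}.
- by tlin.
- by rewrite /lprod => A n; tlin.
- move=> A B t n z; rewrite /lprod.
  have e1 : (lassoc B A' (simp e'))† ∘ (idm B ⊳m (n' ∘ dlt e d')) ∘
       ((t ⊳m idm (simp e)) ∘ n) =
      ((t ⊗m idm A') ⊳m idm (simp e')) ∘
        ((lassoc A A' (simp e'))† ∘ (idm A ⊳m (n' ∘ dlt e d')) ∘ n).
    rewrite -!compA -(precomp (act_swap MP t (n' ∘ dlt e d'))) !compA.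
    by rewrite (assocV_nat MP) (act1 MP).
  rewrite e1 lbracket_balance; congr lbracket.
  rewrite -!compA (act_assoc MP) (act1 MP).
  by rewrite -(precomp (act_swap MP t _)).
move=> a n z; apply: (lbracket_univ (F := fun t => ltmul (ltube_elt n z) t)
  (Psi := fun A n' z' => lprod n z n' z')) => {A' n' z'}.
- by tlin.
- by rewrite /lprod => A' n'; tlin.
- move=> A B t n' z'; rewrite /lprod.
  have e1 : (lassoc (simp a) B (simp e'))† ∘
       (idm (simp a) ⊳m ((t ⊳m idm (simp e')) ∘ n' ∘ dlt e d')) ∘ n =
      ((idm (simp a) ⊗m t) ⊳m idm (simp e')) ∘
        ((lassoc (simp a) A (simp e'))† ∘ (idm (simp a) ⊳m (n' ∘ dlt e d')) ∘ n).
    by rewrite !compA (assocV_nat MP) -compA -compA (actMl MP) !compA.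
  rewrite e1 lbracket_balance; congr lbracket.
  by rewrite -!compA (act_assoc MP) [in RHS](compA (dlt _ _)) [in RHS](actMl MP) !compA.
by move=> a' n' z'; rewrite ltmulE.
Qed.

(** The two sides are brackets over A (A' A'') and (A A') A''. Balance along the associator of D
    brings them over the same object, and the pentagon identifies the entries. *)
Lemma lprodA A A' A'' d e f g d' e' f' g' d'' e'' f'' g''
    (n : hom (simp d) (A ⊳ simp e)) (z : hom (A ⊳ simp f) (simp g))
    (n' : hom (simp d') (A' ⊳ simp e')) (z' : hom (A' ⊳ simp f') (simp g'))
    (n'' : hom (simp d'') (A'' ⊳ simp e'')) (z'' : hom (A'' ⊳ simp f'') (simp g'')) :
  ltmul (lbracket n z) (lprod n' z' n'' z'') =
  ltmul (lprod n z n' z') (lbracket n'' z'').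
Proof.
rewrite /lprod !ltmul_bracket /lprod.
have [aK aVK] := assoc_unitary (umfcP D) A A' A''.
set n1 := (X in lbracket X _ = _); set z1 := (X in lbracket _ X = _).
have -> : n1 = (assoc A A' A'' ⊳m idm _) ∘ (((assoc A A' A'')† ⊳m idm _) ∘ n1).
  by rewrite compA -(actMr MP) aVK (act1 MP) comp1l.
rewrite lbracket_balance; congr lbracket.
- rewrite {}/n1 !(actMl MP) !compA; congr (_ ∘ _).
  rewrite -!compA 2!(precomp (act_assocV_conj _ _ _)) !compA.
  congr (_ ∘ _ ∘ _ ∘ _).
  have := congr1 (@dag _ _ _ _) (act_pentagon MP A A' A'' (simp e'')).
  rewrite !dagM !(act_dag MP) !dag1 => ->.
  by rewrite !compA.
rewrite {}/z1 !(actMl MP) -!compA; congr (_ ∘ (_ ∘ (_ ∘ _))).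
rewrite 2!(precomp (act_assoc_conj _ _ _)) (act_pentagon MP).
by rewrite !compA.
Qed.

Lemma ltmulA (s t r : T) : ltmul s (ltmul t r) = ltmul (ltmul s t) r.
Proof.
move: s; apply: ltube_ext; [by tlin..|] => a d e f g n z.
move: t; apply: ltube_ext; [by tlin..|] => a' d' e' f' g' n' z'.
move: r; apply: ltube_ext; [by tlin..|] => a'' d'' e'' f'' g'' n'' z''.
by rewrite 2!ltmul_bracket lprodA.
Qed.

Definition lunitE y x : T := lbracket (lmunit (simp y))† (lmunit (simp x)).

(** The product is a bracket over the unit times A. By [unit_triangle] both of its entries contain
    the unit isomorphism of A, so balance brings the two copies together, where they cancel. *)
Lemma lunitE_mull y x A d e f g (n : hom (simp d) (A ⊳ simp e))
    (z : hom (A ⊳ simp f) (simp g)) :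
  ltmul (lunitE y x) (lbracket n z) = lbracket (n ∘ dlt y d) (dlt g x ∘ z).
Proof.
rewrite ltmul_bracket /lprod.
rewrite -[_ ∘ _ ∘ (lmunit _)†]compA (unitV_nat MP) (act_unit MP).
rewrite compA -dagM (unit_triangle MP) (act_dag MP) dag1 lbracket_balance.
rewrite -!compA (precomp1 (unit_triangle MP _ _)) -(actMr MP).
by rewrite (lunit_unitary (umfcP D) A).2 (act1 MP) comp1r.
Qed.

Lemma lunitE_mulr y x A d e f g (n : hom (simp d) (A ⊳ simp e))
    (z : hom (A ⊳ simp f) (simp g)) :
  ltmul (lbracket n z) (lunitE y x) =
  lbracket ((idm A ⊳m dlt e y) ∘ n) (z ∘ (idm A ⊳m dlt x f)).
Proof.
rewrite ltmul_bracket /lprod !(actMl MP) -!compA (act_triangle MP).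
have -> : (lassoc A unito (simp y))† ∘ ((idm A ⊳m (lmunit (simp y))†) ∘
     ((idm A ⊳m dlt e y) ∘ n)) =
   ((runit A)† ⊳m idm _) ∘ ((idm A ⊳m dlt e y) ∘ n).
  rewrite compA; congr (_ ∘ _).
  by rewrite -(dag1 (simp y)) -(act_dag MP) -(act_triangle MP) dagM (act_dag MP) dag1.
rewrite lbracket_balance -!compA -(actMr MP) (runit_unitary (umfcP D) A).2.
by rewrite (act1 MP) comp1r.
Qed.

Lemma ltmul1l (t : T) : ltmul (ltone M) t = t.
Proof.
move: t; apply: ltube_ext; [by tlin..|] => a d e f g n z.
rewrite /ltone (lin_sum (lin_ltmull _ (@lin_id _ _))).
under eq_bigr => y _.
  rewrite (lin_sum (lin_ltmull _ (@lin_id _ _))).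
  under eq_bigr do rewrite lunitE_mull.
  rewrite (sum_dltr (F := fun x h => lbracket (n ∘ dlt y d) (h ∘ z))).
    by rewrite comp1l; over.
  by move=> x; rewrite comp0l (lin0 (lin_lbracketr _ (@lin_id _ _))).
rewrite (sum_dltl (F := fun y h => lbracket (n ∘ h) z)) ?comp1r //.
by move=> y; rewrite comp0r (lin0 (lin_lbracketl _ (@lin_id _ _))).
Qed.

Lemma ltmul1r (t : T) : ltmul t (ltone M) = t.
Proof.
move: t; apply: ltube_ext; [by tlin..|] => a d e f g n z.
rewrite /ltone (lin_sum (lin_ltmulr _ (@lin_id _ _))).
under eq_bigr => y _.
  rewrite (lin_sum (lin_ltmulr _ (@lin_id _ _))).
  under eq_bigr do rewrite lunitE_mulr.
  rewrite (sum_dltl (F := fun x h =>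
    lbracket ((idm (simp a) ⊳m dlt e y) ∘ n) (z ∘ (idm (simp a) ⊳m h)))).
    by rewrite (act1 MP) comp1r; over.
  move=> x; exact: (lin0 (lin_lbracketr _ (lin_compr _ (lin_lactr _ (@lin_id _ _))))).
rewrite (sum_dltr (F := fun y h => lbracket ((idm (simp a) ⊳m h) ∘ n) z)).
  by rewrite (act1 MP) comp1l.
move=> y; exact: (lin0 (lin_lbracketl _ (lin_compl _ (lin_lactr _ (@lin_id _ _))))).
Qed.

End TubeProduct.

(** * The coproduct *)

Section BsumComm.
Variables (C : numClosedFieldType) (X Y : ucat C) (U : nmodType).

Lemma bsum_comm (I J : finType) (x : I -> X) (y : J -> Y)
    (G : forall i k, hom (simp k) (x i) -> hom (x i) (simp k) ->
         forall j l, hom (simp l) (y j) -> hom (y j) (simp l) -> U) :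
  \sum_i bsum (fun k (u : hom _ (x i)) v =>
    \sum_j bsum (fun l (s : hom _ (y j)) t => G i k u v j l s t)) =
  \sum_j bsum (fun l (s : hom _ (y j)) t =>
    \sum_i bsum (fun k (u : hom _ (x i)) v => G i k u v j l s t)).
Proof.
under eq_bigr => i _ do rewrite -bsum_sum.
rewrite exchange_big; apply: eq_bigr => j _.
rewrite -bsum_sum; apply: eq_bigr => i _.
rewrite /bsum.
under eq_bigr => k _ do rewrite exchange_big.
rewrite exchange_big; apply: eq_bigr => l _.
under eq_bigr => k _ do rewrite exchange_big.
by rewrite exchange_big.
Qed.

End BsumComm.

Section TubeCoalgebra.
Variables (C : numClosedFieldType) (D : umfc C) (M : left_module D).
Implicit Types (A B : D) (d e f g i j x y : Irr M).

Let MP := left_module_action M.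
Local Notation T := (left_tube M).

Lemma lteps_bracket A d e f g (n : hom (simp d) (A ⊳ simp e))
    (z : hom (A ⊳ simp f) (simp g)) :
  lteps (lbracket n z) = co (z ∘ (idm A ⊳m dlt e f) ∘ n).
Proof.
apply: (lbracket_univ (F := fun t => lteps t : C^o)
  (Psi := fun A n z => co (z ∘ (idm A ⊳m dlt e f) ∘ n) : C^o)) => {A n z}.
- by tlin.
- by move=> A n; tlin.
- by move=> A B t n z; rewrite -!compA -(precomp (act_swap MP t _)).
by move=> a n z; rewrite /lteps tube_liftE //; tlin2.
Qed.

(** Naturality in A uses three slides: t crosses the second bracket by balance in D, then the dual
    bases of the M-objects by [bsum_balance], then the first bracket by balance in D. *)
Lemma ltdelta_bracket A d e f g (n : hom (simp d) (A ⊳ simp e))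
    (z : hom (A ⊳ simp f) (simp g)) :
  ltdelta (lbracket n z) = \sum_i bsum (fun j
    (u : hom (simp j) (A ⊳ simp i)) v => lbracket u z ⊠ lbracket n v).
Proof.
apply: (lbracket_univ (F := fun t => ltdelta t) (Psi := fun A n z => \sum_i bsum (fun j
    (u : hom (simp j) (A ⊳ simp i)) v => lbracket u z ⊠ lbracket n v))) => {A n z}.
- by tlin.
- by move=> A n; tlin.
- move=> A B t n z; apply: eq_bigr => i _.
  transitivity (bsum (fun j (u : hom _ (A ⊳ simp i)) v =>
    lbracket ((t ⊳m idm _) ∘ u) z ⊠ lbracket n v)).
    rewrite (bsum_balance (t ⊳m idm _)
      (B := fun j u v => lbracket u z ⊠ lbracket n v)).
      by apply: eq_bsum => j u v; rewrite lbracket_balance.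
    by move=> j; tlin2.
  by apply: eq_bsum => j u v; rewrite lbracket_balance.
move=> a n z; rewrite /ltdelta tube_liftE; last by tlin2.
by apply: eq_bigr => i _; apply: eq_bsum => j u v; rewrite !lbracket_simple.
Qed.

Lemma tlift_ltdelta (U : lmodType C) A d e f g (n : hom (simp d) (A ⊳ simp e))
    (z : hom (A ⊳ simp f) (simp g)) (B : T -> T -> U) :
  bilinear2 B ->
  tlift B (ltdelta (lbracket n z)) = \sum_i bsum (fun j
    (u : hom (simp j) (A ⊳ simp i)) v => B (lbracket u z) (lbracket n v)).
Proof.
move=> bB; rewrite ltdelta_bracket (lin_sum (lin_tlift _ (@lin_id _ _))).
apply: eq_bigr => i _; rewrite (bsum_lin _ (lin_tlift _ (@lin_id _ _))).
by apply: eq_bsum => j u v; rewrite tlift_pure.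
Qed.

(** Both iterated coproducts are the same sum over two independent families of dual bases, taken in
    opposite orders. *)
Lemma ltdelta_coassoc (t : T) :
  tlift (fun u c => tlift (fun a b => a ⊠ (b ⊠ c)) (ltdelta u)) (ltdelta t) =
  tlift (fun a u => a ⊠ ltdelta u) (ltdelta t).
Proof.
move: t; apply: ltube_ext; [by tlin..|] => a d e f g n z.
rewrite !tlift_ltdelta; [|tlin2..].
transitivity (\sum_i bsum (fun j (s : hom (simp j) (simp a ⊳ simp i)) s' =>
  \sum_k bsum (fun l (u : hom (simp l) (simp a ⊳ simp k)) u' =>
    lbracket u z ⊠ (lbracket s u' ⊠ lbracket n s')))).
  apply: eq_bigr => i _; apply: eq_bsum => j s s'.
  by rewrite tlift_ltdelta //; tlin2.
rewrite bsum_comm; apply: eq_bigr => i _; apply: eq_bsum => j s s'.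
rewrite ltdelta_bracket (lin_sum ((pure_bilinear _ _).1 _)).
by apply: eq_bigr => k _; rewrite (bsum_lin _ ((pure_bilinear _ _).1 _)).
Qed.

Lemma ltdelta_counitl (t : T) : tlift (fun a b => lteps a *: b) (ltdelta t) = t.
Proof.
move: t; apply: ltube_ext; [by tlin..|] => a d e f g n z.
rewrite tlift_ltdelta; last by tlin2.
transitivity (\sum_i lbracket n (z ∘ (idm (simp a) ⊳m dlt i f))).
  apply: eq_bigr => i _; under eq_bsum do rewrite lteps_bracket.
  rewrite (bsum_postl (z ∘ (idm (simp a) ⊳m dlt i f))
     (B := fun j u v => co u *: lbracket n v)).
    by rewrite co_id scale1r.
  by move=> j; tlin2.
rewrite (sum_dltl (F := fun i h => lbracket n (z ∘ (idm (simp a) ⊳m h)))).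
  by rewrite (act1 MP) comp1r.
move=> i; apply: (lin0 (f := fun h => lbracket n (z ∘ (idm (simp a) ⊳m h)))); tlin.
Qed.

Lemma ltdelta_counitr (t : T) : tlift (fun a b => lteps b *: a) (ltdelta t) = t.
Proof.
move: t; apply: ltube_ext; [by tlin..|] => a d e f g n z.
rewrite tlift_ltdelta; last by tlin2.
transitivity (\sum_i lbracket ((idm (simp a) ⊳m dlt e i) ∘ n) z).
  apply: eq_bigr => i _.
  under eq_bsum do rewrite lteps_bracket -compA.
  rewrite (bsum_postr ((idm (simp a) ⊳m dlt e i) ∘ n)
     (B := fun j u v => co v *: lbracket u z)).
    by rewrite co_id scale1r.
  by move=> j; tlin2.
rewrite (sum_dltr (F := fun i h => lbracket ((idm (simp a) ⊳m h) ∘ n) z)).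
  by rewrite (act1 MP) comp1l.
move=> i; apply: (lin0 (f := fun h => lbracket ((idm (simp a) ⊳m h) ∘ n) z)); tlin.
Qed.

End TubeCoalgebra.

(** * Compatibility of the product with the coproduct and the counit *)

Section TubeBialgebra.
Variables (C : numClosedFieldType) (D : umfc C) (M : left_module D).
Implicit Types (A B : D) (d e f g i j x y : Irr M).

Let MP := left_module_action M.
Local Notation T := (left_tube M).

(** On the right the [dlt] factors match the label i of the outer sum with a summand l of a' k. The
    outer dual bases of a i then slide through u to become dual bases of a (a' k), and the inner
    pairs u, u' resolve the identity of a' k, which leaves the coproduct of the product. *)
Lemma ltdeltaM (s t : T) :
  ltdelta (ltmul s t) =
  tlift (fun a b => tlift (fun c d : T => ltmul a c ⊠ ltmul b d) (ltdelta t))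
    (ltdelta s).
Proof.
move: s; apply: ltube_ext; [by tlin..|] => a d e f g n z.
move: t; apply: ltube_ext; [by tlin..|] => a' d' e' f' g' n' z'.
rewrite ltmul_bracket /lprod ltdelta_bracket.
set N := _ ∘ n; set Z := z ∘ _ ∘ _.
rewrite tlift_ltdelta; last by tlin2.
transitivity (\sum_i bsum (fun j (s : hom (simp j) (simp a ⊳ simp i)) s' =>
  \sum_k bsum (fun l (u : hom (simp l) (simp a' ⊳ simp k)) u' =>
  lbracket ((lassoc (simp a) (simp a') _)† ∘ ((idm _ ⊳m (u ∘ dlt i l)) ∘ s)) Z ⊠
  lbracket N (s' ∘ (idm _ ⊳m (dlt l i ∘ u')) ∘ lassoc (simp a) (simp a') _)))); last first.
  apply: eq_bigr => i _; apply: eq_bsum => j s s'.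
  rewrite tlift_ltdelta; last by tlin2.
  apply: eq_bigr => k _; apply: eq_bsum => l u u'.
  by rewrite !ltmul_bracket /lprod !compA.
rewrite bsum_comm; apply: eq_bigr => k _.
pose B j (p : hom (simp j) (simp a ⊳ simp a' ⊳ simp k))
    (p' : hom (simp a ⊳ simp a' ⊳ simp k) (simp j)) :=
  lbracket ((lassoc (simp a) (simp a') _)† ∘ p) Z ⊠
  lbracket N (p' ∘ lassoc (simp a) (simp a') _).
have bB j : bilinear2 (B j) by rewrite /B; tlin2.
transitivity (bsum B).
  rewrite (bsum_balance _ (B := fun j u v => lbracket u Z ⊠
    lbracket N (v ∘ lassoc (simp a) (simp a') _))); last by move=> j; tlin2.
  by apply: eq_bsum => j u v; rewrite -compA (assocK MP) comp1r.
pose F h := bsum (fun j p p' => B j p (p' ∘ (idm (simp a) ⊳m h))).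
have FL : linear F by rewrite /F /B; tlin.
transitivity (bsum (fun l (u : hom (simp l) (simp a' ⊳ simp k)) u' => F (u ∘ u'))).
  rewrite (bsum_res FL) /F.
  by apply: eq_bsum => j p p'; rewrite (act1 MP) comp1r.
apply: eq_bsum => l u u'.
(* Cutting u u' at a label i is harmless: only i = l contributes. *)
transitivity (\sum_i F (u ∘ dlt i l ∘ (dlt l i ∘ u'))).
  rewrite (sum_dltl (F := fun i h => F (u ∘ h ∘ (dlt l i ∘ u')))).
    by rewrite dltE comp1l comp1r.
  by move=> i; rewrite comp0r comp0l (lin0 FL).
apply: eq_bigr => i _; rewrite /F.
transitivity (bsum (fun j p p' => B j p (p' ∘ (idm (simp a) ⊳m (u ∘ dlt i l)) ∘
     (idm (simp a) ⊳m (dlt l i ∘ u'))))).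
  by apply: eq_bsum => j p p'; rewrite (actMl MP) !compA.
rewrite -(bsum_balance (idm (simp a) ⊳m (u ∘ dlt i l))
   (B := fun j p p' => B j p (p' ∘ (idm (simp a) ⊳m (dlt l i ∘ u'))))) //.
by move=> j; apply: bilinear_comp2 => //; tlin.
Qed.

(** Applied to a product, the counit becomes the scalar of one nested composite in which the
    associators cancel. The counit axioms then only cut and reglue such composites. *)
Lemma lteps_mul A A' d e f g d' e' f' g'
    (n : hom (simp d) (A ⊳ simp e)) (z : hom (A ⊳ simp f) (simp g))
    (n' : hom (simp d') (A' ⊳ simp e')) (z' : hom (A' ⊳ simp f') (simp g')) :
  lteps (ltmul (lbracket n z) (lbracket n' z')) =
  co (z ∘ (idm A ⊳m (dlt g' f ∘ (z' ∘ (idm A' ⊳m dlt e' f') ∘ n') ∘ dlt e d')) ∘ n).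
Proof.
rewrite ltmul_bracket /lprod lteps_bracket; congr co.
rewrite -!compA; congr (_ ∘ _).
rewrite (precomp (act_assoc_conj _ _ _)) (precompK (assocVK MP _ _ _)).
by rewrite !(actMl MP) -!compA.
Qed.

Lemma lteps_mul3 A1 A2 A3 d1 e1 f1 g1 d2 e2 f2 g2 d3 e3 f3 g3
    (n1 : hom (simp d1) (A1 ⊳ simp e1)) (z1 : hom (A1 ⊳ simp f1) (simp g1))
    (n2 : hom (simp d2) (A2 ⊳ simp e2)) (z2 : hom (A2 ⊳ simp f2) (simp g2))
    (n3 : hom (simp d3) (A3 ⊳ simp e3)) (z3 : hom (A3 ⊳ simp f3) (simp g3)) :
  lteps (ltmul (lbracket n1 z1) (ltmul (lbracket n2 z2) (lbracket n3 z3))) =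
  co (z1 ∘ (idm A1 ⊳m (dlt g2 f1 ∘ (z2 ∘ (idm A2 ⊳m (dlt g3 f2 ∘
    (z3 ∘ (idm A3 ⊳m dlt e3 f3) ∘ n3) ∘ dlt e2 d3)) ∘ n2) ∘ dlt e1 d2)) ∘ n1).
Proof.
rewrite [ltmul (lbracket n2 z2) _]ltmul_bracket /lprod.
rewrite [LHS]lteps_mul; congr (co (_ ∘ (_ ⊳m (_ ∘ _ ∘ _)) ∘ _)).
rewrite -!compA; congr (_ ∘ _).
rewrite (precomp (act_assoc_conj _ _ _)) (precompK (assocVK MP _ _ _)).
by rewrite !(actMl MP) -!compA.
Qed.

(** The composite contributed by y has the scalar w of z nested inside it. The sum over i cuts it
    just after w, and the dual bases of a2 i separate the two pieces; in [ltepsMr] the cut is just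
    before w. *)
Lemma ltepsMl (x y z : T) :
  (lteps (ltmul (ltmul x y) z) : C^o) =
  tlift (fun a b => lteps (ltmul x a) * lteps (ltmul b z) : C^o) (ltdelta y).
Proof.
rewrite -ltmulA.
move: x; apply: ltube_ext; [by tlin..|] => a1 d1 e1 f1 g1 n1 z1.
move: y; apply: ltube_ext; [by tlin..|] => a2 d2 e2 f2 g2 n2 z2.
move: z; apply: ltube_ext; [by tlin..|] => a3 d3 e3 f3 g3 n3 z3.
rewrite tlift_ltdelta; last by tlin2.
rewrite [LHS]lteps_mul3; set w := z3 ∘ _ ∘ n3.
pose F i k := co (z1 ∘ (idm (simp a1) ⊳m (dlt g2 f1 ∘
   (z2 ∘ (idm (simp a2) ⊳m k) ∘
     ((idm (simp a2) ⊳m (dlt g3 i ∘ w ∘ dlt e2 d3)) ∘ n2)) ∘ dlt e1 d2)) ∘ n1).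
transitivity (\sum_i F i (dlt i f2)).
  rewrite sum_dltl; first by rewrite /F (act1 MP) comp1r !compA.
  by move=> i; apply: (lin0 (f := F i : _ -> C^o)); rewrite /F; tlin.
apply: eq_bigr => i _.
transitivity (bsum (fun j (u : hom (simp j) (simp a2 ⊳ simp i)) v =>
  co (z1 ∘ (idm (simp a1) ⊳m (dlt g2 f1 ∘
   (z2 ∘ (idm (simp a2) ⊳m dlt i f2) ∘ u) ∘ dlt e1 j)) ∘ n1) *
  co (v ∘ ((idm (simp a2) ⊳m (dlt g3 i ∘ w ∘ dlt e2 d3)) ∘ n2)) : C^o)).
  rewrite (bsum_postr _ (B := fun j u v => co (z1 ∘ (idm (simp a1) ⊳m (dlt g2 f1 ∘
   (z2 ∘ (idm (simp a2) ⊳m dlt i f2) ∘ u) ∘ dlt e1 j)) ∘ n1) * co v : C^o)).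
    by rewrite co_id mulr1.
  by move=> j; tlin2.
apply: eq_bsum => j u v.
by congr GRing.mul; rewrite [RHS]lteps_mul // -[in RHS]compA.
Qed.

Lemma ltepsMr (x y z : T) :
  (lteps (ltmul (ltmul x y) z) : C^o) =
  tlift (fun a b => lteps (ltmul x b) * lteps (ltmul a z) : C^o) (ltdelta y).
Proof.
rewrite -ltmulA.
move: x; apply: ltube_ext; [by tlin..|] => a1 d1 e1 f1 g1 n1 z1.
move: y; apply: ltube_ext; [by tlin..|] => a2 d2 e2 f2 g2 n2 z2.
move: z; apply: ltube_ext; [by tlin..|] => a3 d3 e3 f3 g3 n3 z3.
rewrite tlift_ltdelta; last by tlin2.
rewrite [LHS]lteps_mul3; set w := z3 ∘ _ ∘ n3.
pose F i k := co (z1 ∘ (idm (simp a1) ⊳m (dlt g2 f1 ∘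
   (z2 ∘ (idm (simp a2) ⊳m (dlt g3 f2 ∘ w ∘ dlt i d3)) ∘
     (idm (simp a2) ⊳m k) ∘ n2) ∘ dlt e1 d2)) ∘ n1).
transitivity (\sum_i F i (dlt e2 i)).
  rewrite sum_dltr; first by rewrite /F (act1 MP) comp1r.
  by move=> i; apply: (lin0 (f := F i : _ -> C^o)); rewrite /F; tlin.
apply: eq_bigr => i _.
transitivity (bsum (fun j (u : hom (simp j) (simp a2 ⊳ simp i)) v =>
  co (z1 ∘ (idm (simp a1) ⊳m (dlt j f1 ∘
   (v ∘ (idm (simp a2) ⊳m dlt e2 i) ∘ n2) ∘ dlt e1 d2)) ∘ n1) *
  co (z2 ∘ (idm (simp a2) ⊳m (dlt g3 f2 ∘ w ∘ dlt i d3)) ∘ u) : C^o)).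
  rewrite (bsum_postl _ (B := fun j u v => co (z1 ∘ (idm (simp a1) ⊳m (dlt j f1 ∘
   (v ∘ (idm (simp a2) ⊳m dlt e2 i) ∘ n2) ∘ dlt e1 d2)) ∘ n1) * co u : C^o)).
    by rewrite co_id mulr1.
  by move=> j; tlin2.
apply: eq_bsum => j u v.
by congr GRing.mul; rewrite [RHS]lteps_mul.
Qed.

End TubeBialgebra.

(** * The unit and the antipode *)

Section TubeUnit.
Variables (C : numClosedFieldType) (D : umfc C) (M : left_module D).
Implicit Types (A B : D) (d e f g i j x y : Irr M).

Let MP := left_module_action M.
Local Notation T := (left_tube M).
Local Notation lunitE := (@lunitE C D M).

(** The unit object times i is isomorphic to the simple object i, so the sum over j collapses to j =
    i. *)
Lemma tlift_lunitE (U : lmodType C) (B : T -> T -> U) x y : bilinear2 B ->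
  tlift B (ltdelta (lunitE y x)) = \sum_i B (lunitE i x) (lunitE y i).
Proof.
move=> bB; rewrite tlift_ltdelta //; apply: eq_bigr => i _.
transitivity (bsum (fun j (u : hom (simp j) (unito ⊳ simp i)) v =>
   B (lbracket ((lmunit (simp i))† ∘ (lmunit (simp i) ∘ u)) (lmunit (simp x)))
     (lbracket (lmunit (simp y))† v))).
  by apply: eq_bsum => j u v; rewrite compA (munitK MP) comp1l.
rewrite (bsum_postl (lmunit (simp i)) (B := fun j u v =>
   B (lbracket ((lmunit (simp i))† ∘ u) (lmunit (simp x)))
     (lbracket (lmunit (simp y))† v))); first by rewrite comp1r.
by move=> j; apply: bilinear_comp2 => //; tlin.
Qed.

Lemma tlift_ltone (U : lmodType C) (B : T -> T -> U) : bilinear2 B ->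
  tlift B (ltdelta (ltone M)) = \sum_y \sum_x \sum_i B (lunitE i x) (lunitE y i).
Proof.
move=> bB.
have L : linear (fun t : T => tlift B (ltdelta t)) by tlin.
rewrite /ltone (lin_sum L); apply: eq_bigr => y _.
by rewrite (lin_sum L); apply: eq_bigr => x _; apply: tlift_lunitE.
Qed.

Lemma lunitE_mul y x y' x' :
  ltmul (lunitE y x) (lunitE y' x') =
  lbracket ((lmunit (simp y'))† ∘ dlt y y') (dlt x' x ∘ lmunit (simp x')).
Proof. exact: lunitE_mull. Qed.

(** The normal form to which both axioms on the coproduct of 1 are reduced. *)
Lemma ltdelta_one3 :
  tlift (fun u c : T => tlift (fun a b : T => a ⊠ (b ⊠ c)) (ltdelta u))
    (ltdelta (ltone M)) =
  \sum_y \sum_x \sum_i \sum_j lunitE i x ⊠ (lunitE j i ⊠ lunitE y j).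
Proof.
rewrite tlift_ltone; last by tlin2.
apply: eq_bigr => y _; apply: eq_bigr => x _; rewrite [RHS]exchange_big.
by apply: eq_bigr => i _; rewrite tlift_lunitE //; tlin2.
Qed.

Lemma ltdelta1l :
  tlift (fun u c : T => tlift (fun a b : T => a ⊠ (b ⊠ c)) (ltdelta u))
    (ltdelta (ltone M)) =
  tlift (fun a b : T => tlift (fun c d : T => a ⊠ (ltmul b c ⊠ d))
    (ltdelta (ltone M))) (ltdelta (ltone M)).
Proof.
rewrite ltdelta_one3 tlift_ltone; last by tlin2.
transitivity (\sum_j \sum_y \sum_x \sum_i lunitE i x ⊠ (lunitE j i ⊠ lunitE y j)).
  rewrite [RHS]exchange_big; apply: eq_bigr => y _; rewrite [RHS]exchange_big.
  by apply: eq_bigr => x _; rewrite exchange_big.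
apply: eq_bigr => j _; rewrite exchange_big; apply: eq_bigr => x _.
rewrite exchange_big; apply: eq_bigr => i _.
rewrite tlift_ltone; last by tlin2.
apply: eq_bigr => y _; rewrite exchange_big.
under eq_bigr => k _ do under eq_bigr => l _ do rewrite lunitE_mul.
transitivity (\sum_k lunitE i x ⊠ (lbracket ((lmunit (simp k))† ∘ dlt j k)
    (lmunit (simp i)) ⊠ lunitE y k)).
  rewrite (sum_dltr (F := fun k h => lunitE i x ⊠
     (lbracket ((lmunit (simp k))† ∘ h) (lmunit (simp i)) ⊠ lunitE y k))).
    by rewrite comp1r.
  move=> k; apply: (lin0 (f := fun h => lunitE i x ⊠
     (lbracket ((lmunit (simp k))† ∘ h) (lmunit (simp i)) ⊠ lunitE y k))).
  by tlin.
apply: eq_bigr => k _.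
rewrite (sum_dltl (F := fun l h => lunitE i x ⊠ (lbracket ((lmunit (simp k))† ∘ dlt j k)
    (h ∘ lmunit (simp l)) ⊠ lunitE y k))); first by rewrite comp1l.
move=> l; apply: (lin0 (f := fun h => lunitE i x ⊠
   (lbracket ((lmunit (simp k))† ∘ dlt j k) (h ∘ lmunit (simp l)) ⊠ lunitE y k))).
by tlin.
Qed.

Lemma ltdelta1r :
  tlift (fun u c : T => tlift (fun a b : T => a ⊠ (b ⊠ c)) (ltdelta u))
    (ltdelta (ltone M)) =
  tlift (fun a b : T => tlift (fun c d : T => a ⊠ (ltmul c b ⊠ d))
    (ltdelta (ltone M))) (ltdelta (ltone M)).
Proof.
rewrite ltdelta_one3 tlift_ltone; last by tlin2.
transitivity (\sum_j \sum_y \sum_x \sum_i lunitE i x ⊠ (lunitE j i ⊠ lunitE y j)).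
  rewrite [RHS]exchange_big; apply: eq_bigr => y _; rewrite [RHS]exchange_big.
  by apply: eq_bigr => x _; rewrite exchange_big.
apply: eq_bigr => j _; rewrite exchange_big; apply: eq_bigr => x _.
rewrite exchange_big; apply: eq_bigr => i _.
rewrite tlift_ltone; last by tlin2.
apply: eq_bigr => y _; rewrite exchange_big.
under eq_bigr => k _ do under eq_bigr => l _ do rewrite lunitE_mul.
transitivity (\sum_k lunitE i x ⊠ (lbracket ((lmunit (simp j))† ∘ dlt k j)
    (lmunit (simp i)) ⊠ lunitE y k)).
  rewrite (sum_dltl (F := fun k h => lunitE i x ⊠
     (lbracket ((lmunit (simp j))† ∘ h) (lmunit (simp i)) ⊠ lunitE y k))).
    by rewrite comp1r.
  move=> k; apply: (lin0 (f := fun h => lunitE i x ⊠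
     (lbracket ((lmunit (simp j))† ∘ h) (lmunit (simp i)) ⊠ lunitE y k))).
  by tlin.
apply: eq_bigr => k _.
rewrite (sum_dltr (F := fun l h => lunitE i x ⊠ (lbracket ((lmunit (simp j))† ∘ dlt k j)
    (h ∘ lmunit (simp i)) ⊠ lunitE y k))); first by rewrite comp1l.
move=> l; apply: (lin0 (f := fun h => lunitE i x ⊠
   (lbracket ((lmunit (simp j))† ∘ dlt k j) (h ∘ lmunit (simp i)) ⊠ lunitE y k))).
by tlin.
Qed.

Lemma ltSE (a : Irr D) d e f g (n : hom (simp d) (simp a ⊳ simp e))
    (z : hom (simp a ⊳ simp f) (simp g)) :
  ltS (lbracket n z) = (ldim f / ldim g) *: lbracket (flat z) (sharp n).
Proof. by rewrite lbracket_simple /ltS tube_liftE //; tlin2. Qed.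

(** The antipode bends one member v of each dual pair; [sharpK] rewrites the other member as an
    unbent [sharp u]. With the factor d_i / d_j from the antipode, [bsum_bend] makes them dual bases
    of the dual of a times j, which resolve an identity. A coevaluation is left over; balance
    carries it to the other entry, where it closes up to the scalar of h. *)
Lemma ltS_target (t : T) :
  tlift (fun a b => ltmul a (ltS b)) (ltdelta t) =
  tlift (fun a b => lteps (ltmul a t) *: b) (ltdelta (ltone M)).
Proof.
move: t; apply: ltube_ext; [by tlin..|] => a d e f g n z.
rewrite tlift_ltdelta; last by tlin2.
rewrite tlift_ltone; last by tlin2.
set h := z ∘ (idm (simp a) ⊳m dlt e f) ∘ n.
pose B j i (u : hom (simp i) (dual (simp a) ⊳ simp j))
    (v : hom (dual (simp a) ⊳ simp j) (simp i)) := lbracket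
  ((lassoc (simp a) (dual (simp a)) (simp j))† ∘ (idm (simp a) ⊳m u) ∘
    ((idm (simp a) ⊳m v) ∘ lcoev (simp a) (simp j)))
  (z ∘ (idm (simp a) ⊳m (dlt e f ∘ sharp n)) ∘
    lassoc (simp a) (dual (simp a)) (simp d)).
transitivity (\sum_j bsum (B j)).
  rewrite /bsum exchange_big; apply: eq_bigr => j _; apply: eq_bigr => i _.
  rewrite -(bsum_bend MP (ki := ldim i) (kj := ldim j)) ?ldim_neq0 //.
  - apply: eq_bigr => s _.
    rewrite ltSE (linZ (lin_ltmulr _ (@lin_id _ _))) ltmul_bracket /lprod /B.
    by rewrite dltE comp1r (sharpK MP).
  - by rewrite /B; split=> ?; tlin.
  by move=> s r; apply: module_bend_trace.
transitivity (\sum_j co h *: lunitE j d).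
  apply: eq_bigr => j _.
  pose F k := lbracket
    ((lassoc (simp a) (dual (simp a)) (simp j))† ∘ (idm (simp a) ⊳m k) ∘
       lcoev (simp a) (simp j))
    (z ∘ (idm (simp a) ⊳m (dlt e f ∘ sharp n)) ∘
      lassoc (simp a) (dual (simp a)) (simp d)).
  transitivity (F (idm _)).
    rewrite -(bsum_res (F := F)); last by rewrite /F; tlin.
    by apply: eq_bsum => k u v; rewrite /B /F !(actMl MP) !compA.
  rewrite /F (act1 MP) comp1r {1}/lcoev -[X in _ ∘ X]compA (precompK (assocK MP _ _ _)).
  rewrite lbracket_balance.
  (* By [sharpK] the coevaluation turns [sharp n] back into n. *)
  have -> : z ∘ (idm (simp a) ⊳m (dlt e f ∘ sharp n)) ∘
       lassoc (simp a) (dual (simp a)) (simp d) ∘ (coev (simp a) ⊳m idm (simp d)) =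
     h ∘ lmunit (simp d).
    rewrite /h -[X in _ = _ ∘ X ∘ _](sharpK MP) /lcoev (actMl MP) -!compA.
    by rewrite (munitK MP) comp1r.
  have [dg|dg] := eqVneq d g; last first.
    rewrite (co_neq _ dg) scale0r [h]coE (co_neq _ dg) scale0r comp0l.
    exact: (lin0 (lin_lbracketr _ (@lin_id _ _))).
  subst g; rewrite [in LHS](coE1 h) compZl comp1l.
  by rewrite (linZ (lin_lbracketr _ (@lin_id _ _))).
apply: eq_bigr => y _.
transitivity (\sum_i co (h ∘ dlt i d) *: lunitE y i).
  rewrite (sum_dltl (F := fun i k => co (h ∘ k) *: lunitE y i)) ?comp1r //.
  by move=> i; rewrite comp0r co0 scale0r.
rewrite exchange_big; apply: eq_bigr => i _.
under eq_bigr => x _ do rewrite lunitE_mull lteps_bracket.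
rewrite (sum_dltr (F := fun x k => co (k ∘ z ∘ (idm (simp a) ⊳m dlt e f) ∘
   (n ∘ dlt i d)) *: lunitE y i)); first by rewrite comp1l /h !compA.
by move=> x; rewrite !comp0l co0 scale0r.
Qed.

(** Here the dual bases meet without having been bent and resolve an identity at once. Balance along
    the evaluation leaves the partial trace over a of a composite of z and n; [module_bend_trace]
    makes it a scalar with factor d_g / d_f, which the factor d_f / d_g of the antipode cancels. *)
Lemma ltS_source_bracket (a : Irr D) d e f g (n : hom (simp d) (simp a ⊳ simp e))
    (z : hom (simp a ⊳ simp f) (simp g)) :
  tlift (fun a b => ltmul (ltS a) b) (ltdelta (lbracket n z)) =
  \sum_x co (z ∘ (idm (simp a) ⊳m dlt e f) ∘ n) *: lunitE f x.
Proof.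
rewrite tlift_ltdelta; last by tlin2.
apply: eq_bigr => i _.
pose N := (lassoc (dual (simp a)) (simp a) (simp e))† ∘
   (idm (dual (simp a)) ⊳m (n ∘ dlt g d)) ∘ flat z.
pose F k := (ldim f / ldim g) *: lbracket N
   (lcap (simp a) (simp i) ∘ (idm (dual (simp a)) ⊳m k) ∘
    lassoc (dual (simp a)) (simp a) (simp i)).
transitivity (F (idm _)).
  rewrite -(bsum_res (F := F)); last by rewrite /F; tlin.
  apply: eq_bsum => j u v.
  rewrite ltSE (linZ (lin_ltmull _ (@lin_id _ _))) ltmul_bracket /lprod /F /N.
  by rewrite dltE comp1l /sharp !(actMl MP) !compA.
have -> : F (idm _) = (ldim f / ldim g) *:
    lbracket ((lmunit (simp e))† ∘ (lcap (simp a) (simp e) ∘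
       (idm (dual (simp a)) ⊳m (n ∘ dlt g d ∘ z)) ∘ lcup (simp a) (simp f)))
     (lmunit (simp i)).
  rewrite /F (act1 MP) comp1r /lcap -!compA (assocK MP) comp1r -lbracket_balance.
  congr (_ *: lbracket _ _); rewrite /N /flat /lcap !(actMl MP) -!compA.
  by rewrite (precompK (munitK MP _)).
set k := _ ∘ lcup _ _.
have -> : k = (ldim g / ldim f * co (z ∘ (idm (simp a) ⊳m dlt e f) ∘ n)) *: dlt f e.
  have [ef|ef] := eqVneq e f; last first.
    rewrite (dlt_neq ef) (dlt_neq (k := f)) ?scaler0; last by rewrite eq_sym.
    by rewrite [k]coE co_neq ?scale0r // eq_sym.
  subst f; rewrite !dltE (act1 MP) comp1r.
  apply: (scalerI (ldim_neq0 e)); rewrite -[k]/(lptr _) -compA.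
  rewrite module_bend_trace scalerA; congr (_ *: _).
  have [dg|dg] := eqVneq d g; last first.
    by rewrite (dlt_neq (k := g)) 1?eq_sym // comp0l comp0l co0 co_neq // !mulr0.
  subst g; rewrite dltE comp1l; field; exact: ldim_neq0.
rewrite compZr (linZ (lin_lbracketl _ (@lin_id _ _))) scalerA.
set c := co _; have -> : ldim f / ldim g * (ldim g / ldim f * c) = c.
  by field; rewrite !ldim_neq0.
have [ef|ef] := eqVneq e f; first by subst e; rewrite dltE comp1r.
by rewrite {}/c (dlt_neq ef) (lin0 (lin_lactr _ (@lin_id _ _))) comp0r comp0l co0 !scale0r.
Qed.

Lemma ltS_source (t : T) :
  tlift (fun a b => ltmul (ltS a) b) (ltdelta t) =
  tlift (fun a b => lteps (ltmul t b) *: a) (ltdelta (ltone M)).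
Proof.
move: t; apply: ltube_ext; [by tlin..|] => a d e f g n z.
rewrite ltS_source_bracket tlift_ltone; last by tlin2.
rewrite exchange_big; apply: eq_bigr => x _; rewrite exchange_big.
transitivity (\sum_i co (z ∘ (idm (simp a) ⊳m dlt i f) ∘
    (idm (simp a) ⊳m dlt e i) ∘ n) *: lunitE i x).
  rewrite (sum_dltl (F := fun i k => co (z ∘ (idm (simp a) ⊳m k) ∘
    (idm (simp a) ⊳m dlt e i) ∘ n) *: lunitE i x)).
    by rewrite (act1 MP) comp1r.
  move=> i; rewrite (lin0 (lin_lactr _ (@lin_id _ _))).
  by rewrite comp0r !comp0l co0 scale0r.
apply: eq_bigr => i _.
under eq_bigr => y _ do rewrite lunitE_mulr lteps_bracket.
rewrite (sum_dltr (F := fun y k => co (z ∘ (idm (simp a) ⊳m dlt i f) ∘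
   (idm (simp a) ⊳m dlt y i) ∘ ((idm (simp a) ⊳m k) ∘ n)) *: lunitE i x)).
  by rewrite (act1 MP) comp1l.
move=> y; rewrite (lin0 (lin_lactr _ (@lin_id _ _))).
by rewrite comp0l comp0r co0 scale0r.
Qed.

Lemma lin_tlift_out (V W : vectType C) (U U' : lmodType C) (F : U -> U')
    (B : V -> W -> U) t : linear F -> F (tlift B t) = tlift (fun a b => F (B a b)) t.
Proof.
move=> FL; rewrite /tlift (lin_sum FL); apply: eq_bigr => i _.
by rewrite (lin_sum FL); apply: eq_bigr => j _; rewrite (linZ FL).
Qed.

(** By [ltS_source_bracket] the first two legs multiply to a combination of the [lunitE], whose
    products only restrict labels; a sum over dual bases absorbed by a counit scalar remains. *)
Lemma ltS_conv (t : T) :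
  tlift (fun u c => tlift (fun a b => ltmul (ltmul (ltS a) b) (ltS c)) (ltdelta u))
    (ltdelta t) = ltS t.
Proof.
move: t; apply: ltube_ext; [by tlin..|] => a d e f g n z.
rewrite tlift_ltdelta; last by tlin2.
transitivity (\sum_i (ldim i / ldim g) *:
  lbracket (flat (z ∘ (idm (simp a) ⊳m dlt i f)) ∘ dlt f i) (sharp n)); last first.
  rewrite ltSE (sum_dltr (F := fun i k => (ldim i / ldim g) *:
    lbracket (flat (z ∘ (idm (simp a) ⊳m dlt i f)) ∘ k) (sharp n))).
    by rewrite dltE (act1 MP) !comp1r.
  by move=> i; rewrite comp0r (lin0 (lin_lbracketl _ (@lin_id _ _))) scaler0.
apply: eq_bigr => i _.
transitivity (bsum (fun j (u : hom (simp j) (simp a ⊳ simp i)) v =>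
   co (z ∘ (idm (simp a) ⊳m dlt i f) ∘ u) *: ((ldim i / ldim j) *:
     lbracket (flat v ∘ dlt f i) (sharp n)))); last first.
  rewrite (bsum_postl (z ∘ (idm (simp a) ⊳m dlt i f)) (B := fun j u v =>
    co u *: ((ldim i / ldim j) *: lbracket (flat v ∘ dlt f i) (sharp n)))).
    by rewrite co_id scale1r.
  by move=> j; tlin2.
apply: eq_bsum => j u v.
rewrite -(lin_tlift_out (F := fun r => ltmul r (ltS (lbracket n v)))
  (fun a b => ltmul (ltS a) b)); last by tlin.
rewrite ltS_source_bracket (lin_sum (lin_ltmull _ (@lin_id _ _))).
under eq_bigr => x _ do rewrite (linZ (lin_ltmull _ (@lin_id _ _))) ltSE
  (linZ (lin_ltmulr _ (@lin_id _ _))) lunitE_mull.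
rewrite (sum_dltr (F := fun x k => co (z ∘ (idm (simp a) ⊳m dlt i f) ∘ u) *:
  ((ldim i / ldim j) *: lbracket (flat v ∘ dlt f i) (k ∘ sharp n)))).
  by rewrite comp1l.
by move=> x; rewrite comp0l (lin0 (lin_lbracketr _ (@lin_id _ _))) !scaler0.
Qed.

End TubeUnit.

(** * The involution *)

Section TubeStar.
Variables (C : numClosedFieldType) (D : umfc C) (M : left_module D).
Implicit Types (A B : D) (d e f g i j x y : Irr M).

Let MP := left_module_action M.
Local Notation T := (left_tube M).

Lemma ltstarE (a : Irr D) d e f g (n : hom (simp d) (simp a ⊳ simp e))
    (z : hom (simp a ⊳ simp f) (simp g)) :
  ltstar (lbracket n z) = (ldim e / ldim d) *: lbracket (flat n†) (sharp z†).
Proof.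
rewrite lbracket_simple /ltstar tube_aliftE //.
split=> u; apply: alin_scale.
  exact: (alin_fun (f := fun r => lbracket (flat u†) (sharp r))
    (lin_lbracketr _ (lin_sharp (@lin_id _ _))) (@alin_dag _ _ _ _ _)).
exact: (alin_fun (f := fun r => lbracket (flat r) (sharp u†))
    (lin_lbracketl _ (lin_flat (@lin_id _ _))) (@alin_dag _ _ _ _ _)).
Qed.

(** Daggers exchange the members of the dual pairs, and [bsum_dag] makes them dual bases again. The
    star of the first leg supplies the factor d_i / d_j required by [bsum_bend], which also
    exchanges the summation labels i and j. *)
Lemma ltdelta_star (t : T) :
  ltdelta (ltstar t) =
  tlift_anti (fun a b => ltstar a ⊠ ltstar b) (ltdelta t).
Proof.
have bB : antilinear2 (fun a b : T => ltstar a ⊠ ltstar b).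
  split=> u; first exact: (alin_fun ((pure_bilinear _ _).1 _) (@ltstar_alin _ _ _)).
  exact: (alin_fun ((pure_bilinear _ _).2 _) (@ltstar_alin _ _ _)).
have sA := @tlift_anti_antilinear C T T _ (fun a b : T => ltstar a ⊠ ltstar b).
move: t; apply: ltube_aext.
- by apply: alin_fun (@ltstar_alin _ _ _); tlin.
- by apply: (alin_lin sA); tlin.
move=> a d e f g n z.
rewrite ltstarE (linZ (lin_ltdelta (@lin_id _ _))) !ltdelta_bracket.
rewrite (alin_sum sA).
transitivity (\sum_i bsum (fun j (u : hom (simp j) (simp a ⊳ simp i)) v =>
  ((ldim i / ldim j) *: lbracket (flat u†) (sharp z†)) ⊠
  ((ldim e / ldim d) *: lbracket (flat n†) (sharp v†)))); last first.
  apply: eq_bigr => i _; rewrite /bsum (alin_sum sA); apply: eq_bigr => j _.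
  rewrite (alin_sum sA); apply: eq_bigr => s _.
  by rewrite (tlift_anti_pure _ _ bB) !ltstarE.
transitivity (\sum_i bsum (fun j (u : hom (simp j) (simp a ⊳ simp i)) v =>
  ((ldim i / ldim j) *: lbracket (flat v) (sharp z†)) ⊠
  ((ldim e / ldim d) *: lbracket (flat n†) (sharp u)))); last first.
  apply: eq_bigr => i _; rewrite -bsum_dag //.
  by move=> j; tlin2.
rewrite scaler_sumr [RHS]exchange_big; apply: eq_bigr => j _.
rewrite /bsum scaler_sumr; apply: eq_bigr => i _; rewrite scaler_sumr.
rewrite -(bsum_bend MP (ki := ldim i) (kj := ldim j) (B := fun u v =>
  (ldim e / ldim d) *: (lbracket u (sharp z†) ⊠ lbracket (flat n†) v)));
  rewrite ?ldim_neq0 //.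
- apply: eq_bigr => s _.
  rewrite (linZ ((pure_bilinear _ _).1 _)).
  by rewrite (linZ ((pure_bilinear _ _).2 _)) !scalerA mulrC.
- by tlin2.
by move=> s r; apply: module_bend_trace.
Qed.

Lemma lwha_weak_hopf : is_weak_hopf (lwha M).
Proof.
split; rewrite /=.
- exact: ltmul_lin2.
- exact: ltmulA.
- exact: ltmul1l.
- exact: ltmul1r.
- exact: lin_ltdelta (@lin_id _ _).
- exact: lin_lteps (@lin_id _ _).
- exact: ltdelta_coassoc.
- exact: ltdelta_counitl.
- exact: ltdelta_counitr.
- exact: ltdeltaM.
- exact: ltdelta1l.
- exact: ltdelta1r.
- exact: ltepsMl.
- exact: ltepsMr.
- exact: lin_ltS (@lin_id _ _).
- exact: ltS_target.
- exact: ltS_source.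
- exact: ltS_conv.
Qed.

Lemma id_lact0 (a : Irr D) (m n : M) (u : hom n (simp a ⊳ m)) :
  idm (simp a ⊳ m) = 0 -> u = 0.
Proof. by move=> e; rewrite -(comp1l u) e comp0l. Qed.

(** Resolving the identity of the unit object into [unit_proj i] and balancing along the inclusions
    gives sums over all x and y; a term with a zero object has a zero entry, hence the
    restrictions. *)
Lemma ltone_simple : ltone M = \sum_(i in (unit_irr : {set Irr D}))
      \sum_(y : Irr M | idm (simp i ⊳ simp y) != 0)
      \sum_(x : Irr M | idm (simp i ⊳ simp x) != 0)
        ltube_elt (((unit_inc i)† ⊳m idm (simp y)) ∘ (lmunit (simp y))†)
                  (lmunit (simp x) ∘ (unit_inc i ⊳m idm (simp x))).
Proof.
transitivity (\sum_(i in (unit_irr : {set Irr D})) \sum_y \sum_x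
  lbracket (((unit_inc i)† ⊳m idm (simp y)) ∘ (lmunit (simp y))†)
           (lmunit (simp x) ∘ (unit_inc i ⊳m idm (simp x))) : T).
  rewrite /ltone [RHS]exchange_big; apply: eq_bigr => y _.
  rewrite [RHS]exchange_big; apply: eq_bigr => x _.
  pose F (h : hom unito unito) : T :=
    lbracket (lmunit (simp y))† (lmunit (simp x) ∘ (h ⊳m idm (simp x))).
  transitivity (F (idm _)); first by rewrite /F (act1 MP) comp1r.
  rewrite -(unit_decomp (umfcP D)) lin_sum; last by rewrite /F; tlin.
  apply: eq_bigr => i _; rewrite lbracket_balance; congr lbracket.
  by rewrite /unit_proj (actMr MP) !compA.
apply: eq_bigr => i _; rewrite [RHS]big_mkcond; apply: eq_bigr => y _.
have [y0|_] := eqVneq (idm (simp i ⊳ simp y)) 0.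
  apply: big1 => x _; rewrite (id_lact0 (_ ∘ _) y0).
  exact: (lin0 (lin_lbracketl _ (@lin_id _ _))).
rewrite [RHS]big_mkcond; apply: eq_bigr => x _.
have [x0|_] := eqVneq (idm (simp i ⊳ simp x)) 0; last exact: lbracket_simple.
rewrite -[X in lbracket _ X]comp1r x0 comp0r.
exact: (lin0 (lin_lbracketr _ (@lin_id _ _))).
Qed.

Lemma lwha_tube_algebra : is_left_tube_algebra (lwha M).
Proof.
split; rewrite /=.
- exact: ltone_simple.
- move=> a a' d e f g e' f' n z n' z'.
  by rewrite ltmulE /lprod !dltE comp1l comp1r.
- move=> a a' d e f g d' e' f' g' n z n' z'.
  by rewrite ltmulE; apply: lprod_neq.
- move=> a d e n z; rewrite -lbracket_simple lteps_bracket dltE (act1 MP) comp1r.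
  by rewrite -coE1.
- move=> a d e f g n z; rewrite -lbracket_simple lteps_bracket negb_and.
  case/orP=> [ef|dg]; last by rewrite co_neq.
  by rewrite (dlt_neq ef) (lin0 (lin_lactr _ (@lin_id _ _))) comp0r comp0l co0.
- move=> a d e f g n z; rewrite -lbracket_simple ltdelta_bracket.
  apply: eq_bigr => i _; apply: eq_bigr => j _; apply: eq_bigr => s _.
  by rewrite !lbracket_simple.
- by move=> a d e f g n z; rewrite -lbracket_simple ltSE.
by move=> a d e f g n z; rewrite -lbracket_simple ltstarE.
Qed.

End TubeStar.

(** * The inner product *)

Section Parseval.
Variables (C : numClosedFieldType) (V : vectType C) (q : V -> V -> C).
Hypothesis q_linear : forall w, linear (q^~ w : V -> C^o).
Hypothesis q_conj : forall v w, q w v = (q v w)^*.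
Hypothesis q_ge0 : forall v, 0 <= q v v.
Hypothesis q_eq0 : forall v, q v v = 0 -> v = 0.

(** Gram-Schmidt by induction on the dimension: a vector of U is normalised to u, and the induction
    continues in the orthogonal complement of u in U, the kernel of [q^~ u]. *)
Lemma orthonormal_seq (U : {vspace V}) : exists s : seq V,
  {subset s <= U} /\ forall v, v \in U -> v = \sum_(e <- s) q v e *: e.
Proof.
have [m le_m] := ubnP (\dim U); elim: m => // m IH in U le_m *.
have [U0|U0] := eqVneq U 0%VS.
  exists [::]; split=> // v; rewrite U0 memv0 big_nil => /eqP ->.
  by [].
have u0 : vpick U != 0 by rewrite vpick0.
set c := q (vpick U) (vpick U).
have c0 : 0 < c.
  by rewrite lt_neqAle q_ge0 andbT eq_sym; apply: contra u0 => /eqP/q_eq0 ->.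
pose u := (sqrtC c)^-1 *: vpick U.
have uU : u \in U by rewrite memvZ // memv_pick.
have qZ a v w : q (a *: v) w = a * q v w by exact: (linZ (q_linear w)).
have quu : q u u = 1.
  rewrite /u qZ q_conj qZ -/c geC0_conj; last first.
    by rewrite mulr_ge0 ?invr_ge0 ?sqrtC_ge0 ?ltW.
  by rewrite mulrA -invfM -expr2 sqrtCK mulVf // gt_eqF.
pose g : {linear V -> C^o} :=
  HB.pack (q^~ u : V -> C^o) (GRing.isLinear.Build C V C^o _ (q^~ u) (q_linear u)).
pose U' := (U :&: lker (linfun g))%VS.
have U'P v : v \in U' -> v \in U /\ q v u = 0.
  by rewrite memv_cap memv_ker lfunE => /andP[-> /eqP].
have ltU : (\dim U' < m)%N.
  rewrite -ltnS; apply: leq_trans le_m; rewrite ltnS ltn_neqAle dimvS ?capvSl // andbT.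
  apply/negP => /eqP e; have /eqP eU : U' == U by rewrite eqEdim capvSl e leqnn.
  have := uU; rewrite -eU => /U'P[_ /eqP]; rewrite quu oner_eq0.
  by [].
have [s [sU' sP]] := IH _ ltU.
exists (u :: s); split=> [v|v vU].
  by rewrite inE => /predU1P[-> //|/sU'/U'P[]].
rewrite big_cons; pose v' := v - q v u *: u.
have v'U : v' \in U'.
  rewrite memv_cap; apply/andP; split; first by rewrite /v'; apply: memvB => //; apply: memvZ.
  rewrite memv_ker lfunE /=; apply/eqP.
  rewrite /v' -scaleNr addrC -[LHS]/(q (_ + _) u : C^o) (q_linear u).
  by rewrite quu -[_ *: _]/(_ * _) mulr1 addNr.
rewrite -[LHS](subrK (q v u *: u)) addrC; congr (_ + _).
rewrite -/v' (sP _ v'U); apply: eq_big_seq => e /sU'/U'P[eU qe]; congr (_ *: _).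
rewrite /v' -scaleNr addrC -[LHS]/(q (_ + _) e : C^o) (q_linear e).
by rewrite (q_conj e u) qe conjC0 scaler0 add0r.
Qed.

(** The sequence is continued by zeros, so that every n from N on works. In [lact_frames] this gives
    all the Hom spaces frames of one common length, hence a non-dependent index type. *)
Lemma parseval_frame : exists N (e : nat -> V), forall n, (N <= n)%N ->
  forall v, v = \sum_(i < n) q v (e i) *: e i.
Proof.
have [s [_ sP]] := orthonormal_seq fullv.
exists (size s), (fun i => s`_i) => n le_n v.
rewrite -(big_mkord xpredT (fun i => q v s`_i *: s`_i)).
rewrite (big_cat_nat (n := size s)) //= [X in _ + X]big_nat_cond [X in _ + X]big1 ?addr0.
  by rewrite {1}(sP v (memvf v)) (big_nth 0).
by move=> i /andP[/andP[le_i _] _]; rewrite nth_default ?scaler0.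
Qed.

End Parseval.

(** * Inner products pulled back along frame coordinates *)

Section Frame.
Variables (C : numClosedFieldType) (V : lmodType C) (I : finType).
Variables (phi : I -> V -> C) (e : I -> V).
Hypothesis phi_lin : forall k, linear (phi k : V -> C^o).
Hypothesis frame : forall v, v = \sum_k phi k v *: e k.

Definition frame_ip (v w : V) : C := \sum_k phi k v * (phi k w)^*.

Lemma frame_ip_lin w : linear (fun v => frame_ip v w : C^o).
Proof. by apply: lin_bigsum => k; apply: lin_mulr. Qed.

Lemma frame_ip_conj v w : frame_ip w v = (frame_ip v w)^*.
Proof.
rewrite /frame_ip rmorph_sum; apply: eq_bigr => k _.
by rewrite rmorphM /= conjCK mulrC.
Qed.

Lemma frame_ip_alin v : antilinear (fun w => frame_ip v w : C^o).
Proof.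
move=> c u w; rewrite 3![frame_ip v _]frame_ip_conj.
have -> : frame_ip (c *: u + w) v = c * frame_ip u v + frame_ip w v.
  exact: (frame_ip_lin v c u w).
by rewrite rmorphD rmorphM.
Qed.

Lemma frame_ipE v : frame_ip v v = \sum_k `|phi k v| ^+ 2.
Proof. by apply: eq_bigr => k _; rewrite normCK. Qed.

Lemma frame_ip_ge0 v : 0 <= frame_ip v v.
Proof. by rewrite frame_ipE sumr_ge0 // => k _; rewrite exprn_ge0. Qed.

Lemma frame_ip_eq0 v : frame_ip v v = 0 -> v = 0.
Proof.
rewrite frame_ipE => /psumr_eq0P e0.
rewrite (frame v) big1 // => k _.
have /eqP : `|phi k v| ^+ 2 = 0 by apply: e0 => // l _; rewrite exprn_ge0.
by rewrite expf_eq0 normr_eq0 => /= /eqP ->; rewrite scale0r.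
Qed.

Lemma frame_ip_dual (psi : V -> C) w : linear (psi : V -> C^o) ->
  (forall k, (phi k w)^* = psi (e k)) -> forall v, frame_ip v w = psi v.
Proof.
move=> pL pE v; rewrite [in RHS](frame v) (lin_sum pL); apply: eq_bigr => k _.
by rewrite (linZ pL) pE.
Qed.

End Frame.

(** * The weighted inner product on the tube space *)

Section TubeHilbert.
Variables (C : numClosedFieldType) (D : umfc C) (M : left_module D).
Implicit Types (d e f g x y : Irr M).

Let MP := left_module_action M.
Local Notation T := (left_tube M).

Lemma hom_frame (X : ucat C) k (x : X) : exists N (E : nat -> hom (simp k) x),
  forall n, (N <= n)%N -> forall v, v = \sum_(i < n) co ((E i)† ∘ v) *: E i.
Proof.
apply: (parseval_frame (q := fun v w : hom (simp k) x => co (w† ∘ v))).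
- move=> w; apply: (lin_fun (@co_linear _ _ _ _)).
  exact: lin_compr _ (@lin_id _ _).
- by move=> v w; rewrite -co_dag dagM dagKK.
- exact: co_ge0.
- exact: co_eq0.
Qed.

Lemma lact_frames : exists N
  (E : forall (a : Irr D) d e, nat -> hom (simp d) (simp a ⊳ simp e)),
  forall a d e v, v = \sum_(i < N) co ((E a d e i)† ∘ v) *: E a d e i.
Proof.
have F (s : Irr D * Irr M * Irr M) : exists NE :
    nat * (nat -> hom (simp s.1.2) (simp s.1.1 ⊳ simp s.2)),
  forall n, (NE.1 <= n)%N -> forall v,
    v = \sum_(i < n) co ((NE.2 i)† ∘ v) *: NE.2 i.
  by have [N [E EP]] := hom_frame s.1.2 (simp s.1.1 ⊳ simp s.2); exists (N, E).
have [G GP] := fin_all_exists F.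
exists (\max_s (G s).1), (fun a d e => (G (a, d, e)).2) => a d e v.
exact: (GP (a, d, e) _ (leq_bigmax (F := fun s => (G s).1) (a, d, e))).
Qed.

(* The value on the zero object is irrelevant; 1 keeps the weights positive. *)
Definition lfdim (a : Irr D) e : C :=
  if idm (simp a ⊳ simp e) == 0 then 1 else ltr (idm (simp a ⊳ simp e)).

Lemma lfdim_gt0 a e : 0 < lfdim a e.
Proof. by rewrite /lfdim; case: eqVneq => // n; apply: ltr_id_gt0. Qed.

Definition tlabel : finType := (Irr D * Irr M * Irr M * Irr M * Irr M)%type.

(* The dependence on [g] and [a] makes left multiplication by [ltstar x] adjoint to
   left multiplication by [x]; a factor depending only on [e] and [f] is arbitrary,
   and using tr(id_(a e)) for the dimension of [a] amounts to choosing 1 / d_e. *)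
Definition tweight (a : Irr D) d e f g : C := ldim g / lfdim a e.

Lemma tweight_gt0 a d e f g : 0 < tweight a d e f g.
Proof. by rewrite divr_gt0 ?ldim_gt0 ?lfdim_gt0. Qed.

(** The unweighted inner product with n0 (x) z0, which vanishes across different labels because of
    the [dlt] factors. *)
Definition tform (a0 : Irr D) d0 e0 f0 g0
    (n0 : hom (simp d0) (simp a0 ⊳ simp e0))
    (z0 : hom (simp a0 ⊳ simp f0) (simp g0)) (t : T) : C :=
  tube_lift (U := C^o) (fun a d e f g n z =>
    co (n0† ∘ (dlt a a0 ⊳m dlt e e0) ∘ n) *
    co (z ∘ (dlt a0 a ⊳m dlt f0 f) ∘ z0†)) t.

Lemma tform_lin (a0 : Irr D) d0 e0 f0 g0
    (n0 : hom (simp d0) (simp a0 ⊳ simp e0))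
    (z0 : hom (simp a0 ⊳ simp f0) (simp g0)) : linear (tform n0 z0 : T -> C^o).
Proof. exact: tube_lift_lin. Qed.

Lemma tformE (a0 : Irr D) d0 e0 f0 g0
    (n0 : hom (simp d0) (simp a0 ⊳ simp e0))
    (z0 : hom (simp a0 ⊳ simp f0) (simp g0))
    (a : Irr D) d e f g (n : hom (simp d) (simp a ⊳ simp e))
    (z : hom (simp a ⊳ simp f) (simp g)) :
  tform n0 z0 (ltube_elt n z) =
  co (n0† ∘ (dlt a a0 ⊳m dlt e e0) ∘ n) * co (z ∘ (dlt a0 a ⊳m dlt f0 f) ∘ z0†).
Proof. by rewrite /tform tube_liftE //; lin2. Qed.

Lemma tform_same (a : Irr D) d e f g
    (n0 : hom (simp d) (simp a ⊳ simp e)) (z0 : hom (simp a ⊳ simp f) (simp g))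
    (n : hom (simp d) (simp a ⊳ simp e)) (z : hom (simp a ⊳ simp f) (simp g)) :
  tform n0 z0 (ltube_elt n z) = co (n0† ∘ n) * co (z ∘ z0†).
Proof. by rewrite tformE !dltE !(act1 MP) !comp1r. Qed.

Lemma tform_neq (a0 : Irr D) d0 e0 f0 g0
    (n0 : hom (simp d0) (simp a0 ⊳ simp e0))
    (z0 : hom (simp a0 ⊳ simp f0) (simp g0))
    (a : Irr D) d e f g (n : hom (simp d) (simp a ⊳ simp e))
    (z : hom (simp a ⊳ simp f) (simp g)) :
  (a0, d0, e0, f0, g0) != (a, d, e, f, g) -> tform n0 z0 (ltube_elt n z) = 0.
Proof.
rewrite !xpair_eqE !negb_and -!orbA tformE => /or4P[h|h|h|/orP[h|h]].
- rewrite (dlt_neq (k := a)) 1?eq_sym // (lin0 (lin_lactl _ (@lin_id _ _))).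
  by rewrite comp0r comp0l co0 mul0r.
- by rewrite co_neq ?mul0r // eq_sym.
- rewrite (dlt_neq (k := e)) 1?eq_sym // (lin0 (lin_lactr _ (@lin_id _ _))).
  by rewrite comp0r comp0l co0 mul0r.
- rewrite (dlt_neq (k := f0)) // (lin0 (lin_lactr _ (@lin_id _ _))).
  by rewrite comp0r comp0l co0 mulr0.
by rewrite [X in _ * X]co_neq ?mulr0.
Qed.

Lemma tform_herm (a0 : Irr D) d0 e0 f0 g0
    (n0 : hom (simp d0) (simp a0 ⊳ simp e0))
    (z0 : hom (simp a0 ⊳ simp f0) (simp g0))
    (a : Irr D) d e f g (n : hom (simp d) (simp a ⊳ simp e))
    (z : hom (simp a ⊳ simp f) (simp g)) :
  (tform n0 z0 (ltube_elt n z))^* = tform n z (ltube_elt n0 z0).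
Proof.
rewrite !tformE rmorphM /= -!co_dag !dagM !dagKK !(act_dag MP) !dlt_dag !compA.
by [].
Qed.

Lemma tform_bracket (A : D) (a0 : Irr D) d0 e0 f0 g0
    (n0 : hom (simp d0) (simp a0 ⊳ simp e0))
    (z0 : hom (simp a0 ⊳ simp f0) (simp g0))
    d e f g (n : hom (simp d) (A ⊳ simp e)) (z : hom (A ⊳ simp f) (simp g)) :
  tform n0 z0 (lbracket n z) = \sum_(p < mult a0 A)
    co (n0† ∘ (prj a0 A p ⊳m dlt e e0) ∘ n) *
    co (z ∘ (inc a0 A p ⊳m dlt f0 f) ∘ z0†).
Proof.
rewrite lbracketE (bsum_lin _ (@tform_lin _ _ _ _ _ n0 z0)) /bsum.
rewrite (bigD1 a0) //= [X in _ + X]big1 ?addr0 => [|k n_k].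
  apply: eq_bigr => p _; rewrite tformE dltE; congr GRing.mul; congr co.
    by rewrite -!compA; congr (_ ∘ _); rewrite compA -(actM MP) comp1l comp1r.
  by rewrite -!compA; congr (_ ∘ _); rewrite compA -(actM MP) comp1l comp1r.
apply: big1 => p _; apply: tform_neq; rewrite !xpair_eqE.
by rewrite eq_sym (negPf n_k).
Qed.

Lemma tform_bracket_neq (A : D) (a0 : Irr D) d0 e0 f0 g0
    (n0 : hom (simp d0) (simp a0 ⊳ simp e0))
    (z0 : hom (simp a0 ⊳ simp f0) (simp g0))
    d e f g (n : hom (simp d) (A ⊳ simp e)) (z : hom (A ⊳ simp f) (simp g)) :
  ~~ [&& d == d0, e == e0, f == f0 & g == g0] -> tform n0 z0 (lbracket n z) = 0.
Proof.
move=> ne; rewrite lbracketE (bsum_lin _ (@tform_lin _ _ _ _ _ n0 z0)).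
apply: big1 => k _; apply: big1 => p _; apply: tform_neq.
apply: contra ne => /eqP[_ -> -> -> ->].
by rewrite !eqxx.
Qed.

Variables (N : nat)
  (E : forall (a : Irr D) d e, nat -> hom (simp d) (simp a ⊳ simp e)).
Hypothesis EP : forall a d e v,
  v = \sum_(i < N) co ((E a d e i)† ∘ v) *: E a d e i.

Lemma frame_dag a f g (z : hom (simp a ⊳ simp f) (simp g)) :
  z = \sum_(i < N) co (z ∘ E a g f i) *: (E a g f i)†.
Proof.
rewrite -[LHS]dagKK (EP z†) dagS; apply: eq_bigr => i _.
by rewrite dagZ -co_dag dagM !dagKK.
Qed.

Definition tindex : finType := (tlabel * 'I_N * 'I_N)%type.

(** The square root of the weight is placed so that [tcoord k t] is the weighted inner product of t
    with [tvec k], which makes the vectors [tvec k] a Parseval frame. *)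
Definition tcoord (k : tindex) (t : T) : C :=
  let: (a, d, e, f, g, i, j) := k in
  sqrtC (tweight a d e f g) * tform (E a d e i) (E a g f j)† t.

Definition tvec (k : tindex) : T :=
  let: (a, d, e, f, g, i, j) := k in
  (sqrtC (tweight a d e f g))^-1 *: ltube_elt (E a d e i) (E a g f j)†.

Lemma tcoord_lin k : linear (tcoord k : T -> C^o).
Proof.
move: k => [[[[[[a d] e] f] g] i] j]; apply: lin_mull.
exact: tform_lin.
Qed.

Lemma sqrt_tweight_neq0 a d e f g : sqrtC (tweight a d e f g) != 0.
Proof. by rewrite sqrtC_eq0 gt_eqF ?tweight_gt0. Qed.

Lemma tcoord_vec (t : T) : t = \sum_k tcoord k t *: tvec k.
Proof.
have L : linear (fun t : T => \sum_k tcoord k t *: tvec k).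
  by apply: lin_bigsum => k; apply: lin_scalel; apply: tcoord_lin.
move: t; apply: tube_ext => // a d e f g n z.
rewrite -[tube_elt n z]/(ltube_elt n z).
transitivity (\sum_(s : tlabel) \sum_(i < N) \sum_(j < N)
  tcoord (s, i, j) (ltube_elt n z) *: tvec (s, i, j)); last first.
  by rewrite !pair_bigA /=; apply: eq_bigr => -[[s i] j].
rewrite (bigD1 (a, d, e, f, g)) //= [X in _ + X]big1 ?addr0; last first.
  move=> [[[[a0 d0] e0] f0] g0] ne; apply: big1 => i _; apply: big1 => j _.
  by rewrite /tcoord tform_neq // mulr0 scale0r.
rewrite {1}(EP n) {1}(frame_dag z) (lin_sum ((ltube_elt_lin2 _ _ _ _ _).2 _)).
apply: eq_bigr => i _; rewrite (linZ ((ltube_elt_lin2 _ _ _ _ _).2 _)).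
rewrite (lin_sum ((ltube_elt_lin2 _ _ _ _ _).1 _)) scaler_sumr.
apply: eq_bigr => j _; rewrite (linZ ((ltube_elt_lin2 _ _ _ _ _).1 _)) !scalerA.
rewrite tform_same dagKK; congr (_ *: _).
by rewrite mulrAC mulfV ?mul1r // sqrt_tweight_neq0.
Qed.

(** The frame is only a device: in this form the inner product no longer depends on it, so that
    [adjoint_core] can work with morphisms alone. *)
Lemma tip_elt (a : Irr D) d e f g (n : hom (simp d) (simp a ⊳ simp e))
    (z : hom (simp a ⊳ simp f) (simp g)) t :
  frame_ip tcoord t (ltube_elt n z) = tweight a d e f g * tform n z t.
Proof.
apply: (frame_ip_dual tcoord_vec (psi := fun t => tweight a d e f g * tform n z t)).
  by apply: lin_mull; apply: tform_lin.
move=> [[[[[[a0 d0] e0] f0] g0] i] j]; rewrite /tcoord /tvec.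
rewrite (linZ (tform_lin n z)) rmorphM /= tform_herm.
rewrite (geC0_conj (x := sqrtC _)) ?sqrtC_ge0 ?ltW ?tweight_gt0 //.
have [eq|ne] := eqVneq (a, d, e, f, g) (a0, d0, e0, f0, g0); last first.
  by rewrite tform_neq // scaler0 !mulr0.
case: eq => ? ? ? ? ?; subst a0 d0 e0 f0 g0.
rewrite -[_ *: _]/(_ * _) mulrA; congr (_ * _).
by rewrite -{2}(sqrtCK (tweight _ _ _ _ _)) expr2 mulfK ?sqrt_tweight_neq0.
Qed.

End TubeHilbert.

(** * The star as the adjoint of left multiplication *)

Section Adjoint.
Variables (C : numClosedFieldType) (D : umfc C) (M : left_module D).
Implicit Types (d e f g x y : Irr M).

Let MP := left_module_action M.
Let RP := regular_action D.
Local Notation T := (left_tube M).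

(** Typed over D instead of its regular module, so that the result can act on objects of M; likewise
    [dsharp]. *)
Definition dflat (a x b : D) (u : hom (a ⊗ x) b) : hom x (dual a ⊗ b) :=
  @flat C D (regular_module D) a x b u.

Definition dsharp (a x b : D) (u : hom b (a ⊗ x)) : hom (dual a ⊗ b) x :=
  @sharp C D (regular_module D) a x b u.

Lemma flat_regular (a x b : D) (m : M) (u : hom (a ⊗ x) b) :
  lassoc (dual a) b m ∘
    (dflat u ⊳m idm m) =
  flat ((u ⊳m idm m) ∘ (lassoc a x m)†).
Proof.
rewrite /dflat /flat (actMr MP) (lcup_regular MP) -!compA.
rewrite (precomp (act_assoc MP _ _ _)) (precompK (assocVK MP _ _ _)).
by rewrite (actMl MP) compA.
Qed.

Lemma sharp_regular (a x b : D) (m : M) (u : hom b (a ⊗ x)) :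
  (dsharp u ⊳m idm m) ∘ (lassoc (dual a) b m)† =
  sharp (lassoc a x m ∘ (u ⊳m idm m)).
Proof.
apply: (can_inj (@dagKK _ _ _ _)).
rewrite (sharp_dag MP) dagM dagKK (act_dag MP) dag1 dagM (act_dag MP) dag1.
rewrite -flat_regular; congr (_ ∘ (_ ⊳m _)).
exact: (sharp_dag RP).
Qed.

(** After [flat_regular] has moved the bending of p from D to M, the composite on the left is a
    [sharp] following a [flat], that is, the partial trace over a of n h. *)
Lemma bend_left (a a' a'' : Irr D) d e e'
    (n : hom (simp d) (simp a ⊳ simp e)) (n' : hom (simp e) (simp a' ⊳ simp e'))
    (n'' : hom (simp d) (simp a'' ⊳ simp e'))
    (p : hom (simp a ⊗ simp a') (simp a'')) :
  ldim e * co (sharp n ∘ (idm (dual (simp a)) ⊳m n''†) ∘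
    lassoc (dual (simp a)) (simp a'') (simp e') ∘
    (dflat p ⊳m idm _) ∘ n') =
  ldim d * co (n''† ∘ (p ⊳m idm _) ∘ (lassoc (simp a) (simp a') (simp e'))† ∘
     (idm (simp a) ⊳m n') ∘ n).
Proof.
set h := n''† ∘ (p ⊳m idm _) ∘ (lassoc (simp a) (simp a') (simp e'))† ∘
     (idm (simp a) ⊳m n').
have -> : sharp n ∘ (idm (dual (simp a)) ⊳m n''†) ∘
    lassoc (dual (simp a)) (simp a'') (simp e') ∘
    (dflat p ⊳m idm _) ∘ n' =
    lptr (n ∘ h).
  rewrite -compA -compA (compA (lassoc _ _ _)) flat_regular (flat_comp MP).
  by rewrite -[X in X = _]compA (comp_flat MP) (sharp_flat MP) /lptr /h !compA.
have := module_bend_trace n h.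
move/(congr1 (@co _ _ _ _)); rewrite !coZ co_id mulr1.
by [].
Qed.

Lemma bend_right (a a' a'' : Irr D) f g f'
    (z : hom (simp a ⊳ simp f) (simp g)) (z' : hom (simp a' ⊳ simp f') (simp f))
    (z'' : hom (simp a'' ⊳ simp f') (simp g))
    (p : hom (simp a'') (simp a ⊗ simp a')) :
  ldim f * co (z' ∘ (dsharp p ⊳m idm _) ∘
     (lassoc (dual (simp a)) (simp a'') (simp f'))† ∘
     (idm (dual (simp a)) ⊳m z''†) ∘ flat z) =
  ldim g * co (z ∘ (idm (simp a) ⊳m z') ∘ lassoc (simp a) (simp a') (simp f') ∘
     (p ⊳m idm _) ∘ z''†).
Proof.
set s := (idm (simp a) ⊳m z') ∘ lassoc (simp a) (simp a') (simp f') ∘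
     (p ⊳m idm _) ∘ z''†.
have -> : z' ∘ (dsharp p ⊳m idm _) ∘
     (lassoc (dual (simp a)) (simp a'') (simp f'))† ∘
     (idm (dual (simp a)) ⊳m z''†) ∘ flat z = lptr (s ∘ z).
  rewrite -[z' ∘ _ ∘ _]compA sharp_regular (comp_sharp MP) (sharp_comp MP).
  by rewrite (sharp_flat MP) /lptr /s !compA.
have := module_bend_trace s z.
move/(congr1 (@co _ _ _ _)); rewrite !coZ co_id mulr1 => ->.
by rewrite /s !compA.
Qed.

Lemma conj_ldim (k : Irr M) : (ldim k)^* = ldim k.
Proof. by rewrite geC0_conj // ltW ?ldim_gt0. Qed.

(** The sum over a basis of Hom(a', ā a'') on the right is bent in D to a sum over Hom(a'', a a'),
    with factor k' / k''; [bend_left] and [bend_right] then contribute d_d / d_e and d_g / d_f.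
    Together with the star's d_e / d_d and the weight d_f / k' this gives d_g / k'', the weight on
    the left. *)
Lemma adjoint_core (a a' a'' : Irr D) d e f g e' f'
    (n : hom (simp d) (simp a ⊳ simp e)) (z : hom (simp a ⊳ simp f) (simp g))
    (n' : hom (simp e) (simp a' ⊳ simp e')) (z' : hom (simp a' ⊳ simp f') (simp f))
    (n'' : hom (simp d) (simp a'' ⊳ simp e'))
    (z'' : hom (simp a'' ⊳ simp f') (simp g)) :
  tweight a'' d e' f' g * tform n'' z'' (lprod n z n' z') =
  (tweight a' e e' f' f *
    (ldim e / ldim d * tform n' z' (lprod (flat n†) (sharp z†) n'' z'')))^*.
Proof.
rewrite /lprod !tform_bracket !dltE !comp1r !comp1l /tweight.
(* If a' e' or a'' e' is zero, [lfdim] takes its default value, but then n' or n'' is zero and both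
   sides vanish. *)
have [a'0|a'N] := eqVneq (idm (simp a' ⊳ simp e')) 0.
  rewrite (id_lact0 n' a'0) (lin0 (lin_lactr _ (@lin_id _ _))) dag0.
  rewrite !big1 ?mulr0 ?conjC0 // => p _; first by rewrite !comp0l co0 mul0r.
  by rewrite comp0r comp0l comp0r co0 mul0r.
have [a''0|a''N] := eqVneq (idm (simp a'' ⊳ simp e')) 0.
  rewrite (id_lact0 n'' a''0) (lin0 (lin_lactr _ (@lin_id _ _))) dag0.
  rewrite !big1 ?mulr0 ?conjC0 // => p _; last by rewrite !comp0l co0 mul0r.
  by rewrite comp0r comp0l comp0r co0 mul0r.
rewrite /lfdim (negPf a'N) (negPf a''N).
set k' := ltr (idm (simp a' ⊳ simp e')); set k'' := ltr (idm (simp a'' ⊳ simp e')).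
have k'_gt0 : 0 < k' by apply: ltr_id_gt0.
have k''_gt0 : 0 < k'' by apply: ltr_id_gt0.
pose B (u : hom (simp a') (dual (simp a) ⊗ simp a'')) v : C^o :=
  co (sharp n ∘ (idm (dual (simp a)) ⊳m n''†) ∘
    lassoc (dual (simp a)) (simp a'') (simp e') ∘ (u ⊳m idm _) ∘ n') *
  co (z' ∘ (v ⊳m idm _) ∘ (lassoc (dual (simp a)) (simp a'') (simp f'))† ∘
     (idm (dual (simp a)) ⊳m z''†) ∘ flat z).
have bB : bilinear2 B by rewrite /B; lin2.
(* Conjugation turns each composite into its dagger, so the dual bases on the right appear as
   daggers until [sum_dag] removes them. *)
transitivity (ldim f / k' * (ldim e / ldim d *
    \sum_(q < mult a' (dual (simp a) ⊗ simp a'')) B (prj a' _ q)† (inc a' _ q)†)); last first.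
  rewrite !rmorphM !fmorphV /= !conj_ldim (geC0_conj (ltW k'_gt0)) rmorph_sum.
  congr (_ * (_ * _)); apply: eq_bigr => q _.
  rewrite rmorphM /= -!co_dag !dagM !dagKK !(act_dag MP) !dag1 !dagKK.
  by rewrite /B /sharp /flat /lcap /lcup !compA.
rewrite (sum_dag bB).
have := bsum_bend RP (a := simp a) (i := a') (j := a'') (ki := k') (kj := k'') bB.
rewrite !gt_eqF // => /(_ isT isT) bend.
have {bend} <- := bend (fun s h => regular_bend_trace (simp e') s h).
rewrite !mulr_sumr; apply: eq_bigr => p _.
rewrite -[_ *: _]/(_ * _) -[flat _]/(dflat _) -[sharp _]/(dsharp _) /B.
have := bend_left n n' n'' (prj a'' (simp a ⊗ simp a') p).
have := bend_right z z' z'' (inc a'' (simp a ⊗ simp a') p).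
rewrite -!compA.
set Y := co _; set X := co _; set Y' := co _; set X' := co _.
move=> eX eX'.
have -> : X = ldim f * Y / ldim g by rewrite eX mulrAC mulfV ?mul1r ?ldim_neq0.
have -> : X' = ldim e * Y' / ldim d by rewrite eX' mulrAC mulfV ?mul1r ?ldim_neq0.
field.
by rewrite !ldim_neq0 !gt_eqF.
Qed.

Section Weights.
Variables (N : nat)
  (E : forall (a : Irr D) d e, nat -> hom (simp d) (simp a ⊳ simp e)).
Hypothesis EP : forall a d e v,
  v = \sum_(i < N) co ((E a d e i)† ∘ v) *: E a d e i.
Local Notation ip := (frame_ip (tcoord E (N := N))).

Lemma ltmul_adjoint (s t r : T) : ip (ltmul s t) r = ip t (ltmul (ltstar s) r).
Proof.
pose ipl := frame_ip_lin (@tcoord_lin _ _ _ N E).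
pose ipa := frame_ip_alin (@tcoord_lin _ _ _ N E).
move: s; apply: (ltube_ext (U := C^o)).
- by apply: (lin_fun (ipl r)); tlin.
- apply: (alin_alin (ipa t)); apply: (alin_fun (f := fun u => ltmul u r)); first by tlin.
  exact: ltstar_alin.
move=> a d e f g n z.
move: t; apply: (ltube_ext (U := C^o)).
- by apply: (lin_fun (ipl r)); tlin.
- exact: ipl.
move=> a' d' e' f' g' n' z'.
move: r; apply: (ltube_aext (U := C^o)).
- exact: ipa.
- by apply: (alin_lin (ipa _)); tlin.
move=> a'' d'' e'' f'' g'' n'' z''.
rewrite ltstarE (linZ (lin_ltmull _ (@lin_id _ _))) !ltmul_bracket.
rewrite [RHS](frame_ip_conj (tcoord E (N := N))).
rewrite [X in ip _ X = _]lbracket_simple [X in _ = (ip _ X)^*]lbracket_simple.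
rewrite !(tip_elt EP) (linZ (tform_lin _ _)) -[_ *: _]/(_ * _).
(* Unless all labels match, both sides vanish: a mismatch on one side makes the product zero, and on
   the other side makes the inner product zero. *)
have [ed|ne] := eqVneq e d'; last first.
  rewrite lprod_neq ?(negPf ne) ?andbF // tform_bracket_neq ?(negPf ne) //.
  by rewrite (lin0 (tform_lin _ _)) !mulr0 conjC0.
have [fg|ne] := eqVneq f g'; last first.
  rewrite lprod_neq ?(negPf ne) // tform_bracket_neq ?(negPf ne) ?andbF //.
  by rewrite (lin0 (tform_lin _ _)) !mulr0 conjC0.
have [dd|ne] := eqVneq d d''; last first.
  rewrite tform_bracket_neq ?(negPf ne) // lprod_neq ?(negPf ne) ?andbF //.
  by rewrite (lin0 (tform_lin _ _)) !mulr0 conjC0.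
have [gg|ne] := eqVneq g g''; last first.
  rewrite tform_bracket_neq ?(negPf ne) ?andbF // lprod_neq ?(negPf ne) //.
  by rewrite (lin0 (tform_lin _ _)) !mulr0 conjC0.
have [ee|ne] := eqVneq e' e''; last first.
  rewrite tform_bracket_neq ?(negPf ne) ?andbF //.
  by rewrite tform_bracket_neq 1?[e'' == _]eq_sym ?(negPf ne) ?andbF // !mulr0 conjC0.
have [ff|ne] := eqVneq f' f''; last first.
  rewrite tform_bracket_neq ?(negPf ne) ?andbF //.
  by rewrite tform_bracket_neq 1?[f'' == _]eq_sym ?(negPf ne) ?andbF // !mulr0 conjC0.
subst d' g' d'' g'' e'' f''.
exact: adjoint_core.
Qed.

Lemma ltstar_adjoint (s t r : T) : ip (ltmul (ltstar s) t) r = ip t (ltmul s r).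
Proof.
rewrite (frame_ip_conj _ r) -ltmul_adjoint.
by rewrite -(frame_ip_conj _ _ t).
Qed.

(** Left multiplication is tested on u = 1, paired with v = s - t. *)
Lemma ltmul_nondeg (s t : T) :
  (forall u v, ip (ltmul s u) v = ip (ltmul t u) v) -> s = t.
Proof.
move=> st; apply/eqP; rewrite -subr_eq0; apply/eqP.
apply: (frame_ip_eq0 (tcoord_vec EP)); set w := s - t.
have -> : ip w w = ip s w - ip t w.
  rewrite {1}/w -scaleN1r [LHS](linD (frame_ip_lin (@tcoord_lin _ _ _ N E) w)).
  by rewrite (linZ (frame_ip_lin (@tcoord_lin _ _ _ N E) w)) scaleN1r.
by apply/eqP; rewrite subr_eq0 -(ltmul1r s) -{1}(ltmul1r t) st.
Qed.

End Weights.

Lemma ltstarK (s : T) : ltstar (ltstar s) = s.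
Proof.
have [N [E EP]] := lact_frames M.
apply: (ltmul_nondeg EP) => u v.
exact: etrans (ltstar_adjoint EP (ltstar s) u v) (esym (ltmul_adjoint EP s u v)).
Qed.

Lemma ltstarM (s t : T) : ltstar (ltmul s t) = ltmul (ltstar t) (ltstar s).
Proof.
have [N [E EP]] := lact_frames M.
apply: (ltmul_nondeg EP) => u v; apply: etrans (ltstar_adjoint EP _ u v) _.
rewrite -(ltmulA s) -(ltmulA (ltstar t)).
exact: esym (etrans (ltstar_adjoint EP t _ v) (ltstar_adjoint EP s u _)).
Qed.

End Adjoint.

(** * Completeness *)

Section Complete.
Variable R : realType.

(** The limit is found as the lower limit: S consists of the reals that eventually bound the
    sequence from below. *)
Lemma real_cauchy_cvg (u : nat -> R) :
  (forall eps, 0 < eps -> exists N, forall m n, (N <= m)%N -> (N <= n)%N ->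
     `|u m - u n| < eps) ->
  exists l, forall eps, 0 < eps -> exists N, forall n, (N <= n)%N -> `|u n - l| < eps.
Proof.
move=> uC; pose S : set R := fun x => exists N, forall n, (N <= n)%N -> x <= u n.
have ubS eps N : (forall m n, (N <= m)%N -> (N <= n)%N -> `|u m - u n| < eps) ->
    ubound S (u N + eps).
  move=> uN x [K xK]; apply: le_trans (xK (maxn K N) (leq_maxl _ _)) _.
  have := uN (maxn K N) N (leq_maxr _ _) (leqnn _).
  by rewrite ltr_norml => /andP[_]; rewrite ltrBlDl => /ltW.
have SN eps N : (forall m n, (N <= m)%N -> (N <= n)%N -> `|u m - u n| < eps) ->
    S (u N - eps).
  move=> uN; exists N => n le_n; have := uN N n (leqnn _) le_n.
  by rewrite ltr_norml => /andP[_]; rewrite ltrBlDr -ltrBlDl => /ltW.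
exists (sup S) => eps eps0; have e2 : 0 < eps / 2 by rewrite divr_gt0.
have [N uN] := uC _ e2.
have uS : has_ubound S by exists (u N + eps / 2); apply: ubS.
exists N => n le_n.
have un m p : (n <= m)%N -> (n <= p)%N -> `|u m - u p| < eps / 2.
  by move=> nm np; apply: uN; apply: leq_trans le_n _.
have lo : u n - eps / 2 <= sup S by apply: ub_le_sup => //; apply: SN.
have hi : sup S <= u n + eps / 2.
  by apply: ge_sup; [exists (u n - eps / 2); apply: SN | apply: ubS].
by rewrite ltr_norml; apply/andP; split; lra.
Qed.

Lemma complex_cauchy_cvg (z : nat -> R[i]) :
  (forall eps : R[i], 0 < eps -> exists N, forall m n, (N <= m)%N -> (N <= n)%N ->
     `|z m - z n| < eps) ->
  exists l, forall eps : R[i], 0 < eps ->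
    exists N, forall n, (N <= n)%N -> `|z n - l| < eps.
Proof.
move=> zC.
have Cre (eps : R[i]) : 0 < eps -> exists2 e : R, 0 < e & eps = real_complex R e.
  case: eps => a b; rewrite ltcE /= => /andP[/eqP -> a0].
  by exists a.
have part (x : R[i]) : `|complex.Re x| <= Num.sqrt (complex.Re x ^+ 2 + complex.Im x ^+ 2) /\
    `|complex.Im x| <= Num.sqrt (complex.Re x ^+ 2 + complex.Im x ^+ 2).
  by rewrite -!sqrtr_sqr !ler_wsqrtr ?lerDl ?lerDr ?sqr_ge0.
have [|a aP] := @real_cauchy_cvg (fun n => complex.Re (z n)).
  move=> e e0; have e0' : 0 < real_complex R e by rewrite ltcR.
  have [N zN] := zC _ e0'; exists N => m n mN nN.
  have := zN m n mN nN; rewrite normc_def ltcR; apply: le_lt_trans.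
  have [+ _] := part (z m - z n).
  by case: (z m) (z n) => [? ?] [? ?].
have [|b bP] := @real_cauchy_cvg (fun n => complex.Im (z n)).
  move=> e e0; have e0' : 0 < real_complex R e by rewrite ltcR.
  have [N zN] := zC _ e0'; exists N => m n mN nN.
  have := zN m n mN nN; rewrite normc_def ltcR; apply: le_lt_trans.
  have [_ +] := part (z m - z n).
  by case: (z m) (z n) => [? ?] [? ?].
exists (Complex a b) => eps /Cre[e e0 ->].
have e2 : 0 < e / 2 by rewrite divr_gt0.
have [N aN] := aP _ e2; have [K bK] := bP _ e2.
exists (maxn N K) => n; rewrite geq_max => /andP[nN nK].
have := aN n nN; have := bK n nK; rewrite normc_def ltcR.
case: (z n) => x y /= yb xa.
apply: (@le_lt_trans _ _ (`|x - a| + `|y - b|)); last by lra.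
rewrite -[leRHS]ger0_norm ?addr_ge0 // -sqrtr_sqr ler_wsqrtr //.
rewrite -[(x - a) ^+ 2]real_normK ?num_real // -[(y - b) ^+ 2]real_normK ?num_real //.
by rewrite sqrrD -addrA lerD2l -subr_ge0 addrK mulrn_wge0 // mulr_ge0.
Qed.

End Complete.

(** * Boundedness and completeness from a finite frame *)

Section FrameHilbert.
Variables (R : realType) (V : lmodType R[i]) (I : finType).
Variables (phi : I -> V -> R[i]) (e : I -> V).
Hypothesis phi_lin : forall k, linear (phi k : V -> R[i]^o).
Hypothesis frame : forall v, v = \sum_k phi k v *: e k.

Let ip := frame_ip phi.
Let bound (F : V -> V) := \sum_k (\sum_j `|phi k (F (e j))|) ^+ 2.

(** The a j are arbitrary coefficients, not the coordinates of the vector, because the e j may be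
    dependent. Completeness needs this freedom: the limits of coordinates are not known beforehand
    to be coordinates of a vector. *)
Lemma frame_ip_bound (F : V -> V) (a : I -> R[i]) s : linear F -> 0 <= s ->
  (forall j, `|a j| <= s) ->
  ip (F (\sum_j a j *: e j)) (F (\sum_j a j *: e j)) <= s ^+ 2 * bound F.
Proof.
move=> FL s0 aS; rewrite /ip frame_ipE mulr_sumr; apply: ler_sum => k _.
rewrite -exprMn lerXn2r ?nnegrE ?normr_ge0 //.
  by rewrite mulr_ge0 // sumr_ge0.
rewrite (lin_sum FL) (lin_sum (phi_lin k)) mulr_sumr.
apply: le_trans (ler_norm_sum _ _ _) _; apply: ler_sum => j _.
rewrite (linZ FL) (linZ (phi_lin k)) -[_ *: _]/(_ * _) normrM.
by rewrite ler_wpM2r.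
Qed.

Lemma bound_ge0 (F : V -> V) : 0 <= bound F.
Proof. by apply: sumr_ge0 => k _; rewrite exprn_ge0 // sumr_ge0. Qed.

Lemma frame_coord_le k v : `|phi k v| ^+ 2 <= ip v v.
Proof.
rewrite /ip frame_ipE (bigD1 k) //= lerDl sumr_ge0 // => j _.
by rewrite exprn_ge0.
Qed.

Lemma frame_ip_bounded (F : V -> V) : linear F ->
  exists c : R[i], forall v, ip (F v) (F v) <= c * ip v v.
Proof.
move=> FL; exists (bound F) => v; rewrite [in leLHS](frame v).
rewrite mulrC -[X in _ <= X * _]sqrtCK; apply: frame_ip_bound => //.
  by rewrite sqrtC_ge0 frame_ip_ge0.
move=> j; rewrite -(ler_pXn2r (n := 2)) ?nnegrE ?sqrtC_ge0 ?frame_ip_ge0 //.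
by rewrite sqrtCK frame_coord_le.
Qed.

Lemma frame_ip_complete (u : nat -> V) :
  (forall eps : R[i], 0 < eps -> exists N, forall m n, (N <= m)%N -> (N <= n)%N ->
     ip (u m - u n) (u m - u n) < eps) ->
  exists l, forall eps : R[i], 0 < eps -> exists N, forall n, (N <= n)%N ->
     ip (u n - l) (u n - l) < eps.
Proof.
move=> uC.
have phiB k v w : phi k (v - w) = phi k v - phi k w.
  rewrite -[- w]scaleN1r addrC [LHS](phi_lin k) -[_ *: _]/(_ * _) mulN1r.
  by rewrite addrC.
have cvg k : exists c, forall eps : R[i], 0 < eps ->
    exists N, forall n, (N <= n)%N -> `|phi k (u n) - c| < eps.
  apply: complex_cauchy_cvg => eps eps0.
  have [N uN] := uC _ (exprn_gt0 2 eps0); exists N => m n mN nN.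
  rewrite -(ltr_pXn2r (n := 2)) ?nnegrE ?(ltW eps0) //.
  by rewrite -phiB; apply: le_lt_trans (frame_coord_le _ _) (uN _ _ mN nN).
have [c cP] := fin_all_exists cvg.
exists (\sum_k c k *: e k) => eps eps0.
(* Adding 1 makes the divisor positive and the final inequality strict: s ^ 2 times [bound id] is
   less than eps. *)
pose b := bound id + 1; have b0 : 0 < b by rewrite ltr_wpDl ?bound_ge0.
pose s := sqrtC (eps / b); have s0 : 0 < s by rewrite sqrtC_gt0 divr_gt0.
have [N NP] := fin_all_exists (fun k => cP k s s0).
exists (\max_k N k) => n le_n.
have -> : u n - \sum_k c k *: e k = \sum_k (phi k (u n) - c k) *: e k.
  rewrite {1}(frame (u n)) -sumrB; apply: eq_bigr => k _.
  by rewrite scalerBl.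
apply: (@le_lt_trans _ _ (s ^+ 2 * bound id)).
  apply: (frame_ip_bound (F := id)) => // [|j]; first exact: ltW.
  by apply/ltW/NP; apply: leq_trans le_n; apply: leq_bigmax.
rewrite sqrtCK -mulrA gtr_pMr // mulrC ltr_pdivrMr // mul1r.
by rewrite ltrDl.
Qed.

Definition frame_hilbert : hilbert R[i] :=
  @Hilbert _ V ip (fun w => frame_ip_lin phi_lin w)
    (fun v w => frame_ip_conj phi v w) (fun v => frame_ip_ge0 phi v)
    (@frame_ip_eq0 _ _ _ _ _ frame) frame_ip_complete.

End FrameHilbert.

Lemma left_tube_cstar (R : realType) (D : umfc R[i]) (M : left_module D) :
  is_cstar_weak_hopf (lwha M).
Proof.
have [N [E EP]] := lact_frames M.
have phiL := @tcoord_lin _ _ M N E; have fr := tcoord_vec EP.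
split.
- exact: lwha_weak_hopf.
- exact: ltstar_alin.
- exact: ltstarK.
- exact: ltstarM.
- exact: ltdelta_star.
exists (frame_hilbert phiL fr), (@ltmul _ _ M); split.
- exact: ltmul_lin2.
- move=> s; apply: (frame_ip_bounded phiL fr).
  by apply: lin_ltmulr; apply: lin_id.
- by split=> [t|s t r]; [apply: ltmul1l | rewrite -ltmulA].
- by move=> s t r; apply: (ltstar_adjoint EP).
by move=> s s0; rewrite -(ltmul1r s) s0.
Qed.

(** * Right modules *)

Section Reverse.
Variables (C : numClosedFieldType) (D : umfc C).

(** Reversal exchanges left and right duals, so evaluation and coevaluation must come from the other
    pair of duality maps, the daggers of [coev] and [ev]. *)
Definition rev_umfc_data : umfc_data C :=
  UmfcData (ucat_of_umfc := D) (ten := fun x y => y ⊗ x)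
    (fun x x' y y' f g => g ⊗m f) (fun x y z => (assoc z y x)†)
    (fun x => runit x) (fun x => lunit x) unit_irr unit_inc (dual := @dual C D)
    (fun x => (coev x)†) (fun x => (ev x)†).

Lemma bilinear2C (U V W : lmodType C) (B : U -> V -> W) :
  bilinear2 B -> bilinear2 (fun v u => B u v).
Proof. by case. Qed.

Lemma rev_is_umfc : is_umfc rev_umfc_data.
Proof.
have DP := umfcP D.
split; rewrite /=.
- by move=> x x' y y'; apply: bilinear2C; apply: tenm_bilinear DP _ _ _ _.
- by move=> x y; apply: tenm_id DP _ _.
- by move=> *; apply: tenm_comp DP _ _ _ _ _ _ _ _ _ _.
- by move=> *; apply: tenm_dag DP _ _ _ _ _ _.
- move=> x x' y y' z z' f g h.
  by have := assocV_nat (regular_action D) h g f => /= ->.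
- by move=> *; apply: runit_nat DP _ _ _.
- by move=> *; apply: lunit_nat DP _ _ _.
- by move=> x y z; have [? ?] := assoc_unitary DP z y x; split; rewrite dagKK.
- exact: runit_unitary DP.
- exact: lunit_unitary DP.
- move=> x y z w; have := congr1 (@dag _ _ _ _) (pentagon DP w z y x).
  by rewrite !dagM !(tenm_dag DP) !dag1 !compA.
- move=> x y; rewrite -(triangle DP) -compA.
  by rewrite (assoc_unitary DP y unito x).2 comp1r.
- exact: unit_inc_isom DP.
- exact: unit_decomp DP.
- move=> x; have := congr1 (@dag _ _ _ _) (zigzag_r DP x).
  by rewrite !dagM !(tenm_dag DP) !dag1 !dagKK !compA.
- move=> x; have := congr1 (@dag _ _ _ _) (zigzag_l DP x).
  by rewrite !dagM !(tenm_dag DP) !dag1 !dagKK !compA.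
move=> x /(spherical DP)[d [d0 dc de]]; exists d; split=> //.
  by move=> i iU i0; rewrite dagKK; apply: de.
by move=> i iU i0; rewrite dagKK; apply: dc.
Qed.

Definition rev_umfc : umfc C := Umfc rev_is_umfc.

Variable M : right_module D.

Definition rev_lmod_data : lmod_data rev_umfc :=
  LmodData (D := rev_umfc) (ucat_of_lmod := M) (lact := fun b m => m ⊲ b)
    (fun b b' m m' f g => g ⊲m f) (fun a b m => (rassoc m b a)†)
    (fun m => rmunit m) (fun m f => rtr f).

Lemma rev_lcap (b : D) (m : M) : @lcap C rev_umfc rev_lmod_data b m = rcap m b.
Proof. by rewrite /lcap /= dagKK. Qed.

Lemma rev_lcup (b : D) (m : M) : @lcup C rev_umfc rev_lmod_data b m = rcup m b.
Proof. by rewrite /lcup /= dagKK. Qed.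

Lemma rev_is_lmod : is_lmod rev_lmod_data.
Proof.
have MP := rmodP M.
split; rewrite /=.
- by move=> a a' m m'; apply: bilinear2C; apply: ractm_bilinear MP _ _ _ _.
- by move=> a m; apply: ractm_id MP _ _.
- by move=> *; apply: ractm_comp MP _ _ _ _ _ _ _ _ _ _.
- by move=> *; apply: ractm_dag MP _ _ _ _ _ _.
- move=> a a' b b' m m' f g h.
  have [_ aVK] := rassoc_unitary MP m b a.
  have [aK _] := rassoc_unitary MP m' b' a'.
  rewrite -[RHS]comp1l -aK -!compA; congr (_ ∘ _).
  by rewrite !compA (rassoc_nat MP) -compA aVK comp1r.
- by move=> *; apply: rmunit_nat MP _ _ _.
- by move=> a b m; have [? ?] := rassoc_unitary MP m b a; split; rewrite dagKK.
- exact: rmunit_unitary MP.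
- move=> a b c m; have := congr1 (@dag _ _ _ _) (rpentagon MP m c b a).
  by rewrite !dagM !(ractm_dag MP) !dag1 !compA.
- move=> a m; rewrite -(rtriangle MP) -compA.
  by rewrite (rassoc_unitary MP m unito a).2 comp1r.
- exact: rtr_linear MP.
- by move=> m n f g; apply: rtr_cyclic MP _ _ _ _.
- move=> a m f sa; rewrite (rtr_ptr MP _ sa); congr rtr.
  by rewrite /rptr /lptr rev_lcap rev_lcup.
exact: rtr_pos MP.
Qed.

Definition rev_lmod : left_module rev_umfc := LeftModule rev_is_lmod.

(** The two tube spaces are convertible, so each clause carries over as it stands, up to the double
    daggers that come from the reversed associators and duality maps. *)
Lemma rev_tube_algebra (H : wha_data (left_tube rev_lmod)) :
  is_left_tube_algebra H -> is_right_tube_algebra (H : wha_data (right_tube M)).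
Proof.
case=> h1 h2 h3 h4 h5 h6 h7 h8; split.
- exact: h1.
- move=> b b' d e f g e' f' nu zeta nu' zeta'.
  by have := h2 b b' d e f g e' f' nu zeta nu' zeta'; rewrite /= dagKK.
- exact: h3.
- exact: h4.
- exact: h5.
- exact: h6.
- move=> b d e f g nu zeta; have := h7 b d e f g nu zeta.
  by rewrite /lflat /lsharp rev_lcap rev_lcup.
move=> b d e f g nu zeta; have := h8 b d e f g nu zeta.
by rewrite /lflat /lsharp rev_lcap rev_lcup.
Qed.

End Reverse.

Theorem proposition12 (R : realType) (D : umfc R[i]) :
  (forall M : left_module D,
     exists H : wha_data (left_tube M),
       is_left_tube_algebra H /\ is_cstar_weak_hopf H) /\
  (forall M : right_module D,
     exists H : wha_data (right_tube M),
       is_right_tube_algebra H /\ is_cstar_weak_hopf H).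
Proof.
split=> M.
  exists (lwha M); split; first exact: lwha_tube_algebra.
  exact: left_tube_cstar.
exists (lwha (rev_lmod M)); split; last exact: (left_tube_cstar (rev_lmod M)).
exact: rev_tube_algebra (lwha_tube_algebra _).
Qed.
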